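(* Let $p,q\ge 1$ be integers. Equip each of the following compact symmetric spaces $\mathrm G/\mathrm H$ with the $\mathrm G$-invariant metric induced by $-B_{\mathfrak g}$, where $B_{\mathfrak g}$ is the Killing form of $\mathfrak g$, and regard its curvature operator $\mathfrak R$ as an operator on $\mathfrak h$. Then: (a) for the complex Grassmannian $\mathrm{SU}(p+q)/\mathrm S(\mathrm U(p)\times \mathrm U(q))=\mathrm U(p+q)/(\mathrm U(p)\times\mathrm U(q))$, with $\mathfrak h=\mathfrak u(1)\oplus\mathfrak{su}(p)\oplus\mathfrak{su}(q)$, $$\mathfrak R=\tfrac12 I_{\mathfrak u(1)}\oplus\tfrac12\tfrac{q}{p+q}I_{\mathfrak{su}(p)}\oplus\tfrac12\tfrac{p}{p+q}I_{\mathfrak{su}(q)};$$ (b) for the quaternionic Grassmannian $\mathrm{Sp}(p+q)/(\mathrm{Sp}(p)\times\mathrm{Sp}(q))$, with $\mathfrak h=\mathfrak{sp}(p)\oplus\mathfrak{sp}(q)$, $$\mathfrak R=\tfrac12\tfrac{q}{p+q+1}I_{\mathfrak{sp}(p)}\oplus\tfrac12\tfrac{p}{p+q+1}I_{\mathfrak{sp}(q)};$$ (c) for the real (oriented) Grassmannian $\mathrm{SO}(p+q)/(\mathrm{SO}(p)\times\mathrm{SO}(q))$ with $p+q\ge 3$, with $\mathfrak h=\mathfrak{so}(p)\oplus\mathfrak{so}(q)$, $$\mathfrak R=\tfrac12\tfrac{q}{p+q-2}I_{\mathfrak{so}(p)}\oplus\tfrac12\tfrac{p}{p+q-2}I_{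\mathfrak{so}(q)}.$$
   Context: Here $\mathfrak h$ is embedded block-diagonally in $\mathfrak g$, and in (a) $\mathfrak u(1)$ denotes the one-dimensional center of $\mathfrak h$; $\mathfrak{su}(1)=\mathfrak{so}(1)=0$. Let $\mathfrak g=\mathfrak h\oplus\mathfrak p$ be the $B_{\mathfrak g}$-orthogonal decomposition; the tangent space of $M=\mathrm G/\mathrm H$ at the base point is identified with $\mathfrak p$, and the metric $g$ is given on $\mathfrak p$ by the restriction of $-B_{\mathfrak g}$. Curvature operator: the Riemann curvature tensor $R$ is normalized so that $\sec(X,Y)=R(X,Y,X,Y)$ for orthonormal $X,Y$. The metric on $\bigwedge^2TM$ is the tensor metric, so $|X\wedge Y|^2=2$ for orthonormal $X,Y$. The curvature operator is the symmetric map $\mathfrak R:\bigwedge^2TM\to\bigwedge^2TM$ defined by $g(\mathfrak R(X\wedge Y),Z\wedge W)=2R(X,Y,Z,W)$. The space $\bigwedge^2TM$ is identified with $\mathfrak{so}(TM)$ by sending $X\wedge Y$ to $Z\mapsto g(X,Z)Y-g(Y,Z)X$. The algebra $\mathfrak h$ is identified with the subspace $\operatorname{ad}_{\mathfrak h}|_{\mathfrak p}\subset\mathfrak{so}(\mathfrak p)=\bigwedge^2\mathfrak p$ via the injective map $Z\mapsto\operatorname{ad}_Z|_{\mathfrak p}$. The image of $\mathfrak R$ lies in this subspace, so $\mathfrak R$ is determined by its restriction to it, and in this sense is viewed as an operator on $\mathfrak h$. *)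

(* Defs.v *)
From HB Require Import structures.
From mathcomp Require Import all_boot all_order all_algebra all_field.
From mathcomp Require Import ring.
From mathcomp Require Import complex.
From mathcomp Require Import all_classical all_reals all_analysis.

Set Implicit Arguments.
Unset Strict Implicit.
Unset Printing Implicit Defensive.

Import Order.TTheory GRing.Theory Num.Theory.
Import numFieldNormedType.Exports.

Local Open Scope classical_set_scope.
Local Open Scope ring_scope.

(* Finite-dimensional associative unital algebras over [R] with a linear
   anti-involution; the instances below are R, C and the quaternions. *)
HB.mixin Record hasStar (R : fieldType) K of GRing.Algebra R K := {
  star : K -> K;
  star_linear : linear star;
  starK : involutive star;
  starM : forall x y : K, star (x * y) = star y * star x }.

#[short(type="starAlgType")]
HB.structure Definition StarAlgebra (R : fieldType) :=
  {K of Falgebra R K & hasStar R K}.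

Section RealStar.
Variable R : fieldType.

Fact real_star_linear : linear (@idfun R^o). Proof. by []. Qed.
Fact real_starK : involutive (@idfun R^o). Proof. by []. Qed.
Fact real_starM (x y : R^o) : idfun (x * y) = idfun y * idfun x.
Proof. exact: mulrC. Qed.
HB.instance Definition _ :=
  hasStar.Build R R^o real_star_linear real_starK real_starM.
End RealStar.

(* [Rcomplex R] is the copy of [R[i]] carrying the module structure over [R]. *)
Section ComplexStar.
Variable R : rcfType.
Local Notation C := (Rcomplex R).

HB.instance Definition _ := GRing.Lalgebra_isComAlgebra.Build R C.

Fact complex_vect_iso : Vector.axiom 2 C.
Proof.
pose f (x : C) : 'rV[R]_2 := \row_i (if i == 0 then complex.Re x else complex.Im x).
exists f.
  by move=> a [x1 x2] [y1 y2]; apply/rowP=> i; rewrite !mxE; case: ifP.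
exists (fun v : 'rV_2 => Complex (v 0 0) (v 0 1)) => [[x1 x2]|v].
  by rewrite !mxE.
by apply/rowP=> -[[|[|//]] ?]; rewrite mxE /=; congr (v _ _); apply: val_inj.
Qed.
HB.instance Definition _ := Lmodule_hasFinDim.Build R C complex_vect_iso.

Fact complex_star_linear : linear (@conjc R : C -> C).
Proof. by move=> a x y; rewrite linearP. Qed.
Fact complex_starK : involutive (@conjc R : C -> C).
Proof. exact: conjcK. Qed.
Fact complex_starM (x y : C) : conjc (x * y) = conjc y * conjc x :> C.
Proof. by rewrite rmorphM mulrC. Qed.
HB.instance Definition _ :=
  hasStar.Build R C complex_star_linear complex_starK complex_starM.
End ComplexStar.

(* [Quat a b c d] is a + b i + c j + d k. *)
Record quat (R : Type) : Type := Quat { qre : R; qi : R; qj : R; qk : R }.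

Section QuatChoice.
Variable R : Type.
Definition tuple_of_quat (x : quat R) := (qre x, qi x, qj x, qk x).
Definition quat_of_tuple (x : R * R * R * R) :=
  let: (a, b, c, d) := x in Quat a b c d.
Lemma tuple_of_quatK : cancel tuple_of_quat quat_of_tuple.
Proof. by case. Qed.
End QuatChoice.

HB.instance Definition _ (R : choiceType) :=
  Choice.copy (quat R) (can_type (@tuple_of_quatK R)).

Section Quaternions.
Variable R : fieldType.
Implicit Types x y z : quat R.

Definition addq x y :=
  Quat (qre x + qre y) (qi x + qi y) (qj x + qj y) (qk x + qk y).
Definition oppq x := Quat (- qre x) (- qi x) (- qj x) (- qk x).
Definition mulq x y :=
  Quat (qre x * qre y - qi x * qi y - qj x * qj y - qk x * qk y)
       (qre x * qi y + qi x * qre y + qj x * qk y - qk x * qj y)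
       (qre x * qj y - qi x * qk y + qj x * qre y + qk x * qi y)
       (qre x * qk y + qi x * qj y - qj x * qi y + qk x * qre y).
Definition scaleq (a : R) x := Quat (a * qre x) (a * qi x) (a * qj x) (a * qk x).
Definition conjq x := Quat (qre x) (- qi x) (- qj x) (- qk x).

Fact addqA : associative addq.
Proof. by move=> x y z; congr Quat; rewrite /= addrA. Qed.
Fact addqC : commutative addq.
Proof. by move=> x y; congr Quat; rewrite /= addrC. Qed.
Fact add0q : left_id (Quat 0 0 0 0) addq.
Proof. by case=> *; congr Quat; rewrite /= add0r. Qed.
Fact addNq : left_inverse (Quat 0 0 0 0) oppq addq.
Proof. by move=> x; congr Quat; rewrite /= addNr. Qed.
HB.instance Definition _ := GRing.isZmodule.Build (quat R) addqA addqC add0q addNq.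

Fact mulqA : associative mulq.
Proof. by move=> x y z; congr Quat => /=; ring. Qed.
Fact mul1q : left_id (Quat 1 0 0 0) mulq.
Proof. by case=> *; congr Quat => /=; ring. Qed.
Fact mulq1 : right_id (Quat 1 0 0 0) mulq.
Proof. by case=> *; congr Quat => /=; ring. Qed.
Fact mulqDl : left_distributive mulq +%R.
Proof. by move=> x y z; congr Quat => /=; ring. Qed.
Fact mulqDr : right_distributive mulq +%R.
Proof. by move=> x y z; congr Quat => /=; ring. Qed.
Fact oneq_neq0 : Quat 1 0 0 0 != 0 :> quat R.
Proof. by apply/eqP=> -[] /eqP; rewrite oner_eq0. Qed.
HB.instance Definition _ := GRing.Zmodule_isNzRing.Build (quat R)
  mulqA mul1q mulq1 mulqDl mulqDr oneq_neq0.

Fact scaleqA (a b : R) x : scaleq a (scaleq b x) = scaleq (a * b) x.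
Proof. by congr Quat; rewrite /= mulrA. Qed.
Fact scale1q : left_id 1 scaleq.
Proof. by case=> *; congr Quat; rewrite /= mul1r. Qed.
Fact scaleqDr : right_distributive scaleq +%R.
Proof. by move=> a x y; congr Quat; rewrite /= mulrDr. Qed.
Fact scaleqDl x : {morph scaleq^~ x : a b / a + b}.
Proof. by move=> a b; congr Quat; rewrite /= mulrDl. Qed.
HB.instance Definition _ := GRing.Zmodule_isLmodule.Build R (quat R)
  scaleqA scale1q scaleqDr scaleqDl.

Fact scaleqAl (a : R) x y : a *: (x * y) = (a *: x) * y.
Proof. by congr Quat => /=; ring. Qed.
HB.instance Definition _ := GRing.Lmodule_isLalgebra.Build R (quat R) scaleqAl.
Fact scaleqAr (a : R) x y : a *: (x * y) = x * (a *: y).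
Proof. by congr Quat => /=; ring. Qed.
HB.instance Definition _ := GRing.Lalgebra_isAlgebra.Build R (quat R) scaleqAr.

Fact quat_vect_iso : Vector.axiom 4 (quat R).
Proof.
pose f x : 'rV[R]_4 := \row_i [:: qre x; qi x; qj x; qk x]`_i.
exists f.
  by move=> a x y; apply/rowP=> -[[|[|[|[|//]]]] ?]; rewrite !mxE.
pose o k : 'I_4 := inord k.
exists (fun v : 'rV_4 => Quat (v 0 (o 0%N)) (v 0 (o 1%N)) (v 0 (o 2%N)) (v 0 (o 3%N))).
  by case=> *; rewrite !mxE !inordK.
move=> v; apply/rowP=> -[[|[|[|[|//]]]] ?]; rewrite mxE /=;
by congr (v _ _); apply: val_inj; rewrite /= inordK.
Qed.
HB.instance Definition _ := Lmodule_hasFinDim.Build R (quat R) quat_vect_iso.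
HB.instance Definition _ := Algebra_isFalgebra.Build R (quat R).

Fact conjq_linear : linear conjq.
Proof. by move=> a x y; congr Quat => /=; ring. Qed.
Fact conjqK : involutive conjq.
Proof. by case=> *; congr Quat; rewrite /= opprK. Qed.
Fact conjqM x y : conjq (x * y) = conjq y * conjq x.
Proof. by congr Quat => /=; ring. Qed.
HB.instance Definition _ := hasStar.Build R (quat R) conjq_linear conjqK conjqM.
End Quaternions.

(* The type ['M[K]_n] regarded as a vector space over [R] rather than over [K]. *)
Definition kmx (R : fieldType) (K : starAlgType R) (n : nat) : Type := 'M[K]_n.

Section KMatrix.
Variables (R : fieldType) (K : starAlgType R) (n : nat).
Local Notation V := (kmx K n).

HB.instance Definition _ := GRing.Zmodule.copy V 'M[K]_n.

Definition scalekmx (a : R) (X : V) : V := \matrix_(i, j) (a *: X i j).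

Fact scalekmxA a b X : scalekmx a (scalekmx b X) = scalekmx (a * b) X.
Proof. by apply/matrixP=> i j; rewrite !mxE scalerA. Qed.
Fact scale1kmx : left_id 1 scalekmx.
Proof. by move=> X; apply/matrixP=> i j; rewrite !mxE scale1r. Qed.
Fact scalekmxDr : right_distributive scalekmx +%R.
Proof. by move=> a X Y; apply/matrixP=> i j; rewrite !mxE scalerDr. Qed.
Fact scalekmxDl X : {morph scalekmx^~ X : a b / a + b}.
Proof. by move=> a b; apply/matrixP=> i j; rewrite !mxE scalerDl. Qed.
HB.instance Definition _ := GRing.Zmodule_isLmodule.Build R V
  scalekmxA scale1kmx scalekmxDr scalekmxDl.

Lemma kmxZE (a : R) (X : V) i j : (a *: X) i j = a *: X i j.
Proof. by rewrite mxE. Qed.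

Import VectorInternalTheory.
Fact kmx_vect_iso : Vector.axiom (dim {ffun 'I_n * 'I_n -> K}) V.
Proof.
pose toff (X : V) : {ffun 'I_n * 'I_n -> K} := [ffun ij => X ij.1 ij.2].
pose offf (f : {ffun 'I_n * 'I_n -> K}) : V := \matrix_(i, j) f (i, j).
exists (fun X => v2r (toff X)).
  move=> a X Y; have ->: toff (a *: X + Y) = a *: toff X + toff Y.
    by apply/ffunP=> ij; rewrite !ffunE !mxE.
  exact: linearP.
exists (fun r => offf (r2v r)) => [X|r].
  by rewrite v2rK; apply/matrixP=> i j; rewrite mxE ffunE.
apply: (canLR r2vK); apply/ffunP=> -[i j].
by rewrite ffunE mxE.
Qed.
HB.instance Definition _ := Lmodule_hasFinDim.Build R V kmx_vect_iso.

Definition lbr (X Y : V) : V := X *m Y - Y *m X.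

Definition star_tr (X : V) : V := (map_mx star X)^T.

Lemma lbr_linearr X : linear (lbr X).
Proof.
move=> a Y Z; apply/matrixP=> i j; rewrite !mxE scalerBr !scaler_sumr.
rewrite addrACA -opprD -!big_split /=; congr (_ - _); apply: eq_bigr => k _.
  by rewrite !mxE mulrDr scalerAr.
by rewrite !mxE mulrDl scalerAl.
Qed.

Lemma lbrC X Y : lbr X Y = - lbr Y X. Proof. by rewrite opprB. Qed.

Lemma lbr_linearl Y : linear (lbr^~ Y).
Proof. by move=> a X Z /=; rewrite !(lbrC _ Y) lbr_linearr opprD scalerN. Qed.

Lemma star_tr_linear : linear star_tr.
Proof. by move=> a X Y; apply/matrixP=> i j; rewrite !mxE star_linear. Qed.

End KMatrix.

Section Coordinates.
Variables (R : realType) (m : nat).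

Definition pderiv (W : normedModType R) (i : 'I_m) (f : 'rV[R]_m -> W)
  (x : 'rV[R]_m) : W := 'D_(delta_mx 0 i) f x.

Fixpoint Ck (W : normedModType R) (k : nat) (U : set 'rV[R]_m)
    (f : 'rV[R]_m -> W) : Prop :=
  match k with
  | 0 => forall x, U x -> {for x, continuous f}
  | k'.+1 => forall i : 'I_m,
      (forall x, U x -> derivable f x (delta_mx 0 i)) /\
      Ck k' U (pderiv i f)
  end.

(* Levi-Civita connection and curvature of the Riemannian metric
   g = sum_(i,j) g_ij dx^i dx^j. *)
Variable g : 'rV[R]_m -> 'M[R]_m.

Definition christoffel (l i j : 'I_m) (x : 'rV[R]_m) : R :=
  2^-1 * \sum_h invmx (g x) l h *
    (pderiv i (fun y => g y j h) x + pderiv j (fun y => g y i h) x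
     - pderiv h (fun y => g y i j) x).

(* The component dx^l (R(d_i, d_j) d_k), where
   R(X, Y) = [nabla_X, nabla_Y] - nabla_[X, Y]. *)
Definition riemann_up (l k i j : 'I_m) (x : 'rV[R]_m) : R :=
  pderiv i (christoffel l j k) x - pderiv j (christoffel l i k) x
  + \sum_h (christoffel l i h x * christoffel h j k x
            - christoffel l j h x * christoffel h i k x).

(* R_ijkl = g(R(d_i, d_j) d_l, d_k), so that sec(X, Y) = R(X, Y, X, Y). *)
Definition riemann (i j k l : 'I_m) (x : 'rV[R]_m) : R :=
  \sum_h g x k h * riemann_up h l i j x.

End Coordinates.

Lemma mem_lker_linfun (R : fieldType) (V W : vectType R) (f : V -> W) x :
  linear f -> (x \in lker (linfun f)) = (f x == 0).
Proof.
move=> f_lin.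
pose fL : {linear V -> W} := HB.pack f (GRing.isLinear.Build R V W _ f f_lin).
by rewrite memv_ker (lfunE fL).
Qed.

Lemma linfunE (R : fieldType) (V W : vectType R) (f : V -> W) x :
  linear f -> linfun f x = f x.
Proof.
move=> f_lin.
pose fL : {linear V -> W} := HB.pack f (GRing.isLinear.Build R V W _ f f_lin).
exact: (lfunE fL).
Qed.

Lemma memv_bigcap_basis (R : fieldType) (V W : vectType R) (h : {vspace V})
    (f : V -> V -> W) x :
  (forall y, linear (f y)) -> (forall z, linear (f^~ z)) ->
  reflect (forall y, y \in h -> f y x = 0)
    (x \in (\bigcap_(i < \dim h) lker (linfun (f (vbasis h)`_i)))%VS).
Proof.
move=> f_linr f_linl; apply: (iffP idP) => [x_in y y_h|xP].
  pose fL : {linear V -> W} :=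
    HB.pack (f^~ x) (GRing.isLinear.Build R V W _ (f^~ x) (f_linl x)).
  rewrite -[LHS]/(fL y) (coord_vbasis y_h) linear_sum big1 // => i _.
  rewrite linearZ /=; have : x \in lker (linfun (f (vbasis h)`_i)).
    by move: x_in; rewrite memvE => /subv_bigcapP/(_ i isT); rewrite -memvE.
  by rewrite mem_lker_linfun // => /eqP ->; rewrite scaler0.
rewrite memvE; apply/subv_bigcapP => i _.
by rewrite -memvE mem_lker_linfun // xP // vbasis_mem // mem_nth ?size_tuple.
Qed.

Definition lftr (R : fieldType) (W : vectType R) (f : 'End(W)) : R :=
  \tr (passmx.mxof (vbasis {:W}) (vbasis {:W}) f).

Section Trace.
Import passmx.
Variables (R : fieldType) (W : vectType R).

Lemma lftr_linear : linear (@lftr R W : 'End(W) -> R^o).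
Proof. by move=> a f g; rewrite /lftr linearP /= linearP. Qed.

Lemma lftrE (f : 'End(W)) :
  lftr f = \sum_i coord (vbasis {:W}) i (f (vbasis {:W})`_i).
Proof.
apply: eq_bigr => i _; rewrite /passmx.mxof mxE /= mxE.
congr (coord _ _ (f _)); rewrite /passmx.vecof (bigD1 i) //= big1 => [|j ji].
  by rewrite mxE !eqxx scale1r addr0.
by rewrite mxE eqxx (negPf ji) scale0r.
Qed.

Lemma lftrC (f g : 'End(W)) : lftr (f \o g)%VF = lftr (g \o f)%VF.
Proof.
by rewrite /lftr !(mxof_comp _ _ (vbasisP _)) mxtrace_mulC.
Qed.

Lemma lftr_rank1 (f : W -> R^o) (w : W) :
  linear f -> lftr (linfun (fun u => f u *: w)) = f w.
Proof.
move=> f_lin.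
pose fL : {linear W -> R^o} := HB.pack f (GRing.isLinear.Build R W R^o _ f f_lin).
rewrite lftrE -[RHS]/(fL w) {2}(coord_vbasis (memvf w)) linear_sum.
apply: eq_bigr => i _; rewrite linearZ /= linfunE; last first.
  by move=> a u v; rewrite f_lin scalerDl scalerA.
by rewrite linearZ /= mulrC.
Qed.

End Trace.

Section Killing.
Variables (R : fieldType) (K : starAlgType R) (n : nat).
Local Notation V := (kmx K n).
Implicit Types g h : {vspace V}.

(* [vsproj g] is the identity on [g]; it only serves to land in the type of
   elements of [g]. *)
Definition adm g (X : V) : 'End(subvs_of g) :=
  linfun (fun Y : subvs_of g => vsproj g (lbr X (vsval Y))).

Definition killing g (X Y : V) : R := lftr (adm g X \o adm g Y)%VF.

Definition orthk g h : {vspace V} :=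
  (g :&: \bigcap_(i < \dim h)
            lker (linfun (killing g (vbasis h)`_i : V -> R^o)))%VS.

Definition centerv h : {vspace V} :=
  (h :&: \bigcap_(i < \dim h) lker (linfun (lbr (vbasis h)`_i)))%VS.

Lemma adm_linear g : linear (adm g).
Proof.
move=> a X Y; apply/lfunP=> Z; rewrite add_lfunE scale_lfunE !linfunE.
- by rewrite lbr_linearl linearP.
- by move=> c U W; rewrite linearP lbr_linearr linearP.
- by move=> c U W; rewrite linearP lbr_linearr linearP.
by move=> c U W; rewrite linearP lbr_linearr linearP.
Qed.

Lemma killingC g X Y : killing g X Y = killing g Y X.
Proof. exact: lftrC. Qed.

Lemma killing_linearr g X : linear (killing g X : V -> R^o).
Proof.
move=> a Y Z; rewrite /killing adm_linear comp_lfunDr -comp_lfunZr.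
exact: lftr_linear.
Qed.

Lemma killing_linearl g Y : linear (killing g ^~ Y : V -> R^o).
Proof. by move=> a X Z; rewrite !(killingC g _ Y) killing_linearr. Qed.

Lemma memv_orthk g h X :
  reflect (X \in g /\ forall Y, Y \in h -> killing g Y X = 0) (X \in orthk g h).
Proof.
rewrite memv_cap; have P := memv_bigcap_basis h X (killing_linearr g)
  (killing_linearl g).
by apply: (iffP andP) => -[? /P].
Qed.

Lemma memv_centerv h X :
  reflect (X \in h /\ forall Y, Y \in h -> lbr Y X = 0) (X \in centerv h).
Proof.
rewrite memv_cap; have P := memv_bigcap_basis h X (@lbr_linearr R K n)
  (@lbr_linearl R K n).
by apply: (iffP andP) => -[? /P].
Qed.

End Killing.

(* The homogeneous space M = G/H near its base point, where [G] is a group of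
   matrices X with star_tr X *m X = 1, and [g], [h] are the Lie algebras of
   G and H.  Locally, M depends on H only through [h]. *)
Section Homogeneous.
Variables (R : realType) (K : starAlgType R) (n : nat).
Local Notation V := (kmx K n).
Variables (G : set V) (g h : {vspace V}).
Local Notation p := (orthk g h).
Local Notation m := (\dim p).
Local Notation TM := (subvs_of p).
Local Notation b := (vbasis {:V}).

(* Projection of g = h (+) p onto p. *)
Definition projp (X : V) : TM := vsproj p (daddv_pi p h X).

Definition metricM (X Y : TM) : R := - killing g (vsval X) (vsval Y).

Definition pderivV (s : 'rV[R]_m -> V) (i : 'I_m) (x : 'rV[R]_m) : V :=
  passmx.vecof b (pderiv i (fun y => passmx.rVof b (s y)) x).

(* s^-1 d_i s, the Maurer-Cartan form of G pulled back by s. *)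
Definition mcform (s : 'rV[R]_m -> V) (i : 'I_m) (x : 'rV[R]_m) : V :=
  star_tr (s x) *m pderivV s i x.

(* The tangent vector d_i of the parametrization x |-> s(x)H of M, translated
   to the base point by s(x)^-1. *)
Definition frame (s : 'rV[R]_m -> V) (x : 'rV[R]_m) : m.-tuple TM :=
  [tuple projp (mcform s i x) | i < m].

(* A smooth local lift to G, with s(0) = 1, of a parametrization x |-> s(x)H of
   a neighbourhood of the base point of M.  Every smooth local parametrization
   of M at the base point has such a lift, G -> G/H being a smooth bundle;
   x |-> exp (sum_i x_i e_i), for a basis (e_i) of p, is an example. *)
Definition local_param (s : 'rV[R]_m -> V) : Prop :=
  [/\ s 0 = 1%:M,
      exists U : set 'rV[R]_m,
        [/\ open U, U 0, (forall x, U x -> G (s x)) &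
            forall k, Ck k U (fun x => passmx.rVof b (s x))] &
      basis_of {:TM} (frame s 0)].

(* The G-invariant metric of M in the coordinates defined by [s]. *)
Definition metric_coord (s : 'rV[R]_m -> V) (x : 'rV[R]_m) : 'M[R]_m :=
  \matrix_(i, j) metricM (tnth (frame s x) i) (tnth (frame s x) j).

(* The Riemann curvature tensor of M at the base point. *)
Definition curvature (s : 'rV[R]_m -> V) (X Y Z W : TM) : R :=
  \sum_i \sum_j \sum_k \sum_l
    coord (frame s 0) i X * coord (frame s 0) j Y *
    coord (frame s 0) k Z * coord (frame s 0) l W *
    riemann (metric_coord s) i j k l 0.

Definition skewM (A : 'End(TM)) : Prop :=
  forall X Y, metricM (A X) Y = - metricM X (A Y).

(* Bivectors of TM are skew endomorphisms. *)
Definition wedge (X Y : TM) : 'End(TM) :=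
  linfun (fun Z : TM => metricM X Z *: Y - metricM Y Z *: X).

(* On skew endomorphisms, the tensor metric tr (A^T B); see [inner2_wedge]. *)
Definition inner2 (A B : 'End(TM)) : R := - lftr (A \o B)%VF.

Lemma metricMC X Y : metricM X Y = metricM Y X.
Proof. by rewrite /metricM killingC. Qed.

Lemma metricM_linear X : linear (metricM X : TM -> R^o).
Proof.
move=> a Y Z; rewrite /metricM linearP killing_linearr opprD.
by rewrite -scalerN.
Qed.

Lemma wedgeE X Y Z : wedge X Y Z = metricM X Z *: Y - metricM Y Z *: X.
Proof.
rewrite linfunE // => a U W; rewrite !metricM_linear !scalerDl !scalerBr.
by rewrite -!scalerA opprD addrACA.
Qed.

Lemma inner2_wedge X Y Z W :
  inner2 (wedge X Y) (wedge Z W) =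
  2 * (metricM X Z * metricM Y W - metricM X W * metricM Y Z).
Proof.
pose r X Y : 'End(TM) := linfun (fun U => (metricM X U : R^o) *: Y).
have trr X' Y' : lftr (r X' Y') = metricM X' Y'.
  exact/lftr_rank1/metricM_linear.
have rE X' Y' U : r X' Y' U = metricM X' U *: Y'.
  by rewrite linfunE // => a U1 U2; rewrite metricM_linear scalerDl scalerA.
rewrite /inner2; have -> : (wedge X Y \o wedge Z W)%VF =
    metricM X W *: r Z Y - metricM Y W *: r Z X
    - metricM X Z *: r W Y + metricM Y Z *: r W X.
  apply/lfunP=> U; rewrite comp_lfunE (wedgeE Z W) linearB !linearZ /= !wedgeE.
  rewrite !(add_lfunE, opp_lfunE, scale_lfunE) !rE !scalerBr !scalerA.
  rewrite !scalerN scalerBr !scalerA opprB.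
  rewrite (mulrC (metricM Z U)) (mulrC (metricM Z U)) !(mulrC (metricM W U)).
  by rewrite -[RHS]addrA [- _ + _ in RHS]addrC.
pose tL : {linear 'End(TM) -> R^o} :=
  HB.pack (@lftr R TM : 'End(TM) -> R^o)
    (GRing.isLinear.Build R 'End(TM) R^o _ _ (@lftr_linear R TM)).
rewrite -[lftr _]/(tL _) linearD !linearB !linearZ /= !trr.
rewrite (metricMC Z Y) (metricMC Z X) (metricMC W Y) (metricMC W X).
rewrite -![_ *: _]/(_ * _).
ring.
Qed.

(* Only the restriction of [F] to skew endomorphisms matters. *)
Definition is_curvature_operator (s : 'rV[R]_m -> V) (F : 'End('End(TM))) : Prop :=
  [/\ forall A, skewM A -> skewM (F A),
      forall A B, skewM A -> skewM B -> inner2 (F A) B = inner2 A (F B) &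
      forall X Y Z W,
        inner2 (F (wedge X Y)) (wedge Z W) = 2 * curvature s X Y Z W].

Definition adp (Z : V) : 'End(TM) :=
  linfun (fun Y : TM => vsproj p (lbr Z (vsval Y))).

(* The curvature operator, viewed as an operator on h through the embedding
   [adp] of h into the skew endomorphisms, is [T]. *)
Definition curvature_operator_on_h (s : 'rV[R]_m -> V)
    (T : 'End(subvs_of h)) : Prop :=
  exists F : 'End('End(TM)),
    [/\ is_curvature_operator s F,
        forall A, skewM A -> exists Z : subvs_of h, F A = adp (vsval Z) &
        forall Z : subvs_of h, F (adp (vsval Z)) = adp (vsval (T Z))].

End Homogeneous.
Arguments local_param {R K n} G g h s.
Arguments curvature_operator_on_h {R K n} g h s T.

Definition scalar_on (R : fieldType) (W : vectType R) (h : {vspace W})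
    (T : 'End(subvs_of h)) (u : {vspace W}) (c : R) : Prop :=
  forall Z : subvs_of h, vsval Z \in u -> T Z = c *: Z.

Section Blocks.
Variables (R : fieldType) (K : starAlgType R) (p q : nat).

Definition blockdiag : {vspace kmx K (p + q)} :=
  lker (linfun (fun X : kmx K (p + q) =>
    block_mx 0 (ursubmx X) (dlsubmx X) 0 : kmx K (p + q))).

Definition emb_l (u : {vspace kmx K p}) : {vspace kmx K (p + q)} :=
  (linfun (fun A : kmx K p => block_mx A 0 0 0 : kmx K (p + q)) @: u)%VS.

Definition emb_r (u : {vspace kmx K q}) : {vspace kmx K (p + q)} :=
  (linfun (fun D : kmx K q => block_mx 0 0 0 D : kmx K (p + q)) @: u)%VS.

Lemma memv_blockdiag (X : kmx K (p + q)) :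
  (X \in blockdiag) = (ursubmx X == 0) && (dlsubmx X == 0).
Proof.
rewrite mem_lker_linfun => [|a Y Z]; last first.
  apply/matrixP=> i j; rewrite !mxE.
  case: fintype.split => k; rewrite !mxE; case: fintype.split => l;
    by rewrite !mxE ?scaler0 ?addr0.
apply/eqP/andP=> [|[/eqP -> /eqP ->]]; last exact: block_mx0.
rewrite -[RHS](@block_mx0 _ p q p q) => /eq_block_mx[_ -> -> _].
by rewrite !eqxx.
Qed.

Lemma memv_emb_l (u : {vspace kmx K p}) (X : kmx K (p + q)) :
  reflect (exists2 A, A \in u & X = block_mx A 0 0 0) (X \in emb_l u).
Proof.
have lin : linear (fun A : kmx K p => block_mx A 0 0 0 : kmx K (p + q)).
  move=> a A B; apply/matrixP=> i j; rewrite !mxE.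
  case: fintype.split => k; rewrite !mxE; case: fintype.split => l;
    by rewrite !mxE ?scaler0 ?addr0.
by apply: (iffP memv_imgP) => -[A Au ->]; exists A; rewrite // linfunE.
Qed.

Lemma memv_emb_r (u : {vspace kmx K q}) (X : kmx K (p + q)) :
  reflect (exists2 D, D \in u & X = block_mx 0 0 0 D) (X \in emb_r u).
Proof.
have lin : linear (fun D : kmx K q => block_mx 0 0 0 D : kmx K (p + q)).
  move=> a A B; apply/matrixP=> i j; rewrite !mxE.
  case: fintype.split => k; rewrite !mxE; case: fintype.split => l;
    by rewrite !mxE ?scaler0 ?addr0.
by apply: (iffP memv_imgP) => -[D Du ->]; exists D; rewrite // linfunE.
Qed.

End Blocks.

Section Classical.
Variables (R : fieldType) (K : starAlgType R) (n : nat).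

Definition skewherm : {vspace kmx K n} :=
  lker (linfun (fun X : kmx K n => X + star_tr X)).

Definition traceless : {vspace kmx K n} :=
  lker (linfun (fun X : kmx K n => \tr (X : 'M[K]_n))).

(* For each of the three algebras a one-sided inverse is two-sided. *)
Definition unitary_set : set (kmx K n) :=
  [set X : kmx K n | star_tr X *m X = 1%:M].

Lemma memv_skewherm (X : kmx K n) : (X \in skewherm) = (star_tr X == - X).
Proof.
rewrite mem_lker_linfun ?addr_eq0 => [|a Y Z]; first by rewrite -eqr_oppLR eq_sym.
by rewrite star_tr_linear scalerDr addrACA.
Qed.

Lemma memv_traceless (X : kmx K n) :
  (X \in traceless) = (\tr (X : 'M[K]_n) == 0).
Proof.
rewrite mem_lker_linfun // => a Y Z; rewrite /mxtrace scaler_sumr -big_split.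
by apply: eq_bigr => i _; rewrite !mxE.
Qed.

End Classical.

Section ClassicalGroups.
Variables (R : realType) (n : nat).

Definition lie_so : {vspace kmx R^o n} := skewherm R^o n.
Definition lie_su : {vspace kmx (Rcomplex R) n} :=
  (skewherm (Rcomplex R) n :&: traceless (Rcomplex R) n)%VS.
Definition lie_sp : {vspace kmx (quat R) n} := skewherm (quat R) n.

Definition grp_SO : set (kmx R^o n) :=
  [set X | unitary_set X /\ \det (X : 'M[R^o]_n) = 1].
Definition grp_SU : set (kmx (Rcomplex R) n) :=
  [set X | unitary_set X /\ \det (X : 'M[Rcomplex R]_n) = 1].
Definition grp_Sp : set (kmx (quat R) n) := @unitary_set R (quat R) n.

End ClassicalGroups.
Arguments grp_SO : clear implicits.
Arguments grp_SU : clear implicits.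
Arguments grp_Sp : clear implicits.

(* Main.v *)
From HB Require Import structures.
Require Import Defs.
From mathcomp Require Import all_boot all_order all_algebra complex.
From mathcomp Require Import fingroup perm.
From mathcomp Require Import all_classical all_reals all_analysis.
From mathcomp Require Import ring lra.
Set Implicit Arguments.
Unset Strict Implicit.
Unset Printing Implicit Defensive.
Import Order.TTheory GRing.Theory Num.Theory.
Import numFieldNormedType.Exports.
Local Open Scope classical_set_scope.
Local Open Scope ring_scope.

(* A local lift [s] of a parametrization has Maurer-Cartan form
   theta_i = s^-1 d_i s.  Splitting theta = e + w along g = p + h, the
   p-part e is a coframe carrying the metric to the fixed form -B, the h-part
   w is the connection form, and the structure equation
   d_i theta_j - d_j theta_i = - [theta_i, theta_j] says that the connection
   is torsion-free and has curvature - ad [e_i, e_j].  Hence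
   R(X, Y, Z, W) = B([[X, Y], W], Z), and the curvature operator is ad o L,
   where L maps the bivector of X and Y to [X, Y].  On h it becomes
   T = L o ad, which satisfies 2 B(Z, T W) = tr_p (ad Z o ad W).
   Both this form and the Killing form B are traces of maps of the kind
   X |-> A X B and X |-> A X^* B on matrices over R, C or H; each is a multiple
   of Re tr (Z W) on each simple block of h, which gives the eigenvalues.  On
   the center of h, tr_p (ad Z o ad W) is B(Z, W) because ad W vanishes
   on h. *)

(** * Differential calculus without norms *)

(** One computation serves the three algebras because [K] enters only through its real dimension [d]
    and the traces recorded in [trace_form]. Traces over [g] and over [p] become traces over all
    matrices after composition with projections: [(Z - star_tr Z) / 2] onto skew matrices and, for
    [p], also [(Z - J Z J) / 2] with [J = diag(1, -1)]. With [n = p + q], the first alone gives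
    [B(X, Y) = (n d - 4 + 2 d) Re tr(X Y)], where [- 4 + 2 d] comes from the star. With [J] the star
    terms cancel, and for [W] in the first block [n - (p - q) = 2 q] remains, so that [tr_p] is
    [d q Re tr(X W)]. Hence the numerator is the size of the opposite block, and the denominator
    [n + 2 - 4 / d] is [n], [n + 1] or [n - 2]. Uniqueness of the operator on [h] rests on
    injectivity of [adp], which is read off from the eigenvalues being nonzero. Curvature is defined
    by Christoffel symbols in an arbitrary chart, so the structure equation has to be linked to
    derivatives of the inverse metric; this is done with directional derivatives, for which
    identities near the base point along coordinate lines suffice. *)

Section DirectionalDerivative.
Variables (R : realType) (E : normedModType R).

Lemma is_derive_line (F : normedModType R) (f : E -> F) (z v : E) (a : R) df :
  is_derive (a *: v + z) v f df -> is_derive a 1 (fun t => f (t *: v + z)) df.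
Proof.
move=> [fv <-].
have eqf : (fun h : R => h^-1 *: (((fun t => f (t *: v + z)) \o shift a) (h *: 1)
    - f (a *: v + z))) = (fun h => h^-1 *: ((f \o shift (a *: v + z)) (h *: v)
    - f (a *: v + z))).
  by apply/funext => h /=; rewrite addrA -scalerDl [h *: 1]mulr1.
by apply: DeriveDef; rewrite /derivable /derive eqf.
Qed.

Lemma is_derive_line0 (F : normedModType R) (f : E -> F) (z v : E) df :
  is_derive z v f df <-> is_derive (0 : R) 1 (fun t => f (t *: v + z)) df.
Proof.
have eqf : (fun h : R => h^-1 *: (((fun t => f (t *: v + z)) \o shift 0) (h *: 1)
    - f (0 *: v + z))) = (fun h => h^-1 *: ((f \o shift z) (h *: v) - f z)).
  by apply/funext => h /=; rewrite addr0 [h *: 1]mulr1 scale0r add0r.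
split=> -[fv <-]; apply: DeriveDef; rewrite /derivable /derive ?eqf //.
by rewrite -eqf.
Qed.

(** A directional derivative sees only the line through [z]. This weak hypothesis matters later:
    invertibility of the metric, for instance, is established only along coordinate lines. *)
Lemma is_derive_near_line (F : normedModType R) (f g : E -> F) (z v : E) df :
  (\forall t \near (0 : R), f (t *: v + z) = g (t *: v + z)) ->
  is_derive z v f df -> is_derive z v g df.
Proof.
by move=> fg /is_derive_line0 df1; apply/is_derive_line0/(near_eq_is_derive fg).
Qed.

Lemma derivable_line_cvg (f : E -> R) (z v : E) df :
  is_derive z v f df -> f (t *: v + z) @[t --> (0 : R)] --> f z.
Proof.
move=> /is_derive_line0 [/derivable1_diffP/differentiable_continuous].
by move=> + _; rewrite /prop_for /continuous_at /= scale0r add0r.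
Qed.

Lemma MVT_line (f df : E -> R) (z v : E) (t : R) : 0 <= t ->
  (forall a, 0 <= a <= t -> is_derive (a *: v + z) v f (df (a *: v + z))) ->
  exists2 a, 0 <= a <= t & f (t *: v + z) - f z = df (a *: v + z) * t.
Proof.
move=> t0 dfE; pose F (a : R) : R := f (a *: v + z).
have dF a : 0 <= a <= t -> is_derive a 1 F (df (a *: v + z)).
  by move=> at0; apply: is_derive_line; exact: dfE.
have [||a at0] := @MVT_segment R F (fun a => df (a *: v + z)) 0 t t0.
- by move=> a; rewrite in_itv /= => /andP[a0 at1]; apply: dF; rewrite !ltW.
- apply: derivable_within_continuous => a; rewrite in_itv /= => at0.
  by have [] := dF _ at0.
rewrite /F scale0r add0r subr0 => Fa.
by exists a => //; move: at0; rewrite in_itv.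
Qed.

(** Two mean value steps: along [u] for [y |-> f (t *: v + y) - f y], then along [v] for [fu]. The
    second difference is symmetric in [u] and [v], which [derive_sym] exploits. *)
Lemma second_difference (f fu fuv : E -> R) (x u v : E) (t : R) : 0 <= t ->
  (forall a b, 0 <= a <= t -> 0 <= b <= t ->
    is_derive (b *: v + (a *: u + x)) u f (fu (b *: v + (a *: u + x)))) ->
  (forall a b, 0 <= a <= t -> 0 <= b <= t ->
    is_derive (b *: v + (a *: u + x)) v fu (fuv (b *: v + (a *: u + x)))) ->
  exists a b, [/\ 0 <= a <= t, 0 <= b <= t &
    f (t *: v + (t *: u + x)) - f (t *: u + x) - f (t *: v + x) + f x =
    fuv (b *: v + (a *: u + x)) * t ^+ 2].
Proof.
move=> t0 dfu dfuv.
have t0t : 0 <= t <= t by rewrite t0 lexx.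
have z0t : 0 <= (0 : R) <= t by rewrite t0 lexx.
have addvu b a : b *: v + (a *: u + x) = a *: u + (b *: v + x) by rewrite addrCA.
have [|a at0 fa] := @MVT_line (fun y => f (t *: v + y) - f y)
    (fun y => fu (t *: v + y) - fu y) x u t t0.
  move=> a at0; apply: is_deriveB.
    apply/is_derive_line0.
    have /is_derive_line0 := dfu a t at0 t0t.
    by congr is_derive; apply/funext => c; rewrite addrCA.
  by have := dfu a 0 at0 z0t; rewrite scale0r add0r.
have [|b bt0 fb] := @MVT_line fu fuv (a *: u + x) v t t0.
  by move=> b bt0; apply: dfuv.
exists a, b; split=> //.
by rewrite fb -mulrA in fa; rewrite expr2 -fa; lra.
Qed.

(** Schwarz's theorem. Evaluating the second difference in both orders yields a value of [fuv] and a
    value of [fvu], at two points near [x], that coincide; continuity at [x] concludes. *)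
Lemma derive_sym (f fu fv fuv fvu : E -> R) (x u v : E) :
  (\forall y \near x, [/\ is_derive y u f (fu y), is_derive y v f (fv y),
     is_derive y v fu (fuv y) & is_derive y u fv (fvu y)]) ->
  {for x, continuous fuv} -> {for x, continuous fvu} -> fuv x = fvu x.
Proof.
move=> dnear cuv cvu; apply/eqP; rewrite -subr_eq0 -normr_le0.
apply/ler_addgt0Pl => e e0; rewrite addr0.
have e20 : 0 < e / 2 by rewrite divr_gt0.
have cuv' : \forall y \near x, `|fuv x - fuv y| < e / 2.
  by move/cvgrPdist_lt : cuv; apply.
have cvu' : \forall y \near x, `|fvu x - fvu y| < e / 2.
  by move/cvgrPdist_lt : cvu; apply.
have /nbhs_ballP[r /= r0 Hr] : nbhs x [set y | [/\ is_derive y u f (fu y),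
    is_derive y v f (fv y), is_derive y v fu (fuv y) & is_derive y u fv (fvu y)]
    /\ `|fuv x - fuv y| < e / 2 /\ `|fvu x - fvu y| < e / 2].
  by near=> y; split; [|split]; near: y.
(* Since [t * N = r / 2], all points reached with parameters at most [t] stay in the ball; the [+ 1]
   keeps [N] positive when [u] and [v] vanish. *)
pose N := `|u| + `|v| + 1.
have N0 : 0 < N by rewrite ltr_wpDl// addr_ge0.
pose t := r / 2 / N.
have t0 : 0 < t by rewrite !divr_gt0.
have small a b : 0 <= a <= t -> 0 <= b <= t -> ball x r (b *: v + (a *: u + x)).
  move=> /andP[a0 at0] /andP[b0 bt0].
  rewrite -ball_normE /ball_ /= addrA opprD addrCA subrr addr0 normrN.
  apply: le_lt_trans (ler_normD _ _) _; rewrite !normrZ !ger0_norm//.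
  apply: (@le_lt_trans _ _ (t * N)).
    have h1 : a * `|u| <= t * `|u| by rewrite ler_wpM2r.
    have h2 : b * `|v| <= t * `|v| by rewrite ler_wpM2r.
    by rewrite /N; nra.
  by rewrite /t divfK ?gt_eqF//; lra.
have addvu b a : b *: v + (a *: u + x) = a *: u + (b *: v + x) by rewrite addrCA.
have [|||a [b [at0 bt0 E1]]] := @second_difference f fu fuv x u v t.
- exact: ltW.
- by move=> a b at0 bt0; have /Hr[[]] := small _ _ at0 bt0.
- by move=> a b at0 bt0; have /Hr[[]] := small _ _ at0 bt0.
have [|||c [d [ct0 dt0 E2]]] := @second_difference f fv fvu x v u t.
- exact: ltW.
- by move=> c d ct0 dt0; rewrite -addvu; have /Hr[[]] := small _ _ dt0 ct0.
- by move=> c d ct0 dt0; rewrite -addvu; have /Hr[[]] := small _ _ dt0 ct0.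
have /Hr[_ [H1 _]] := small _ _ at0 bt0.
have /Hr[_ [_ H2]] := small _ _ dt0 ct0.
have E3 : fuv (b *: v + (a *: u + x)) = fvu (c *: v + (d *: u + x)).
  have t20 : t ^+ 2 != 0 by rewrite expf_neq0 ?gt_eqF.
  rewrite -(addvu t t) -(addvu c d) in E2.
  by apply: (mulIf t20); rewrite -E1 -E2; lra.
rewrite [_ - _](_ : _ = (fuv x - fuv (b *: v + (a *: u + x)))
   - (fvu x - fvu (c *: v + (d *: u + x)))); last by rewrite E3; lra.
rewrite (le_trans (ler_normB _ _))// (splitr e) lerD// ltW//.
Unshelve. all: by end_near. Qed.

End DirectionalDerivative.

Lemma coord_vbasis_inj (F : fieldType) (W : vectType F) (u w : W) :
  (forall i, coord (vbasis {:W}) i u = coord (vbasis {:W}) i w) -> u = w.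
Proof.
move=> uw; rewrite (coord_vbasis (memvf u)) (coord_vbasis (memvf w)).
by apply: eq_bigr => i _; rewrite uw.
Qed.

Lemma near_line (R : realType) (E : normedModType R) (P : E -> Prop) (x v : E) :
  (\forall y \near x, P y) -> \forall t \near (0 : R), P (t *: v + x).
Proof.
move=> Px; have cont : {for (0 : R), continuous (fun t : R => t *: v + x)}.
  by apply: cvgD; [exact: scalel_continuous | exact: cvg_cst].
have Px' : nbhs ((0 : R) *: v + x) P by rewrite scale0r add0r.
exact: cont Px'.
Qed.

(** * Derivatives with values in a finite-dimensional vector space *)

Section VectorDerivative.
Variables (R : realType) (E : normedModType R).

(* A vector space [W] carries no norm here, so derivatives of [W]-valued
   functions are tested against linear forms. *)
Definition is_vderive (W : vectType R) (x v : E) (f : E -> W) (d : W) : Prop :=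
  forall phi : 'Hom(W, R^o), is_derive x v (fun y => phi (f y) : R^o) (phi d).

Implicit Types (W : vectType R) (x v : E).

Lemma is_vderive_real (f : E -> R^o) x v d :
  is_vderive x v f d <-> is_derive x v f d.
Proof.
split=> [/(_ \1%VF)|df phi].
  by rewrite id_lfunE; congr is_derive; apply/funext => y; rewrite id_lfunE.
have [c phiE] : exists c : R, forall a : R^o, phi a = c *: a.
  by exists (phi 1) => a; rewrite -[in LHS](mulr1 a) -[a * 1]/(a *: 1) linearZ; apply: mulrC.
rewrite (_ : (fun _ => _) = c \*: f); last by apply/funext => y; rewrite phiE.
by rewrite phiE; exact: is_deriveZ.
Qed.

Lemma is_vderive_lfun W W' (F : 'Hom(W, W')) f x v d :
  is_vderive x v f d -> is_vderive x v (fun y => F (f y)) (F d).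
Proof.
move=> df phi; have := df (phi \o F)%VF; rewrite comp_lfunE.
by congr is_derive; apply/funext => y; rewrite comp_lfunE.
Qed.

Lemma is_vderive_linear W W' (F : W -> W') f x v d : linear F ->
  is_vderive x v f d -> is_vderive x v (fun y => F (f y)) (F d).
Proof.
move=> F_lin /(is_vderive_lfun (linfun F)); rewrite linfunE //.
by congr is_vderive; apply/funext => y; rewrite linfunE.
Qed.

Lemma is_vderive_coord W f x v d :
  (forall i, is_derive x v (fun y => coord (vbasis {:W}) i (f y) : R^o)
     (coord (vbasis {:W}) i d)) -> is_vderive x v f d.
Proof.
move=> dc phi; have phiE w : phi w = \sum_i coord (vbasis {:W}) i w *: phi (vbasis {:W})`_i.
  by rewrite {1}(coord_vbasis (memvf w)) linear_sum; apply: eq_bigr => i _; rewrite linearZ.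
have -> : (fun y => phi (f y) : R^o) = \sum_i
    (fun y => coord (vbasis {:W}) i (f y) : R^o) * cst (phi (vbasis {:W})`_i).
  by apply/funext => y; rewrite phiE fct_sumE; apply: eq_bigr.
rewrite phiE; apply: is_derive_sum => i; apply: is_derive_eq.
by rewrite scaler0 add0r /cst /= -![_ *: _]/(_ * _) mulrC.
Qed.

Lemma is_vderive_uniq W (f : E -> W) x v d d' :
  is_vderive x v f d -> is_vderive x v f d' -> d = d'.
Proof.
move=> df df'; apply: coord_vbasis_inj => i.
pose c : 'Hom(W, R^o) := linfun (coord (vbasis {:W}) i : W -> R^o).
have cE w : coord (vbasis {:W}) i w = c w.
  by rewrite linfunE // => a u w'; rewrite linearP.
by rewrite !cE; have [_ <-] := df c; have [_ <-] := df' c.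
Qed.

Lemma is_vderive_near_line W (f g : E -> W) x v d :
  (\forall t \near (0 : R), f (t *: v + x) = g (t *: v + x)) ->
  is_vderive x v f d -> is_vderive x v g d.
Proof.
move=> fg df phi; apply: is_derive_near_line (df phi).
by near=> t; congr (phi _); near: t.
Unshelve. all: by end_near. Qed.

Lemma is_vderive_cst W (c : W) x v : is_vderive x v (fun=> c) 0.
Proof. by move=> phi; rewrite linear0; exact: is_derive_cst. Qed.

Lemma is_vderiveD W (f g : E -> W) x v df dg :
  is_vderive x v f df -> is_vderive x v g dg ->
  is_vderive x v (fun y => f y + g y) (df + dg).
Proof.
move=> Df Dg phi; rewrite linearD.
rewrite (_ : (fun _ => _) = (fun y => phi (f y) : R^o) + (fun y => phi (g y) : R^o)).
  exact: is_deriveD.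
by apply/funext => y; rewrite linearD.
Qed.

Lemma is_vderiveN W (f : E -> W) x v df :
  is_vderive x v f df -> is_vderive x v (fun y => - f y) (- df).
Proof. by apply: is_vderive_linear => a u w; rewrite opprD scalerN. Qed.

Lemma is_vderiveB W (f g : E -> W) x v df dg :
  is_vderive x v f df -> is_vderive x v g dg ->
  is_vderive x v (fun y => f y - g y) (df - dg).
Proof. by move=> Df Dg; apply: is_vderiveD Df (is_vderiveN Dg). Qed.

Lemma is_vderive_sum W (I : Type) (r : seq I) (P : pred I) (f : I -> E -> W) x v df :
  (forall i, is_vderive x v (f i) (df i)) ->
  is_vderive x v (fun y => \sum_(i <- r | P i) f i y) (\sum_(i <- r | P i) df i).
Proof.
move=> Df; elim: r => [|i r IH].
  rewrite big_nil; under eq_fun do rewrite big_nil; exact: is_vderive_cst.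
rewrite big_cons; under eq_fun do rewrite big_cons.
by case: (P i) => //; apply: is_vderiveD.
Qed.

Lemma is_vderive_mul (f g : E -> R^o) x v df dg :
  is_vderive x v f df -> is_vderive x v g dg ->
  is_vderive x v (fun y => f y * g y : R^o) (df * g x + f x * dg : R^o).
Proof.
move=> /is_vderive_real Df /is_vderive_real Dg; apply/is_vderive_real.
apply: (@is_derive_eq _ _ _ _ _ _ _ (f x *: dg + g x *: df)).
by rewrite addrC -![_ *: _]/(_ * _) [g x * _]mulrC.
Qed.

(** Expansion of both arguments in bases reduces the Leibniz rule to products of real coordinates.
    It is applied to the bracket, the Killing form, scaling and matrix products. *)
Lemma is_vderive_bilinear W1 W2 W3 (b : W1 -> W2 -> W3) f g x v df dg :
  (forall u, linear (b u)) -> (forall w, linear (b^~ w)) ->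
  is_vderive x v f df -> is_vderive x v g dg ->
  is_vderive x v (fun y => b (f y) (g y)) (b df (g x) + b (f x) dg).
Proof.
move=> b_linr b_linl Df Dg.
pose B1 := vbasis {:W1}; pose B2 := vbasis {:W2}.
have bE u w : b u w = \sum_i \sum_j (coord B1 i u * coord B2 j w) *: b B1`_i B2`_j.
  pose bl w : {linear W1 -> W3} := HB.pack (b^~ w)
    (GRing.isLinear.Build R W1 W3 _ (b^~ w) (b_linl w)).
  pose br u : {linear W2 -> W3} := HB.pack (b u) (GRing.isLinear.Build R W2 W3 _ (b u) (b_linr u)).
  rewrite -[LHS]/(bl w u) {1}(coord_vbasis (memvf u)) linear_sum; apply: eq_bigr => i _.
  rewrite linearZ /= -[b _ w]/(br B1`_i w) {1}(coord_vbasis (memvf w)) linear_sum scaler_sumr.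
  by apply: eq_bigr => j _; rewrite linearZ scalerA.
have lZ (w : W3) : linear (fun c : R^o => (c : R) *: w).
  by move=> a c c'; rewrite scalerDl scalerA.
have cl (W : vectType R) i : linear (coord (vbasis {:W}) i : W -> R^o).
  by move=> a u w; rewrite linearP.
rewrite !bE -big_split /=; under eq_fun do rewrite bE.
apply: is_vderive_sum => i; rewrite -big_split /=; apply: is_vderive_sum => j.
rewrite -scalerDl; apply: (is_vderive_linear (lZ _)).
by apply: is_vderive_mul; apply: (is_vderive_linear (@cl _ _)).
Qed.

Lemma is_vderive_sym W (f fu fv fuv fvu : E -> W) x u v :
  (\forall y \near x, [/\ is_vderive y u f (fu y), is_vderive y v f (fv y),
     is_vderive y v fu (fuv y) & is_vderive y u fv (fvu y)]) ->
  (forall phi : 'Hom(W, R^o), {for x, continuous (fun y => phi (fuv y) : R)}) ->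
  (forall phi : 'Hom(W, R^o), {for x, continuous (fun y => phi (fvu y) : R)}) ->
  fuv x = fvu x.
Proof.
move=> dnear cuv cvu; apply: coord_vbasis_inj => i.
pose c : 'Hom(W, R^o) := linfun (coord (vbasis {:W}) i : W -> R^o).
have cE w : coord (vbasis {:W}) i w = c w.
  by rewrite linfunE // => a w1 w2; rewrite linearP.
have dnear_c : \forall y \near x,
    [/\ is_derive y u (fun z => c (f z) : R) (c (fu y)),
        is_derive y v (fun z => c (f z) : R) (c (fv y)),
        is_derive y v (fun z => c (fu z) : R) (c (fuv y)) &
        is_derive y u (fun z => c (fv z) : R) (c (fvu y))].
  by near=> y; have [] : [/\ is_vderive y u f (fu y), is_vderive y v f (fv y),
     is_vderive y v fu (fuv y) & is_vderive y u fv (fvu y)] by near: y.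
by rewrite !cE; exact: derive_sym dnear_c (cuv c) (cvu c).
Unshelve. all: by end_near. Qed.

End VectorDerivative.

(** * Smooth maps, their partial derivatives and symmetry of second derivatives *)

Section Partials.
Variables (R : realType) (m : nat) (W : vectType R).
Local Notation b := (vbasis {:W}).
Implicit Types (s : 'rV[R]_m -> W) (U : set 'rV[R]_m).

(** For [W = kmx K n] this unfolds to the same term as [pderivV], so [mcform] is expressed through
    it by conversion. *)
Definition vpartial s (i : 'I_m) (x : 'rV[R]_m) : W :=
  passmx.vecof b (pderiv i (fun y => passmx.rVof b (s y)) x).

Definition smooth_on U s : Prop := forall k, Ck k U (fun x => passmx.rVof b (s x)).

Lemma smooth_on_vderive U s i x : smooth_on U s -> U x ->
  is_vderive x (delta_mx 0 i) s (vpartial s i x).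
Proof.
move=> sm Ux; apply: is_vderive_coord => k.
have [/(_ x Ux) ds _] := sm 1 i.
rewrite passmx.coord_vecof ?vbasisP // /pderiv derive_mx // mxE.
move/derivable_mxP : ds => /(_ 0 k)/derivableP ds.
rewrite (_ : (fun _ => _) = (fun y => passmx.rVof b (s y) 0 k)) //.
by apply/funext => y; rewrite passmx.coord_rVof.
Qed.

Lemma smooth_on_partial U s i : smooth_on U s -> smooth_on U (vpartial s i).
Proof.
move=> sm k; have [_] := sm k.+1 i.
rewrite (_ : pderiv i _ = (fun x => passmx.rVof b (vpartial s i x))) //.
by apply/funext => x; rewrite passmx.vecofK ?vbasisP.
Qed.

Local Opaque vpartial.

Lemma smooth_on_partialC U s i j x : open U -> smooth_on U s -> U x ->
  vpartial (vpartial s i) j x = vpartial (vpartial s j) i x.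
Proof.
move=> oU sm Ux.
have cont t (phi : 'Hom(W, R^o)) : smooth_on U t ->
    {for x, continuous (fun y => phi (t y) : R)}.
  move=> /(_ 0%N x Ux) ct.
  have phiE w : phi w = \sum_k (passmx.rVof b w 0 k) *: phi b`_k.
    rewrite {1}(coord_vbasis (memvf w)) linear_sum; apply: eq_bigr => k _.
    by rewrite linearZ passmx.coord_rVof.
  rewrite (_ : (fun _ => _) =
    (fun v : 'rV[R]__ => \sum_k (v 0 k) *: phi b`_k) \o (fun y => passmx.rVof b (t y))).
    apply: continuous_comp ct _.
    apply: continuous_big => //; first exact: add_continuous.
    move=> k _ v; apply: (@continuous_comp _ _ _ (fun u : 'rV[R]__ => u 0 k)
      (fun a : R => a *: phi b`_k)); first exact: coord_continuous.
    exact: scalel_continuous.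
  by apply/funext => y; rewrite phiE.
have smi := smooth_on_partial i sm; have smj := smooth_on_partial j sm.
have smij := smooth_on_partial j smi; have smji := smooth_on_partial i smj.
have nearU : \forall y \near x, U y by exact: open_nbhs_nbhs.
have di y : U y -> is_vderive y (delta_mx 0 i) s (vpartial s i y).
  exact: smooth_on_vderive.
have dj y : U y -> is_vderive y (delta_mx 0 j) s (vpartial s j y).
  exact: smooth_on_vderive.
have dij y : U y -> is_vderive y (delta_mx 0 j) (vpartial s i) (vpartial (vpartial s i) j y).
  exact: smooth_on_vderive smi.
have dji y : U y -> is_vderive y (delta_mx 0 i) (vpartial s j) (vpartial (vpartial s j) i y).
  exact: smooth_on_vderive smj.
apply: (@is_vderive_sym _ _ _ s _ _ _ _ _ (delta_mx 0 i) (delta_mx 0 j)).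
- by apply: filterS nearU => y Uy; split; [exact: di|exact: dj|exact: dij|exact: dji].
- by move=> phi; exact: cont.
- by move=> phi; exact: cont.
Qed.

End Partials.

(** * Lie algebra of matrices and the curvature operator *)

(** Nondegeneracy makes [w |-> b^~ w] injective from [W] into its dual, hence bijective by
    dimension; [L] is the inverse of this map applied to [c u]. It provides adjoints without a
    choice of orthonormal bases. *)
Lemma riesz_representation (F : fieldType) (U W : vectType F)
    (b : W -> W -> F^o) (c : U -> W -> F^o) :
  (forall w, linear (b w)) -> (forall w, linear (b^~ w)) ->
  (forall u, linear (c u)) -> (forall w, linear (c^~ w)) ->
  (forall w, (forall z, b z w = 0) -> w = 0) ->
  exists L : 'Hom(U, W), forall u z, b z (L u) = c u z.
Proof.
move=> b_linr b_linl c_linr c_linl b_nondeg.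
pose Phi : 'Hom(W, 'Hom(W, F^o)) := linfun (fun w => linfun (b^~ w)).
pose Psi : 'Hom(U, 'Hom(W, F^o)) := linfun (fun u => linfun (c u)).
have PhiE w z : Phi w z = b z w.
  rewrite /Phi linfunE ?linfunE // => a u v; apply/lfunP => t.
  by rewrite add_lfunE scale_lfunE !linfunE // b_linr.
have PsiE u z : Psi u z = c u z.
  rewrite /Psi linfunE ?linfunE // => a u1 v; apply/lfunP => t.
  by rewrite add_lfunE scale_lfunE !linfunE // c_linl.
have kPhi : lker Phi == 0%VS.
  rewrite -subv0; apply/subvP => w; rewrite memv_ker memv0 => /eqP Phiw.
  by apply/eqP/b_nondeg => z; rewrite -PhiE Phiw zero_lfunE.
have fPhi : limg Phi = fullv.
  apply/eqP; rewrite eqEdim subvf /= limg_dim_eq ?(eqP kPhi) ?capv0 //.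
  by rewrite !dimvf /= /dim /= muln1.
exists (Phi^-1 \o Psi)%VF => u z.
by rewrite -PhiE comp_lfunE limg_lfunVK ?PsiE // fPhi memvf.
Qed.

HB.instance Definition _ (F : fieldType) (W : vectType F) :=
  GRing.isLinear.Build F 'End(W) F^o *:%R (@lftr F W : 'End(W) -> F^o)
    (@lftr_linear F W).

Lemma lftr0 (F : fieldType) (W : vectType F) : lftr (0 : 'End(W)) = 0.
Proof. exact: linear0. Qed.

Lemma lftrB (F : fieldType) (W : vectType F) (f g : 'End(W)) :
  lftr (f - g) = lftr f - lftr g.
Proof. exact: linearB. Qed.

Lemma lftrD (F : fieldType) (W : vectType F) (f g : 'End(W)) :
  lftr (f + g) = lftr f + lftr g.
Proof. exact: linearD. Qed.

Lemma lftrZ (F : fieldType) (W : vectType F) a (f : 'End(W)) :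
  lftr (a *: f) = a * lftr f.
Proof. exact: linearZ. Qed.

Section LieBracket.
Variables (R : fieldType) (K : starAlgType R) (n : nat).
Local Notation V := (kmx K n).
Implicit Types (X Y Z : V) (g h : {vspace V}).

Lemma jacobi X Y Z : lbr X (lbr Y Z) = lbr (lbr X Y) Z + lbr Y (lbr X Z).
Proof.
rewrite /lbr !mulmxBl !mulmxBr !mulmxA !opprB.
by rewrite [RHS]addrACA !subrKA [LHS]addrACA [RHS]addrACA [- _ - _ in RHS]addrC.
Qed.

HB.instance Definition _ X :=
  GRing.isLinear.Build R V V *:%R (lbr X) (lbr_linearr X).
HB.instance Definition _ g X :=
  GRing.isLinear.Build R V R^o *:%R (killing g X : V -> R^o) (killing_linearr g X).

Lemma lbrDl X Y Z : lbr (X + Y) Z = lbr X Z + lbr Y Z.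
Proof. by have := lbr_linearl Z 1 X Y; rewrite !scale1r. Qed.

Lemma lbrDr X Y Z : lbr X (Y + Z) = lbr X Y + lbr X Z.
Proof. exact: linearD. Qed.

Lemma lbrBr X Y Z : lbr X (Y - Z) = lbr X Y - lbr X Z.
Proof. exact: linearB. Qed.

Lemma lbrBl X Y Z : lbr (X - Y) Z = lbr X Z - lbr Y Z.
Proof.
have := lbr_linearl Z (-1) Y X; rewrite /= !scaleN1r => XYE.
by rewrite [X - Y]addrC XYE [RHS]addrC.
Qed.

Lemma lbrNl X Y : lbr (- X) Y = - lbr X Y.
Proof. by rewrite -[- X]add0r lbrBl [lbr 0 Y]lbrC [lbr Y 0]linear0 oppr0 add0r. Qed.

Lemma lbrZr a X Y : lbr X (a *: Y) = a *: lbr X Y.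
Proof. exact: linearZ. Qed.

Lemma lbr_sumr (I : Type) (r : seq I) (P : pred I) X (F : I -> V) :
  lbr X (\sum_(i <- r | P i) F i) = \sum_(i <- r | P i) lbr X (F i).
Proof. exact: linear_sum. Qed.

Lemma killingDr g X Y Z : killing g X (Y + Z) = killing g X Y + killing g X Z.
Proof. exact: linearD. Qed.

Lemma killingBr g X Y Z : killing g X (Y - Z) = killing g X Y - killing g X Z.
Proof. exact: linearB. Qed.

Lemma killingZr g a X Y : killing g X (a *: Y) = a * killing g X Y.
Proof. exact: linearZ. Qed.

Lemma killing_sumr (I : Type) (r : seq I) (P : pred I) g X (F : I -> V) :
  killing g X (\sum_(i <- r | P i) F i) = \sum_(i <- r | P i) killing g X (F i).
Proof. exact: linear_sum. Qed.

Lemma killingNl g X Y : killing g (- X) Y = - killing g X Y.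
Proof. by rewrite killingC linearN /= killingC. Qed.

Lemma killingDl g X Y Z : killing g (X + Y) Z = killing g X Z + killing g Y Z.
Proof. by rewrite killingC linearD /= !(killingC _ Z). Qed.

Lemma killingZl g a X Y : killing g (a *: X) Y = a * killing g X Y.
Proof. by rewrite killingC linearZ /= killingC. Qed.

Definition lie_closed g := forall X Y, X \in g -> Y \in g -> lbr X Y \in g.

Lemma vsval_adm g X (Y : subvs_of g) : lie_closed g -> X \in g ->
  vsval (adm g X Y) = lbr X (vsval Y).
Proof.
move=> lieg Xg; rewrite linfunE => [|a U W]; last by rewrite !linearP.
by rewrite vsprojK ?lieg ?subvsP.
Qed.

Lemma adm_lbr g X Y : lie_closed g -> X \in g -> Y \in g ->
  adm g (lbr X Y) = (adm g X \o adm g Y)%VF - (adm g Y \o adm g X)%VF.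
Proof.
move=> lieg Xg Yg; apply/lfunP => Z; apply: subvs_inj.
rewrite add_lfunE opp_lfunE !comp_lfunE linearB /= !vsval_adm ?lieg //.
by rewrite jacobi addrK.
Qed.

(** Invariance of the Killing form: [ad] turns brackets into commutators on a closed [g], and the
    trace is cyclic. *)
Lemma killing_lbr g X Y Z : lie_closed g -> X \in g -> Y \in g -> Z \in g ->
  killing g (lbr X Y) Z = killing g X (lbr Y Z).
Proof.
move=> lieg Xg Yg Zg; rewrite /killing !adm_lbr // comp_lfunDl comp_lfunDr.
rewrite comp_lfunNl comp_lfunNr.
rewrite !linearB /= -comp_lfunA; congr (_ - _).
by rewrite -comp_lfunA lftrC comp_lfunA lftrC comp_lfunA.
Qed.

End LieBracket.

(** Infinitesimal data of a symmetric space of compact type. [sp_ppE] is the symmetric condition,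
    and [sp_neg] makes the metric positive and the sum in [sp_sum] direct; that [[h, p]] lies in [p]
    is derived from invariance of the Killing form. *)
Record symmetric_pair (R : realType) (K : starAlgType R) (n : nat)
    (g h : {vspace kmx K n}) : Prop := SymmetricPair {
  sp_lie : lie_closed g;
  sp_sub : (h <= g)%VS;
  sp_lieh : lie_closed h;
  sp_ppE : forall X Y, X \in orthk g h -> Y \in orthk g h -> lbr X Y \in h;
  sp_sum : g = (orthk g h + h)%VS;
  sp_neg : forall X, X \in g -> X != 0 -> killing g X X < 0 }.

Section HomogeneousLinearity.
Variables (R : realType) (K : starAlgType R) (n : nat) (g h : {vspace kmx K n}).
Local Notation TM := (subvs_of (orthk g h)).

Lemma adp_linear : linear (adp g h).
Proof.
have lin W : linear (fun Y : TM => vsproj (orthk g h) (lbr W (vsval Y))).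
  by move=> c U Y; rewrite !linearP.
move=> a X Y; apply/lfunP => Z; rewrite add_lfunE scale_lfunE !(linfunE _ (lin _)).
by rewrite lbr_linearl linearP.
Qed.
HB.instance Definition _ :=
  GRing.isLinear.Build R _ 'End(TM) *:%R (adp g h) adp_linear.

HB.instance Definition _ (X : TM) :=
  GRing.isLinear.Build R TM R^o *:%R (metricM X : TM -> R^o) (metricM_linear X).

Lemma inner2C (A C : 'End(TM)) : inner2 A C = inner2 C A.
Proof. by rewrite /inner2 lftrC. Qed.

Lemma inner2_linear (A : 'End(TM)) : linear (inner2 A : 'End(TM) -> R^o).
Proof.
by move=> a C D; rewrite /inner2 comp_lfunDr -comp_lfunZr lftr_linear opprD scalerN.
Qed.
HB.instance Definition _ (A : 'End(TM)) :=
  GRing.isLinear.Build R 'End(TM) R^o *:%R (inner2 A : 'End(TM) -> R^o) (inner2_linear A).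

Lemma inner2_linearl (A : 'End(TM)) : linear ((fun C => inner2 C A) : 'End(TM) -> R^o).
Proof.
by move=> a C D; rewrite /inner2 comp_lfunDl -comp_lfunZl lftr_linear opprD scalerN.
Qed.

End HomogeneousLinearity.

(** * Symmetric pairs: existence and uniqueness of the curvature operator on [h] *)

Section SymmetricPair.
Variables (R : realType) (K : starAlgType R) (n : nat).
Local Notation V := (kmx K n).
Variables (g h : {vspace V}).
Hypothesis sp : symmetric_pair g h.
Local Notation p := (orthk g h).
Local Notation B := (killing g).
Local Notation TM := (subvs_of p).
Implicit Types (X Y Z W : V).

Lemma sp_hg X : X \in h -> X \in g.
Proof. by move: X; apply/subvP/(sp_sub sp). Qed.

Lemma sp_pg X : X \in p -> X \in g.
Proof. by case/memv_orthk. Qed.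

Lemma sp_orth X Y : X \in h -> Y \in p -> B X Y = 0.
Proof. by move=> Xh /memv_orthk[_]; apply. Qed.

(** A definite form is nondegenerate on every subspace, so equality of vectors of [h] or of [p] can
    be tested inside [h] or [p]. *)
Lemma sp_nondeg (u : {vspace V}) X : (u <= g)%VS -> X \in u ->
  (forall Y, Y \in u -> B Y X = 0) -> X = 0.
Proof.
move=> /subvP ug Xu XP; apply/eqP; apply: contraT => X0.
by have := sp_neg sp (ug _ Xu) X0; rewrite XP // ltxx.
Qed.

Lemma sp_cap : (p :&: h = 0)%VS.
Proof.
apply/eqP; rewrite -subv0; apply/subvP => X /memv_capP[Xp Xh].
rewrite memv0; apply/eqP/(@sp_nondeg h) => //; first exact: sp_sub sp.
by move=> Y Yh; exact: sp_orth.
Qed.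

Lemma sp_killing_lbr X Y Z : X \in g -> Y \in g -> Z \in g ->
  B (lbr X Y) Z = B X (lbr Y Z).
Proof. exact: killing_lbr (sp_lie sp). Qed.

Lemma sp_hp X Y : X \in h -> Y \in p -> lbr X Y \in p.
Proof.
move=> Xh Yp; apply/memv_orthk; split.
  by apply: (sp_lie sp); [exact: sp_hg | exact: sp_pg].
move=> Z Zh; rewrite -sp_killing_lbr; [|exact: sp_hg|exact: sp_hg|exact: sp_pg].
by apply: sp_orth => //; apply: (sp_lieh sp).
Qed.

Lemma sp_ph X Y : X \in p -> Y \in h -> lbr X Y \in p.
Proof. by move=> Xp Yh; rewrite lbrC memvN; exact: sp_hp. Qed.

Lemma vsval_adp (Z : V) (X : TM) : Z \in h ->
  vsval (adp g h Z X) = lbr Z (vsval X).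
Proof.
move=> Zh; rewrite linfunE => [|a U W]; last by rewrite !linearP.
by rewrite vsprojK // sp_hp // subvsP.
Qed.

Lemma adp_skew Z : Z \in h -> skewM (adp g h Z).
Proof.
move=> Zh X Y; rewrite /metricM !vsval_adp // [lbr Z (vsval X)]lbrC.
have [Xg Yg] := (sp_pg (subvsP X), sp_pg (subvsP Y)).
by rewrite killingNl sp_killing_lbr ?(sp_hg Zh).
Qed.

Lemma metricM_nondeg (X : TM) : (forall Y : TM, metricM Y X = 0) -> X = 0.
Proof.
move=> XP; apply: subvs_inj; rewrite linear0.
apply: (@sp_nondeg p); [exact: capvSl | exact: subvsP | move=> Y Yp].
by apply/eqP; rewrite -oppr_eq0; have := XP (vsproj p Y); rewrite /metricM vsprojK // => ->.
Qed.

Lemma inner2_wedger (A : 'End(TM)) (X Y : TM) :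
  inner2 A (wedge X Y) = metricM Y (A X) - metricM X (A Y).
Proof.
pose r (X Y : TM) : 'End(TM) := linfun (fun U => (metricM X U : R^o) *: Y).
have rlin (X' Y' : TM) : linear (fun U => (metricM X' U : R^o) *: Y').
  by move=> a U1 U2; rewrite metricM_linear scalerDl scalerA.
have trr (X' Y' : TM) : lftr (r X' Y') = metricM X' Y'.
  exact/lftr_rank1/metricM_linear.
have -> : inner2 A (wedge X Y) = - (lftr (r X (A Y)) - lftr (r Y (A X))).
  rewrite /inner2; have -> : (A \o wedge X Y)%VF = r X (A Y) - r Y (A X).
    apply/lfunP => U; rewrite comp_lfunE wedgeE linearB !linearZ /=.
    by rewrite add_lfunE opp_lfunE !(linfunE _ (rlin _ _)) scalerN.
  by rewrite lftrB.
by rewrite opprB !trr.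
Qed.

(** Skewness of [adp g h Z] makes the two terms of [inner2_wedger] equal, whence the factor 2;
    invariance then moves the bracket onto [X] and [Y]. *)
Lemma inner2_adp_wedge (Z : V) (X Y : TM) : Z \in h ->
  inner2 (adp g h Z) (wedge X Y) = - 2 * B Z (lbr (vsval X) (vsval Y)).
Proof.
move=> Zh; rewrite inner2_wedger -[metricM X _]opprK.
have [Xg Yg Zg] := And3 (sp_pg (subvsP X)) (sp_pg (subvsP Y)) (sp_hg Zh).
rewrite -adp_skew // opprK [metricM Y _]metricMC -mulr2n.
rewrite /metricM vsval_adp // sp_killing_lbr // mulNr mulr_natl.
by rewrite mulNrn.
Qed.

(** For skew [A] the pairing with [wedge X Y] is twice [metricM (A X) Y], so it detects every entry
    of [A]. This plays the role of the fact that bivectors span the skew endomorphisms. *)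
Lemma skewM_inner2_eq0 (A : 'End(TM)) : skewM A ->
  (forall X Y : TM, inner2 A (wedge X Y) = 0) -> A = 0.
Proof.
move=> Ask AP; apply/lfunP => X; rewrite zero_lfunE; apply: metricM_nondeg => Y.
have := AP X Y; rewrite inner2_wedger -[metricM X _]opprK -Ask opprK metricMC -mulr2n.
by rewrite metricMC => /eqP; rewrite mulrn_eq0 /= => /eqP.
Qed.

Definition isotropy_form (Z W : V) : R := lftr (adp g h Z \o adp g h W)%VF.

Lemma isotropy_formDr (X W W' : V) :
  isotropy_form X (W + W') = isotropy_form X W + isotropy_form X W'.
Proof.
rewrite /isotropy_form (_ : adp g h (W + W') = adp g h W + adp g h W').
  by rewrite comp_lfunDr lftrD.
exact: linearD.
Qed.

Lemma isotropy_form0r (X : V) : isotropy_form X 0 = 0.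
Proof.
by rewrite /isotropy_form (_ : adp g h 0 = 0) ?comp_lfun0r ?lftr0 //; exact: linear0.
Qed.

(* With respect to [- B] and [inner2], the adjoint of [adp] is [2 L], where [L]
   maps [wedge X Y] to the bracket of [X] and [Y]; the curvature operator is
   [adp \o L] and its restriction to [h] is [L \o adp]. *)
Lemma curvature_operator_exists : exists T : 'End(subvs_of h),
  (forall Z W : subvs_of h,
     2 * B (vsval Z) (vsval (T W)) = isotropy_form (vsval Z) (vsval W)) /\
  forall s, (forall X Y Z W : TM, curvature s X Y Z W =
               B (lbr (lbr (vsval X) (vsval Y)) (vsval W)) (vsval Z)) ->
    curvature_operator_on_h g h s T.
Proof.
have [||||w|L LE] := @riesz_representation R 'End(TM) (subvs_of h)
  (fun Z W : subvs_of h => B (vsval Z) (vsval W) : R^o)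
  (fun A (Z : subvs_of h) => (- 2^-1 * inner2 (adp g h (vsval Z)) A) : R^o).
- by move=> Z a X Y; rewrite !linearP.
- by move=> Z a X Y; rewrite linearP killingDl killingZl.
- move=> A a X Y; rewrite -[vsval (a *: X + Y)]/(a *: vsval X + vsval Y)
    adp_linear inner2_linearl mulrDr.
  by rewrite -![_ *: _]/(_ * _) mulrCA.
- move=> Z a X Y; rewrite inner2_linear mulrDr. by rewrite -![_ *: _]/(_ * _) mulrCA.
- move=> wP; apply: subvs_inj; rewrite linear0.
  apply: (@sp_nondeg h); [exact: sp_sub sp | exact: subvsP | move=> Y Yh].
  by have := wP (vsproj h Y); rewrite vsprojK.
have L_wedge (X Y : TM) : vsval (L (wedge X Y)) = lbr (vsval X) (vsval Y).
  have XYh := sp_ppE sp (subvsP X) (subvsP Y).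
  apply/eqP; rewrite -subr_eq0; apply/eqP/(@sp_nondeg h); first exact: sp_sub sp.
    by rewrite memvB ?subvsP.
  move=> Z Zh; rewrite linearB /=; have := LE (wedge X Y) (vsproj h Z).
  by rewrite vsprojK // => ->; rewrite inner2_adp_wedge // mulNr mulNr mulrN opprK
    mulKf ?subrr // pnatr_eq0.
have LE2 (Z : V) A : Z \in h -> inner2 (adp g h Z) A = - 2 * B Z (vsval (L A)).
  move=> Zh; have := LE A (vsproj h Z); rewrite vsprojK // => ->.
  by rewrite mulNr mulNr mulrN opprK mulVKf // pnatr_eq0.
pose F : 'End('End(TM)) := linfun (fun A => adp g h (vsval (L A))).
have FE A : F A = adp g h (vsval (L A)).
  by rewrite linfunE // => a C D; rewrite [L _]linearP; apply: adp_linear.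
pose T : 'End(subvs_of h) := linfun (fun Z : subvs_of h => L (adp g h (vsval Z))).
have TE (Z : subvs_of h) : T Z = L (adp g h (vsval Z)).
  rewrite linfunE // => a C D; rewrite -[RHS]linearP; congr (L _).
  exact: adp_linear.
exists T; split=> [Z W|s curv].
  rewrite TE; apply: oppr_inj; rewrite -mulNr -LE2 ?subvsP //.
exists F; split.
- split=> [A Ask|A C Ask Csk|X Y Z W].
  + by rewrite FE; apply/adp_skew/subvsP.
  + by rewrite FE LE2 ?subvsP // inner2C FE LE2 ?subvsP // killingC.
  + rewrite FE inner2_adp_wedge ?subvsP // curv L_wedge.
    have [Xg Yg Zg Wg] := And4 (sp_pg (subvsP X)) (sp_pg (subvsP Y))
      (sp_pg (subvsP Z)) (sp_pg (subvsP W)).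
    rewrite (sp_killing_lbr (sp_lie sp Xg Yg) Wg Zg).
    by rewrite (lbrC (vsval W)) [killing g _ (- _)]linearN mulNr mulrN.
- by move=> A Ask; exists (L A); rewrite FE.
- by move=> Z; rewrite FE TE.
Qed.

(** The curvature determines [F] on bivectors, since skew endomorphisms are detected by bivectors;
    symmetry of [F] extends this to all skew endomorphisms. Injectivity of [adp] then carries the
    conclusion to [h]. *)
Lemma curvature_operator_uniq s (T1 T2 : 'End(subvs_of h)) :
  (forall Z, Z \in h -> adp g h Z = 0 -> Z = 0) ->
  curvature_operator_on_h g h s T1 -> curvature_operator_on_h g h s T2 -> T1 = T2.
Proof.
move=> adp_inj [F1 [[F1sk F1sym F1E] _ F1T]] [F2 [[F2sk F2sym F2E] _ F2T]].
have skewB (A C : 'End(TM)) : skewM A -> skewM C -> skewM (A - C).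
  move=> Ask Csk X Y; rewrite !add_lfunE !opp_lfunE [LHS]metricMC.
  have mB (U0 U1 U2 : TM) : metricM U0 (U1 - U2) = metricM U0 U1 - metricM U0 U2.
    exact: linearB.
  by rewrite !mB !(metricMC Y) Ask Csk opprD.
have wsk (X Y : TM) : skewM (wedge X Y).
  have mE (U0 U1 U2 : TM) a c :
      metricM U0 (a *: U1 - c *: U2) = a * metricM U0 U1 - c * metricM U0 U2.
    by rewrite linearB 2!linearZ.
  move=> U W; rewrite !wedgeE [LHS]metricMC !mE opprB.
  by rewrite !(metricMC U) !(metricMC W); congr (_ - _); rewrite mulrC.
have iB (A C D : 'End(TM)) : inner2 (A - C) D = inner2 A D - inner2 C D.
  by rewrite /inner2 comp_lfunDl comp_lfunNl lftrB opprD.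
have F12w (X Y : TM) : F1 (wedge X Y) = F2 (wedge X Y).
  apply/eqP; rewrite -subr_eq0; apply/eqP/skewM_inner2_eq0.
    by apply: skewB; [apply: F1sk | apply: F2sk].
  by move=> Z W; rewrite iB F1E F2E subrr.
have F12 (A : 'End(TM)) : skewM A -> F1 A = F2 A.
  move=> Ask; apply/eqP; rewrite -subr_eq0; apply/eqP/skewM_inner2_eq0.
    by apply: skewB; [apply: F1sk | apply: F2sk].
  by move=> X Y; rewrite iB F1sym // F2sym // F12w subrr.
apply/lfunP => Z; apply: subvs_inj; apply/eqP; rewrite -subr_eq0.
apply/eqP/adp_inj; first by rewrite memvB ?subvsP.
have -> : adp g h (vsval (T1 Z) - vsval (T2 Z)) = adp g h (vsval (T1 Z)) - adp g h (vsval (T2 Z)).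
  exact: linearB.
by rewrite -F1T -F2T F12 ?subrr //; apply/adp_skew/subvsP.
Qed.

End SymmetricPair.

(** * Curvature of a symmetric space in local coordinates *)

Section DerivableMatrix.
Variables (R : realType) (E : normedModType R) (x v : E).

Lemma derivable_big_add (I : Type) (r : seq I) (P : pred I) (f : I -> E -> R) :
  (forall i, derivable (f i) x v) ->
  derivable (fun y => \sum_(i <- r | P i) f i y) x v.
Proof.
move=> df; elim: r => [|i r IH].
  by under eq_fun do rewrite big_nil; exact: derivable_cst.
under eq_fun do rewrite big_cons.
by case: (P i); [exact: (derivableD (df i) IH)|exact: IH].
Qed.

Lemma derivable_big_mul (I : Type) (r : seq I) (P : pred I) (f : I -> E -> R) :
  (forall i, derivable (f i) x v) ->
  derivable (fun y => \prod_(i <- r | P i) f i y) x v.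
Proof.
move=> df; elim: r => [|i r IH].
  by under eq_fun do rewrite big_nil; exact: derivable_cst.
under eq_fun do rewrite big_cons.
by case: (P i); [exact: (derivableM (df i) IH)|exact: IH].
Qed.

Lemma derivable_det n (M : E -> 'M[R]_n) :
  (forall i j, derivable (fun y => M y i j) x v) ->
  derivable (fun y => \det (M y)) x v.
Proof.
move=> dM; rewrite /determinant; apply: derivable_big_add => s.
apply: derivableM; first exact: derivable_cst.
by apply: derivable_big_mul => i; exact: dM.
Qed.

Lemma unitmx_near_line n (M : E -> 'M[R]_n) :
  (forall i j, derivable (fun y => M y i j) x v) -> M x \in unitmx ->
  \forall t \near (0 : R), M (t *: v + x) \in unitmx.
Proof.
move=> dM Mx; have /derivableP/derivable_line_cvg dcvg := derivable_det dM.
have d0 : \det (M x) != 0 by rewrite -unitfE -unitmxE.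
have dn := cvgr_neq0 _ dcvg d0.
near=> t; rewrite unitmxE unitfE; near: t; exact: dn.
Unshelve. all: by end_near. Qed.

Lemma derivable_invmx n (M : E -> 'M[R]_n) i j :
  (forall i j, derivable (fun y => M y i j) x v) -> M x \in unitmx ->
  derivable (fun y => invmx (M y) i j) x v.
Proof.
move=> dM Mx; have Mnear := unitmx_near_line dM Mx.
pose f y : R := (\det (M y))^-1 * \adj (M y) i j.
have df : derivable f x v.
  apply: derivableM.
    apply: derivableV; first by rewrite -unitfE -unitmxE.
    exact: derivable_det.
  rewrite (_ : (fun y => _) = (fun y => (-1) ^+ (j + i) * \det (row' j (col' i (M y))))).
    apply: derivableM; first exact: derivable_cst.
    apply: derivable_det => k l.
    rewrite (_ : (fun y => _) = (fun y => M y (lift j k) (lift i l))) //.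
    by apply/funext => y; rewrite !mxE.
  by apply/funext => y; rewrite mxE.
(* [invmx] returns its argument at a singular matrix, so the cofactor formula is available only
   where [M] stays invertible. *)
have fE : \forall t \near (0 : R), f (t *: v + x) = invmx (M (t *: v + x)) i j.
  near=> t; have Mt : M (t *: v + x) \in unitmx by near: t; exact: Mnear.
  by rewrite /f /invmx Mt [RHS]mxE.
have [] // := @is_derive_near_line R E _ f (fun y => invmx (M y) i j) x v _ fE
  (derivableP df).
Unshelve. all: by end_near. Qed.

End DerivableMatrix.

Section StarMatrices.
Variables (R : fieldType) (K : starAlgType R) (n : nat).
Local Notation V := (kmx K n).
Implicit Types X Y Z : V.

Lemma mulkmx_linearr X : linear (fun Y : V => X *m Y : V).
Proof.
move=> a Y Z; apply/matrixP => i j; rewrite !mxE scaler_sumr -big_split /=.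
by apply: eq_bigr => k _; rewrite !mxE mulrDr scalerAr.
Qed.

Lemma mulkmx_linearl Y : linear (fun X : V => X *m Y : V).
Proof.
move=> a X Z; apply/matrixP => i j; rewrite !mxE scaler_sumr -big_split /=.
by apply: eq_bigr => k _; rewrite !mxE mulrDl scalerAl.
Qed.

Lemma star1 : star (1 : K) = 1.
Proof. by rewrite -[star 1]mulr1 -{2}[1](@starK R K) -starM mulr1 starK. Qed.

Lemma star0 : star (0 : K) = 0.
Proof. by have := @star_linear R K (-1) 0 0; rewrite scaleN1r oppr0 addr0 scaleN1r addNr. Qed.

Lemma starD (a b : K) : star (a + b) = star a + star b.
Proof. by have := @star_linear R K 1 a b; rewrite !scale1r. Qed.

Lemma starN (a : K) : star (- a) = - star a.
Proof. by have := @star_linear R K (-1) a 0; rewrite star0 !addr0 !scaleN1r. Qed.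

Lemma star_sum (I : Type) (r : seq I) (P : pred I) (f : I -> K) :
  star (\sum_(i <- r | P i) f i) = \sum_(i <- r | P i) star (f i).
Proof. exact: (big_morph _ starD star0). Qed.

Lemma star_trK : involutive (@star_tr R K n).
Proof. by move=> X; apply/matrixP => i j; rewrite !mxE starK. Qed.

Lemma star_trM X Y : star_tr (X *m Y : V) = star_tr Y *m star_tr X.
Proof.
apply/matrixP => i j; rewrite !mxE star_sum; apply: eq_bigr => k _.
by rewrite !mxE starM.
Qed.

Lemma star_trN X : star_tr (- X) = - star_tr X.
Proof. by apply/matrixP => i j; rewrite !mxE starN. Qed.

Lemma star_trB X Y : star_tr (X - Y) = star_tr X - star_tr Y.
Proof. by apply/matrixP => i j; rewrite !mxE starD starN. Qed.

Lemma starZ a (x : K) : star (a *: x) = a *: star x.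
Proof. by have := @star_linear R K a x 0; rewrite star0 !addr0. Qed.

Lemma star_trZ a X : star_tr (a *: X) = a *: star_tr X.
Proof. by apply/matrixP => i j; rewrite !mxE starZ. Qed.

Lemma star_tr1 : star_tr (1%:M : V) = 1%:M.
Proof.
apply/matrixP => i j; rewrite !mxE eq_sym.
by case: eqP; rewrite ?mulr1n ?mulr0n ?star1 ?star0.
Qed.

Lemma star_mxtrace X : star (\tr (X : 'M[K]_n)) = \tr (star_tr X : 'M[K]_n).
Proof. by rewrite /mxtrace star_sum; apply: eq_bigr => i _; rewrite !mxE. Qed.

Lemma star_tr_mul_linearr X : linear (fun Y : V => star_tr X *m Y : V).
Proof. exact: mulkmx_linearr. Qed.

Lemma star_tr_mul_linearl Y : linear (fun X : V => star_tr X *m Y : V).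
Proof. by move=> a X Z; rewrite star_tr_linear mulkmx_linearl. Qed.

(** Over a noncommutative [K] no determinant argument applies. Instead, left multiplication by [X]
    is an injective endomorphism of a finite-dimensional space over [R], hence onto, and [X] has a
    right inverse. *)
Lemma unitary_mulC X : star_tr X *m X = 1%:M -> X *m star_tr X = 1%:M.
Proof.
move=> XX; pose L : 'End(V) := linfun (fun Y : V => X *m Y : V).
have LE Y : L Y = X *m Y by rewrite linfunE //; exact: mulkmx_linearr.
have kL : lker L == 0%VS.
  rewrite -subv0; apply/subvP => Y; rewrite memv_ker memv0 LE => /eqP XY0.
  by rewrite -[Y]mul1mx -XX -mulmxA XY0 mulmx0.
have := lker0_lfunVK kL (1%:M : V); rewrite LE.
move: (L^-1%VF (1%:M : V)) => Y XY.
by rewrite (_ : star_tr X = Y) // -[LHS]mulmx1 -XY mulmxA XX mul1mx.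
Qed.

End StarMatrices.

Lemma killing_suml (R : fieldType) (K : starAlgType R) (n : nat) (g : {vspace kmx K n})
    (I : Type) (r : seq I) (P : pred I) (F : I -> kmx K n) Y :
  killing g (\sum_(i <- r | P i) F i) Y = \sum_(i <- r | P i) killing g (F i) Y.
Proof. by rewrite killingC killing_sumr; under eq_bigr do rewrite killingC. Qed.

(** * Moving frames: from the structure equations to the curvature tensor *)

Section MovingFrame.
Variables (R : realType) (K : starAlgType R) (n : nat).
Local Notation V := (kmx K n).
Variables (g h : {vspace V}).
Hypothesis sp : symmetric_pair g h.
Local Notation p := (orthk g h).
Local Notation B := (killing g).
Local Notation m := (\dim p).
Local Notation TM := (subvs_of p).
Local Notation E := 'rV[R]_m.

Variables (U : set E) (e w : 'I_m -> E -> V) (de dw : 'I_m -> 'I_m -> E -> V)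
  (dde : 'I_m -> 'I_m -> 'I_m -> E -> V).
Hypotheses (oU : open U) (U0 : U 0).
Hypothesis e_p : forall j x, e j x \in p.
Hypothesis w_h : forall j x, U x -> w j x \in h.
Hypothesis de_p : forall i j x, de i j x \in p.
Hypothesis De : forall i j x, U x ->
  is_vderive x (delta_mx 0 i) (e j) (de i j x).
Hypothesis Dw : forall i j x, U x ->
  is_vderive x (delta_mx 0 i) (w j) (dw i j x).
Hypothesis Dde : forall k i j x, U x ->
  is_vderive x (delta_mx 0 k) (de i j) (dde k i j x).
Hypothesis dde_sym : forall k i j x, U x -> dde k i j x = dde i k j x.
Hypothesis torsion_free : forall i j x, U x ->
  de i j x + lbr (w i x) (e j x) = de j i x + lbr (w j x) (e i x).
Hypothesis curvature_form : forall i j x, U x ->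
  dw i j x - dw j i x + lbr (w i x) (w j x) = - lbr (e i x) (e j x).
Hypothesis frame0 : free [tuple vsproj p (e i 0) | i < m].

(* The covariant derivative of [e j] in the direction [i]. *)
Let nab i j x := de i j x + lbr (w i x) (e j x).
Let dnab k i j x := dde k i j x +
  (lbr (dw k i x) (e j x) + lbr (w i x) (de k j x)).

Definition frame_metric x : 'M[R]_m := \matrix_(i, j) - B (e i x) (e j x).
Local Notation gm := frame_metric.

Let nab_p i j x : U x -> nab i j x \in p.
Proof. by move=> Ux; rewrite memvD ?de_p // (sp_hp sp) ?w_h. Qed.

Let Dnab k i j x : U x -> is_vderive x (delta_mx 0 k) (nab i j) (dnab k i j x).
Proof.
move=> Ux; apply: is_vderiveD; first exact: Dde.
apply: is_vderive_bilinear; [exact: lbr_linearr|exact: lbr_linearl| |].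
  exact: Dw.
exact: De.
Qed.

(** Ricci identity for the connection form [w]: second derivatives of [e] cancel by [dde_sym], the
    Jacobi identity collects the brackets of [w], and [curvature_form] replaces what remains by [-
    [e k, e i]] acting on [e j]. *)
Let nab_comm k i j x : U x ->
  dnab k i j x + lbr (w k x) (nab i j x) -
    (dnab i k j x + lbr (w i x) (nab k j x)) =
  - lbr (lbr (e k x) (e i x)) (e j x).
Proof.
move=> Ux; rewrite /dnab /nab (dde_sym k i) // (lbrDr (w k x) (de i j x))
  (lbrDr (w i x) (de k j x)).
rewrite (jacobi (w k x) (w i x)).
rewrite -lbrNl -(curvature_form k i Ux) lbrDl lbrBl.
move: (lbr (dw k i x) _) (lbr (dw i k x) _) (lbr (w i x) (de k j x))
  (lbr (w k x) (de i j x)) (lbr (lbr (w k x) (w i x)) _)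
  (lbr (w i x) (lbr (w k x) _)) (dde i k j x) => A A' C D J J2 X.
apply/eqP; rewrite subr_eq -{1}(subrK A' A); move: (A - A') => a; apply/eqP.
by rewrite [LHS](AC ((1*((1*1)*1))*(1*(1*1))) ((2*6)*((1*(3*5))*(4*7))))%AC.
Qed.

Let inv_w i j l x : U x ->
  B (lbr (w i x) (e j x)) (e l x) = - B (e j x) (lbr (w i x) (e l x)).
Proof.
move=> Ux; rewrite lbrC killingNl (sp_killing_lbr sp) //.
- exact/sp_pg/e_p.
- exact/(sp_hg sp)/w_h.
- exact/sp_pg/e_p.
Qed.

(** Metric compatibility: the terms in [w] may be added because [ad w] is skew for [B] ([inv_w]). *)
Let Dgm i j l x : U x -> is_derive x (delta_mx 0 i) (fun y => gm y j l : R^o)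
  (- B (nab i j x) (e l x) - B (e j x) (nab i l x)).
Proof.
move=> Ux.
have DB : is_vderive x (delta_mx 0 i) (fun y => B (e j y) (e l y) : R^o)
    (B (de i j x) (e l x) + B (e j x) (de i l x)).
  apply: (@is_vderive_bilinear R E V V R^o (fun X Y => B X Y : R^o)).
  - by move=> X; exact: killing_linearr.
  - by move=> X; exact: killing_linearl.
  - exact: De.
  - exact: De.
have := is_vderiveN DB => /is_vderive_real.
rewrite (_ : (fun y => - B (e j y) (e l y) : R^o) = (fun y => gm y j l : R^o)); last first.
  by apply/funext => y; rewrite mxE.
congr is_derive.
by rewrite /nab killingDl killingDr inv_w //; ring.
Qed.

(** Koszul formula. Each of the three derivatives of the metric gives two terms; by symmetry of
    [nab] four of the six cancel and the other two are equal, which absorbs the [2^-1]. *)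
Let christoffelE l i j x : U x -> christoffel gm l i j x =
  \sum_k invmx (gm x) l k * - B (nab i j x) (e k x).
Proof.
move=> Ux; rewrite /christoffel mulr_sumr; apply: eq_bigr => k _.
have pE a c d : pderiv a (fun y => gm y c d) x =
    - B (nab a c x) (e d x) - B (e c x) (nab a d x).
  by have [_ <-] := Dgm a c d Ux.
have nsym a c : nab a c x = nab c a x by exact: torsion_free.
rewrite !pE (nsym j i) (nsym k j) (nsym k i) (killingC _ (e i x)) (killingC _ (e j x) (nab i k x)).
by field.
Qed.

Let nth_frame x (i : 'I_m) : vsval [tuple vsproj p (e i x) | i < m]`_i = e i x.
Proof. by rewrite -tnth_nth tnth_mktuple vsprojK. Qed.

Let frame_free x : gm x \in unitmx -> free [tuple vsproj p (e i x) | i < m].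
Proof.
move=> gmx; apply/freeP => c c0 i.
have {}c0 : \sum_i c i *: e i x = 0.
  have := congr1 vsval c0; rewrite linear0 linear_sum => c0V; rewrite -[RHS]c0V.
  by apply: eq_bigr => j _; rewrite [RHS]linearZ; congr (_ *: _); exact/esym/nth_frame.
have : (\row_i c i) *m gm x = 0.
  apply/rowP => j; rewrite !mxE; transitivity (- B (\sum_i c i *: e i x) (e j x)).
    rewrite killing_suml -sumrN; apply: eq_bigr => k _.
    by rewrite !mxE killingZl mulrN.
  by rewrite c0 killingC [killing _ _ 0]linear0 oppr0.
move=> /(congr1 (mulmx^~ (invmx (gm x)))); rewrite mulmxK // mul0mx => /rowP/(_ i).
by rewrite !mxE.
Qed.

(** Expansion through the inverse Gram matrix: the difference of the two sides is [B]-orthogonal to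
    the frame, which spans [p] by freeness and dimension, so it vanishes by definiteness. *)
Let frame_expand x Y : gm x \in unitmx -> Y \in p ->
  Y = \sum_l (\sum_k invmx (gm x) l k * - B Y (e k x)) *: e l x.
Proof.
move=> gmx Yp; set Z := (X in Y = X).
have Zp : Z \in p by apply: memv_suml => l _; rewrite memvZ.
have YZe k : B (e k x) (Y - Z) = 0.
  apply/eqP; rewrite killingBr subr_eq0 killing_sumr; apply/eqP.
  under eq_bigr do rewrite killingZr mulr_suml; rewrite exchange_big /=.
  have gV k' : \sum_l gm x k l * invmx (gm x) l k' = (k == k')%:R.
    by have /matrixP/(_ k k') := mulmxV gmx; rewrite !mxE.
  transitivity (\sum_k' (k == k')%:R * B Y (e k' x)).
    rewrite (bigD1 k) //= eqxx mul1r big1 ?addr0 1?killingC // => k' k'k.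
    by rewrite eq_sym (negPf k'k) mul0r.
  apply: eq_bigr => k' _; rewrite -gV mulr_suml; apply: eq_bigr => l _.
  by rewrite [gm x k l]mxE; ring.
have bas : basis_of {:TM} [tuple vsproj p (e i x) | i < m].
  rewrite basisEfree frame_free // subvf size_tuple.
  by rewrite dimvf /dim /=.
apply/eqP; rewrite -subr_eq0; apply/eqP.
apply: (@sp_nondeg _ _ _ _ _ sp p); [exact: capvSl|exact: memvB|move=> X Xp].
have [c ->] : exists c : 'I_m -> R, X = \sum_i c i *: e i x.
  exists (fun i => coord [tuple vsproj p (e i x) | i < m] i (vsproj p X)).
  have := congr1 vsval (coord_basis bas (memvf (vsproj p X))).
  rewrite vsprojK // linear_sum => {1}->; apply: eq_bigr => i _.
  by rewrite [LHS]linearZ; congr (_ *: _); exact: nth_frame.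
by rewrite killing_suml big1 // => i _; rewrite killingZl YZe mulr0.
Qed.

Let gm0_unit : gm 0 \in unitmx.
Proof.
rewrite -row_free_unit; apply: inj_row_free => v v0.
pose Y := \sum_i v 0 i *: e i 0.
have Yp : Y \in p by apply: memv_suml => l _; rewrite memvZ.
have Ye j : B Y (e j 0) = 0.
  have /rowP/(_ j) := v0; rewrite !mxE killing_suml => v0j.
  apply/eqP; rewrite -oppr_eq0 -sumrN; apply/eqP; rewrite -[RHS]v0j.
  by apply: eq_bigr => k _; rewrite killingZl mxE mulrN.
have Y0 : Y = 0.
  apply/eqP; apply: contraT => Y0; have := sp_neg sp (sp_pg Yp) Y0.
  rewrite {2}/Y killing_sumr big1 ?ltxx // => i _.
  by rewrite killingZr Ye mulr0.
apply/rowP => i; rewrite mxE; move/freeP : frame0 => /(_ (fun i => v 0 i)); apply.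
apply: subvs_inj; rewrite linear0 linear_sum -[RHS]Y0.
by apply: eq_bigr => j _; rewrite [LHS]linearZ; congr (_ *: _); exact: nth_frame.
Qed.

Let gm_near k : \forall t \near (0 : R), gm (t *: delta_mx 0 k + 0) \in unitmx.
Proof.
apply: unitmx_near_line gm0_unit => i j.
by have [] := Dgm k i j U0.
Qed.

Let U_near k : \forall t \near (0 : R), U (t *: delta_mx 0 k + 0).
Proof. by apply: near_line; exact: open_nbhs_nbhs. Qed.

Let nabE x i j : U x -> gm x \in unitmx ->
  nab i j x = \sum_l christoffel gm l i j x *: e l x.
Proof.
move=> Ux gmx; rewrite {1}(frame_expand gmx (nab_p i j Ux)).
by apply: eq_bigr => l _; rewrite christoffelE.
Qed.

(** The derivative is taken of the closed formula of [christoffelE], valid near [0] on the line;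
    second derivatives of the metric need not be formed. *)
Let Dchristoffel k l i j :
  derivable (fun x => christoffel gm l i j x : R) 0 (delta_mx 0 k).
Proof.
pose f x := \sum_a invmx (gm x) l a * - B (nab i j x) (e a x).
have df : derivable f 0 (delta_mx 0 k).
  apply: derivable_big_add => a; apply: derivableM.
    by apply: derivable_invmx gm0_unit => b c; have [] := Dgm k b c U0.
  have DB : is_vderive (0 : E) (delta_mx 0 k) (fun y => B (nab i j y) (e a y) : R^o)
      (B (dnab k i j 0) (e a 0) + B (nab i j 0) (de k a 0)).
    apply: (@is_vderive_bilinear R E V V R^o (fun X Y => B X Y : R^o)).
    - by move=> X; exact: killing_linearr.
    - by move=> X; exact: killing_linearl.
    - exact: Dnab.
    - exact: De.
  by have /is_vderive_real[] := is_vderiveN DB.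
have fE : \forall t \near (0 : R), f (t *: delta_mx 0 k + 0) =
    christoffel gm l i j (t *: delta_mx 0 k + 0).
  near=> t; rewrite christoffelE //; near: t; exact: U_near.
by have [] // := @is_derive_near_line R E _ f (christoffel gm l i j) 0 (delta_mx 0 k) _ fE
  (derivableP df).
Unshelve. all: by end_near. Qed.

(** Differentiates the frame expansion [nabE], which holds near [0] on each coordinate line, and
    compares with [Dnab] by uniqueness of derivatives. *)
Let dnabE k i j : dnab k i j 0 =
  \sum_l (pderiv k (christoffel gm l i j) 0 *: e l 0
           + christoffel gm l i j 0 *: de k l 0).
Proof.
have D2 : is_vderive (0 : E) (delta_mx 0 k)
    (fun x => \sum_l (christoffel gm l i j x : R^o) *: e l x)
    (\sum_l (pderiv k (christoffel gm l i j) 0 *: e l 0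
           + christoffel gm l i j 0 *: de k l 0)).
  apply: is_vderive_sum => l.
  apply: (@is_vderive_bilinear R E R^o V V (fun a X => (a : R) *: X)).
  - by move=> a b X Y; rewrite scalerDr !scalerA mulrC.
  - by move=> X a b c; rewrite scalerDl scalerA.
  - by apply/is_vderive_real/derivableP/Dchristoffel.
  - exact: De.
apply: is_vderive_uniq (Dnab k i j U0) _; apply: is_vderive_near_line D2.
near=> t; rewrite -nabE //; near: t; [exact: U_near|exact: gm_near].
Unshelve. all: by end_near. Qed.

(** Both sides are the commutator of second covariant derivatives of [e j]: once in components by
    Christoffel symbols, once by [nab_comm]. *)
Let riemann_upE i j k : \sum_l riemann_up gm l j k i 0 *: e l 0 =
  - lbr (lbr (e k 0) (e i 0)) (e j 0).
Proof.
(* Components of one iterated covariant derivative. The terms [de a q] from [dnabE] and the bracket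
   with [w a] recombine into [nab a q], which is expanded in the frame a second time. *)
have half a b c : \sum_l (pderiv a (christoffel gm l b c) 0 +
    \sum_q christoffel gm l a q 0 * christoffel gm q b c 0) *: e l 0 =
    dnab a b c 0 + lbr (w a 0) (nab b c 0).
  under eq_bigr do rewrite scalerDl scaler_suml; rewrite big_split /= dnabE.
  rewrite big_split /= -addrA; congr (_ + _); rewrite exchange_big /=.
  rewrite (nabE b c U0 gm0_unit) lbr_sumr -big_split /=; apply: eq_bigr => q _.
  transitivity (christoffel gm q b c 0 *: nab a q 0).
    rewrite (nabE a q U0 gm0_unit) scaler_sumr; apply: eq_bigr => l _.
    by rewrite scalerA mulrC.
  by rewrite scalerDr lbrZr.
rewrite -(nab_comm k i j U0) -!half -sumrB; apply: eq_bigr => l _.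
rewrite -scalerBl; congr (_ *: _); rewrite /riemann_up sumrB opprD.
by rewrite addrACA.
Qed.

(** Lowering the index with the metric [- B] cancels the minus sign of the curvature. *)
Lemma riemann_frame_metric i j k l : riemann gm i j k l 0 =
  B (lbr (lbr (e i 0) (e j 0)) (e l 0)) (e k 0).
Proof.
rewrite -[RHS]opprK -killingNl -riemann_upE killing_suml -sumrN.
by apply: eq_bigr => q _; rewrite killingZl mxE killingC -mulrN mulrC.
Qed.

End MovingFrame.

(** * The structure equation split into its [p]-part and its [h]-part *)

Section SymmetricSplitting.
Variables (R : realType) (K : starAlgType R) (n : nat).
Local Notation V := (kmx K n).
Variables (g h : {vspace V}).
Hypothesis sp : symmetric_pair g h.
Local Notation p := (orthk g h).
Local Notation pip := (daddv_pi p h).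

Lemma pip_id X : X \in p -> pip X = X.
Proof. exact/daddv_pi_id/sp_cap. Qed.

Lemma pip_compl X : X \in g -> X - pip X \in h.
Proof.
move=> Xg; have : X \in (p + h)%VS by rewrite -(sp_sum sp).
move=> /(daddv_pi_add (sp_cap sp)) piE.
suff -> : X - pip X = daddv_pi h p X by exact: memv_pi.
by apply/eqP; rewrite subr_eq addrC eq_sym piE.
Qed.

Lemma pip_h X : X \in h -> pip X = 0.
Proof.
move=> Xh; have Xg := sp_hg sp Xh.
have piXh : pip X \in h by rewrite -(subKr X (pip X)) memvB ?pip_compl.
by apply/eqP; rewrite -memv0 -(sp_cap sp) memv_cap memv_pi.
Qed.

Lemma lbr_split (X Y : V) : lbr X Y =
  (lbr (X - pip X) (Y - pip Y) + lbr (pip X) (pip Y)) +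
  (lbr (X - pip X) (pip Y) + lbr (pip X) (Y - pip Y)).
Proof.
rewrite addrACA -lbrDr subrK [lbr (pip X) _ + _]addrC -lbrDr subrK.
by rewrite -lbrDl subrK.
Qed.

Lemma pip_lbr (X Y : V) : X \in g -> Y \in g ->
  pip (lbr X Y) = lbr (X - pip X) (pip Y) + lbr (pip X) (Y - pip Y).
Proof.
move=> Xg Yg; have [Xh Yh] := (pip_compl Xg, pip_compl Yg).
have [Xp Yp] := (memv_pi p h X, memv_pi p h Y).
have inh : lbr (X - pip X) (Y - pip Y) + lbr (pip X) (pip Y) \in h.
  by apply: memvD; [exact: (sp_lieh sp)|exact: (sp_ppE sp)].
have inp : lbr (X - pip X) (pip Y) + lbr (pip X) (Y - pip Y) \in p.
  by apply: memvD; [exact: (sp_hp sp)|exact: (sp_ph sp)].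
transitivity (pip (lbr (X - pip X) (Y - pip Y) + lbr (pip X) (pip Y)) +
    pip (lbr (X - pip X) (pip Y) + lbr (pip X) (Y - pip Y))).
  by rewrite [in LHS]lbr_split; exact: linearD.
by rewrite (pip_h inh) (pip_id inp) add0r.
Qed.

(** Brackets within [h] and within [p] land in [h], so only mixed brackets survive projection to
    [p]; the result is the torsion-free equation. *)
Lemma maurer_cartan_p (A A' X Y : V) : X \in g -> Y \in g ->
  A - A' = - lbr X Y ->
  pip A + lbr (X - pip X) (pip Y) = pip A' + lbr (Y - pip Y) (pip X).
Proof.
move=> Xg Yg AE; apply/eqP; rewrite -subr_eq0 opprD addrACA -linearB AE.
by rewrite linearN /= pip_lbr // [lbr (pip X) _]lbrC addNr.
Qed.

(** The complementary part of the same equation, which identifies the curvature of the connection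
    form. *)
Lemma maurer_cartan_h (A A' X Y : V) : X \in g -> Y \in g ->
  A - A' = - lbr X Y ->
  (A - pip A) - (A' - pip A') + lbr (X - pip X) (Y - pip Y) =
  - lbr (pip X) (pip Y).
Proof.
move=> Xg Yg AE.
rewrite [_ - _ - _](_ : _ = (A - A') - pip (A - A')); last first.
  rewrite (_ : pip (A - A') = pip A - pip A'); last exact: linearB.
  move: (pip A) (pip A') => a a'.
  by rewrite !opprB [a' - A']addrC addrACA [- a + a']addrC.
rewrite AE [pip (- _)]linearN /= pip_lbr // [lbr X Y]lbr_split opprK.
move: (lbr (X - _) (Y - _)) (lbr (pip X) (pip Y))
  (lbr (X - _) (pip Y) + lbr _ (Y - _)) => a b c.
by rewrite opprD subrK opprD addrAC addNr add0r.
Qed.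

End SymmetricSplitting.

(** Expresses that the Lie algebra of [G] lies in [g] through left-translated velocities of maps
    into [G]; [star_tr] is the inverse on the groups considered. *)
Definition tangent_in (R : realType) (K : starAlgType R) (n : nat)
    (G : set (kmx K n)) (g : {vspace kmx K n}) : Prop :=
  forall (E : normedModType R) (c : E -> kmx K n) x v d,
    (\forall y \near x, G (c y)) -> is_vderive x v c d ->
    star_tr (c x) *m d \in g.

(** * Curvature of [G/H] in an arbitrary local parametrization *)

Section LocalParam.
Variables (R : realType) (K : starAlgType R) (n : nat).
Local Notation V := (kmx K n).
Variables (G : set V) (g h : {vspace V}).
Hypothesis sp : symmetric_pair g h.
Hypothesis G_unitary : forall X, G X -> star_tr X *m X = 1%:M.
Hypothesis G_tangent : tangent_in G g.
Local Notation p := (orthk g h).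
Local Notation B := (killing g).
Local Notation m := (\dim p).
Local Notation TM := (subvs_of p).
Local Notation E := 'rV[R]_m.
Local Notation pip := (daddv_pi p h).

Let smul (X Y : V) : V := star_tr X *m Y.

Let smulD (f f1 : V) (x v : E) (F F1 : E -> V) :
  is_vderive x v F f -> is_vderive x v F1 f1 ->
  is_vderive x v (fun y => smul (F y) (F1 y)) (smul f (F1 x) + smul (F x) f1).
Proof.
by apply: is_vderive_bilinear; [exact: star_tr_mul_linearr|exact: star_tr_mul_linearl].
Qed.

Lemma riemann_local_param s : local_param G g h s -> forall i j k l,
  riemann (metric_coord s) i j k l 0 =
  B (lbr (lbr (vsval (tnth (frame s 0) i)) (vsval (tnth (frame s 0) j)))
      (vsval (tnth (frame s 0) l))) (vsval (tnth (frame s 0) k)).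
Proof.
move=> [_ [U [oU U0 GU sm]] bas] i j k l.
(* Three derivatives of [s] occur: the Maurer-Cartan form uses one, the Christoffel symbols a
   second, and their derivatives a third. *)
pose s1 i := vpartial s i.
pose s2 i j := vpartial (vpartial s j) i.
pose s3 k i j := vpartial (vpartial (vpartial s j) i) k.
have smU : smooth_on U s by [].
have sm1 a : smooth_on U (vpartial s a) by exact: smooth_on_partial.
have sm2 a b : smooth_on U (vpartial (vpartial s b) a) by exact: smooth_on_partial.
have Ds a x : U x -> is_vderive x (delta_mx 0 a) s (s1 a x).
  exact: smooth_on_vderive smU.
have Ds1 a b x : U x -> is_vderive x (delta_mx 0 a) (s1 b) (s2 a b x).
  exact: smooth_on_vderive (sm1 b).
have Ds2 a b c x : U x -> is_vderive x (delta_mx 0 a) (s2 b c) (s3 a b c x).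
  exact: smooth_on_vderive (sm2 b c).
have s2C a b x : U x -> s2 a b x = s2 b a x.
  by move=> Ux; exact: smooth_on_partialC oU smU Ux.
have s3C a b c x : U x -> s3 a b c x = s3 b a c x.
  by move=> Ux; exact: smooth_on_partialC oU (sm1 c) Ux.
have mcE a x : mcform s a x = smul (s x) (s1 a x) by [].
clearbody s1 s2 s3; clear sm1 sm2.
pose th a x := smul (s x) (s1 a x).
pose dth a b x := smul (s1 a x) (s1 b x) + smul (s x) (s2 a b x).
pose ddth a b c x := (smul (s2 a b x) (s1 c x) + smul (s1 b x) (s2 a c x)) +
  (smul (s1 a x) (s2 b c x) + smul (s x) (s3 a b c x)).
have Dth a b x : U x -> is_vderive x (delta_mx 0 a) (th b) (dth a b x).
  by move=> Ux; exact: (smulD (Ds a x Ux) (Ds1 a b x Ux)).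
have Ddth a b c x : U x -> is_vderive x (delta_mx 0 a) (dth b c) (ddth a b c x).
  move=> Ux; apply: is_vderiveD.
    exact: (smulD (Ds1 a b x Ux) (Ds1 a c x Ux)).
  exact: (smulD (Ds a x Ux) (Ds2 a b c x Ux)).
have ddthC a b c x : U x -> ddth a b c x = ddth b a c x.
  move=> Ux; rewrite /ddth (s2C a b) // (s3C a b) //.
  by rewrite -!addrA; congr (_ + _); rewrite !addrA [smul _ _ + smul _ _]addrC.
have nearU x : U x -> \forall y \near x, U y by move=> Ux; apply: open_nbhs_nbhs; split.
have th_g a x : U x -> th a x \in g.
  move=> Ux; apply: (G_tangent _ (Ds a x Ux)).
  by apply: filterS (nearU x Ux) => y; exact: GU.
have ss x : U x -> smul (s x) (s x) = 1%:M by move=> /GU/G_unitary.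
have ss' x : U x -> s x *m star_tr (s x) = 1%:M.
  by move=> Ux; exact: unitary_mulC (ss x Ux).
(* Obtained by differentiating the constant [star_tr s *m s]. *)
have s1s a x : U x -> smul (s1 a x) (s x) = - th a x.
  move=> Ux; apply/eqP; rewrite -addr_eq0; apply/eqP.
  apply: (@is_vderive_uniq _ _ _ (fun y => smul (s y) (s y)) x (delta_mx 0 a)).
    exact: (smulD (Ds a x Ux) (Ds a x Ux)).
  apply: (@is_vderive_near_line R E V (fun=> 1%:M : V) (fun y => smul (s y) (s y)));
    last exact: is_vderive_cst.
  have cU := near_line (delta_mx 0 a) (nearU x Ux).
  by near=> t; rewrite ss //; near: t; exact: cU.
(* The structure equation. Second derivatives of [s] cancel by symmetry; inserting
   [s *m star_tr s = 1] between the two first derivatives turns the rest into products of [th]. *)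
have MC a b x : U x -> dth a b x - dth b a x = - lbr (th a x) (th b x).
  move=> Ux; rewrite /dth (s2C a b) // opprD addrACA subrr addr0.
  have sE c d : smul (s1 c x) (s1 d x) = - (th c x *m th d x).
    rewrite -mulNmx -s1s // /th /smul -mulmxA [s x *m _]mulmxA ss' // mul1mx //.
  by rewrite !sE /lbr opprB opprK addrC.
pose e a x := pip (th a x).
pose w a x := th a x - e a x.
have projE A : vsval (projp g h A) = pip A by rewrite vsprojK ?memv_pi.
have eE a x : vsval (projp g h (mcform s a x)) = e a x by rewrite projE mcE.
have frxE a x : vsval (tnth (frame s x) a) = e a x by rewrite tnth_mktuple eE.
have metE : metric_coord s = @frame_metric R K n g h e.
  apply/funext => x; apply/matrixP => a b.
  have -> : metric_coord s x a b =
      - B (vsval (tnth (frame s x) a)) (vsval (tnth (frame s x) b)).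
    by rewrite /metric_coord mxE.
  by rewrite (frxE a x) (frxE b x) /frame_metric mxE.
have frE a := frxE a 0.
rewrite metE !frE.
apply: (@riemann_frame_metric R K n g h sp U e w (fun a b x => pip (dth a b x))
  (fun a b x => dth a b x - pip (dth a b x)) (fun a b c x => pip (ddth a b c x))) => //.
- by move=> a x; exact: memv_pi.
- by move=> a x Ux; apply: (pip_compl sp); exact: th_g.
- by move=> a b x; exact: memv_pi.
- by move=> a b x Ux; apply: is_vderive_lfun; exact: Dth.
- by move=> a b x Ux; apply: is_vderiveB; [|apply: is_vderive_lfun]; exact: Dth.
- by move=> a b c x Ux; apply: is_vderive_lfun; exact: Ddth.
- by move=> a b c x Ux; rewrite ddthC.
- by move=> a b x Ux; apply: (maurer_cartan_p sp); do ?exact: th_g; exact: MC.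
- by move=> a b x Ux; apply: (maurer_cartan_h sp); do ?exact: th_g; exact: MC.
have := basis_free bas; congr (is_true (free _)); congr tval.
apply: eq_from_tnth => a; rewrite [RHS]tnth_mktuple; apply: subvs_inj.
by rewrite vsprojK ?memv_pi // frE.
Unshelve. all: by end_near. Qed.

Lemma curvature_local_param s : local_param G g h s ->
  forall X Y Z W : TM, curvature s X Y Z W =
    B (lbr (lbr (vsval X) (vsval Y)) (vsval W)) (vsval Z).
Proof.
move=> lps X Y Z W; have riemE := riemann_local_param lps.
case: lps => [_ _ bas].
pose f i := vsval (tnth (frame s 0) i).
have fexp (Q : TM) : vsval Q = \sum_i coord (frame s 0) i Q *: f i.
  have := congr1 vsval (coord_basis bas (memvf Q)); rewrite linear_sum => {1}->.
  apply: eq_bigr => i _; rewrite [LHS]linearZ; congr (_ *: _).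
  by rewrite /f (tnth_nth 0).
have lbr_suml (F : 'I_m -> V) Q : lbr (\sum_i F i) Q = \sum_i lbr (F i) Q.
  by rewrite lbrC lbr_sumr -sumrN; apply: eq_bigr => i _; rewrite -lbrC.
have lbrZl (a : R) (P Q : V) : lbr (a *: P) Q = a *: lbr P Q.
  by rewrite lbrC lbrZr -scalerN -lbrC.
rewrite [vsval X]fexp 2!lbr_suml killing_suml; apply: eq_bigr => i _.
rewrite [vsval Y]fexp lbr_sumr lbr_suml killing_suml; apply: eq_bigr => j _.
rewrite [vsval Z]fexp killing_sumr; apply: eq_bigr => k _.
rewrite [vsval W]fexp lbr_sumr killing_suml; apply: eq_bigr => l _.
rewrite riemE (lbrZl _ (f i)) (lbrZr _ _ (f j)) (lbrZr _ _ (f l)).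
rewrite 2!lbrZl killingZr 3!killingZl.
by rewrite -/(f i) -/(f j) -/(f k) -/(f l); ring.
Qed.

End LocalParam.

(** * Traces over a star algebra *)

Section TraceTools.
Variable F : fieldType.

Lemma lftr_hom_comm (W1 W2 : vectType F) (f : 'Hom(W1, W2)) (f' : 'Hom(W2, W1)) :
  lftr (f \o f')%VF = lftr (f' \o f)%VF.
Proof. by rewrite /lftr !(passmx.mxof_comp _ _ (vbasisP _)) mxtrace_mulC. Qed.

Lemma lftr_sum (W : vectType F) (I : Type) (r : seq I) (P : pred I) (f : I -> 'End(W)) :
  lftr (\sum_(i <- r | P i) f i) = \sum_(i <- r | P i) lftr (f i).
Proof. exact: linear_sum. Qed.

(** With [i] the inclusion and [r] the map [f'] landing in [U], [f] is [r \o i] and [f'] is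
    [i \o r], so the trace is the same. In this way traces over [g] and [p] become traces over all
    matrices. *)
Lemma lftr_restrict (W : vectType F) (U : {vspace W}) (f : 'End(subvs_of U))
    (f' : 'End(W)) :
  (forall w, f' w \in U) -> (forall u, vsval (f u) = f' (vsval u)) -> lftr f = lftr f'.
Proof.
move=> f'U ff'; pose i : 'Hom(subvs_of U, W) := linfun (@vsval F W U).
pose r : 'Hom(W, subvs_of U) := (linfun (vsproj U) \o f')%VF.
have iE u : i u = vsval u by rewrite linfunE //; exact: linearP.
have rE w : r w = vsproj U (f' w).
  by rewrite comp_lfunE linfunE //; exact: linearP.
have -> : f = (r \o i)%VF.
  by apply/lfunP => u; rewrite comp_lfunE iE rE -ff' vsvalK.
have -> : f' = (i \o r)%VF.
  by apply/lfunP => w; rewrite comp_lfunE iE rE vsprojK.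
exact: lftr_hom_comm.
Qed.

End TraceTools.

Section MatrixTrace.
Variables (R : fieldType) (K : starAlgType R) (n : nat).
Local Notation V := (kmx K n).
Implicit Types (A B X Y : V) (a b z : K).

Definition lrmul a b : 'End(K) := linfun (fun z => a * z * b).
Definition star_lrmul a b : 'End(K) := linfun (fun z => a * star z * b).

Lemma lrmulE a b z : lrmul a b z = a * z * b.
Proof. by rewrite linfunE // => c x y; rewrite mulrDr mulrDl -scalerAr -scalerAl. Qed.

Lemma star_lrmulE a b z : star_lrmul a b z = a * star z * b.
Proof.
by rewrite linfunE // => c x y; rewrite star_linear mulrDr mulrDl -scalerAr -scalerAl.
Qed.

Definition mxlrmul A B : 'End(V) := linfun (fun X : V => (A *m X *m B : V)).
Definition star_mxlrmul A B : 'End(V) :=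
  linfun (fun X : V => (A *m star_tr X *m B : V)).

Lemma mxlrmulE A B X : mxlrmul A B X = A *m X *m B.
Proof.
by rewrite linfunE // => c Y Z; rewrite (mulkmx_linearr A) (mulkmx_linearl B).
Qed.

Lemma star_mxlrmulE A B X : star_mxlrmul A B X = A *m star_tr X *m B.
Proof.
rewrite linfunE // => c Y Z.
by rewrite star_tr_linear (mulkmx_linearr A) (mulkmx_linearl B).
Qed.

Let emb_fun (i j : 'I_n) z : V := \matrix_(k, l) if (k == i) && (l == j) then z else 0.
Let emb i j : 'Hom(K, V) := linfun (emb_fun i j).
Let pr (i j : 'I_n) : 'Hom(V, K) := linfun (fun X : V => X i j).

Let embE i j z : emb i j z = emb_fun i j z.
Proof.
rewrite linfunE // => a x y; apply/matrixP => k l; rewrite !mxE.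
by case: ifP; rewrite ?scaler0 ?addr0.
Qed.

Let prE i j X : pr i j X = X i j.
Proof. by rewrite linfunE // => a x y; rewrite !mxE. Qed.

(** The identity is the sum of the maps [emb i j \o pr i j], and cyclicity turns each term into the
    trace of a diagonal block acting on [K]. *)
Lemma lftr_kmx (f : 'End(V)) (c : 'I_n -> 'I_n -> 'End(K)) :
  (forall i j z, f (\matrix_(k, l) if (k == i) && (l == j) then z else 0) i j = c i j z) ->
  lftr f = \sum_i \sum_j lftr (c i j).
Proof.
move=> fc; have -> : f = \sum_i \sum_j (f \o (emb i j \o pr i j))%VF.
  apply/lfunP => X; rewrite sum_lfunE.
  under eq_bigr do rewrite sum_lfunE.
  under eq_bigr do under eq_bigr do rewrite !comp_lfunE prE embE.
  under eq_bigr do rewrite -linear_sum.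
  rewrite -linear_sum; congr (f _); apply/matrixP => k l.
  rewrite summxE (bigD1 k) //= summxE (bigD1 l) //= mxE !eqxx /=.
  rewrite big1 => [|j jl]; last by rewrite mxE [l == _]eq_sym (negPf jl) andbF.
  rewrite big1 ?addr0 // => i ik; rewrite summxE big1 // => j _.
  by rewrite mxE [k == _]eq_sym (negPf ik).
rewrite lftr_sum; apply: eq_bigr => i _; rewrite lftr_sum; apply: eq_bigr => j _.
rewrite comp_lfunA lftr_hom_comm; congr lftr; apply/lfunP => z.
by rewrite !comp_lfunE prE embE fc.
Qed.

Let mul_emb A i j z k l : (A *m emb_fun i j z) k l = if l == j then A k i * z else 0.
Proof.
rewrite mxE (bigD1 i) //= mxE eqxx /= big1 ?addr0 => [|q qi].
  by case: ifP => // _; rewrite mulr0.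
by rewrite mxE (negPf qi) mulr0.
Qed.

Let mul_emb_mul A B i j z k l : (A *m emb_fun i j z *m B) k l = A k i * z * B j l.
Proof.
rewrite mxE (bigD1 j) //= mul_emb eqxx big1 ?addr0 // => q qj.
by rewrite mul_emb (negPf qj) mul0r.
Qed.

Lemma lrmul_linearl b : linear (lrmul^~ b).
Proof.
move=> c x y; apply/lfunP => z; rewrite add_lfunE scale_lfunE !lrmulE.
by rewrite !mulrDl -!scalerAl.
Qed.

Lemma lrmul_linearr a : linear (lrmul a).
Proof.
move=> c x y; apply/lfunP => z; rewrite add_lfunE scale_lfunE !lrmulE.
by rewrite mulrDr -scalerAr.
Qed.

HB.instance Definition _ a :=
  GRing.isLinear.Build R K 'End(K) *:%R (lrmul a) (lrmul_linearr a).

Lemma lrmul_suml b (f : 'I_n -> K) : lrmul (\sum_i f i) b = \sum_i lrmul (f i) b.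
Proof.
apply/lfunP => z; rewrite sum_lfunE lrmulE !mulr_suml.
by apply: eq_bigr => i _; rewrite lrmulE.
Qed.

(** The diagonal block at [(i, j)] is [z |-> A i i * z * B j j], and summation in each argument
    separately produces the two traces. *)
Lemma lftr_mxlrmul A B : lftr (mxlrmul A B) = lftr (lrmul (\tr A) (\tr B)).
Proof.
rewrite (@lftr_kmx _ (fun i j => lrmul (A i i) (B j j))) => [|i j z]; last first.
  by rewrite mxlrmulE mul_emb_mul lrmulE.
rewrite /mxtrace lrmul_suml lftr_sum; apply: eq_bigr => i _.
by rewrite [lrmul _ (\sum_ _ _)]linear_sum lftr_sum.
Qed.

(** Transposition sends position [(i, j)] to [(j, i)], so the same entry of [A] and of [B] meets in
    each block; the sum is later read as the trace of [A *m star_tr B]. *)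
Lemma lftr_star_mxlrmul A B :
  lftr (star_mxlrmul A B) = \sum_i \sum_j lftr (star_lrmul (A i j) (B i j)).
Proof.
apply: lftr_kmx => i j z; rewrite star_mxlrmulE star_lrmulE.
rewrite [star_tr _](_ : _ = emb_fun j i (star z)) ?mul_emb_mul //.
by apply/matrixP => k l; rewrite !mxE andbC; case: ifP => // _; rewrite star0.
Qed.

End MatrixTrace.

(** [d] is the real dimension of [K] and [re] the real part. The factor [2 - d = 1 - (d - 1)] is the
    trace of the involution, which fixes the real line and negates the imaginary part. Only
    one-sided multiplications are listed: over the quaternions the trace of [z |-> a * z * b] is
    [4 re a re b], not a multiple of [re (a * b)]. *)
Record trace_form (R : realType) (K : starAlgType R) (re : K -> R^o) (d : R) : Prop :=
  TraceForm {
  re_linear : linear re;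
  reC : forall a b, re (a * b) = re (b * a);
  re_gt0 : forall a, a != 0 -> 0 < re (a * star a);
  lftr_lrmull : forall a, lftr (lrmul a 1) = d * re a;
  lftr_lrmulr : forall a, lftr (lrmul 1 a) = d * re a;
  lftr_star_lrmul : forall a b,
    lftr (star_lrmul a b) = (2 - d) * re (a * star b) }.

Section TraceForm.
Variables (R : realType) (K : starAlgType R) (re : K -> R^o) (d : R).
Hypothesis tf : trace_form re d.
Variable n : nat.
Local Notation V := (kmx K n).
Implicit Types A B C X Y Z : V.

Lemma re0 : re 0 = 0.
Proof.
by have := re_linear tf (-1) 0 0; rewrite !scaleN1r oppr0 addr0 addNr.
Qed.

Lemma reZ a x : re (a *: x) = a * re x.
Proof. by have := re_linear tf a x 0; rewrite re0 !addr0. Qed.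

Lemma reD x y : re (x + y) = re x + re y.
Proof. by have := re_linear tf 1 x y; rewrite !scale1r. Qed.

Lemma reN x : re (- x) = - re x.
Proof. by rewrite -scaleN1r reZ mulN1r. Qed.

Lemma re_sum (I : Type) (r : seq I) (P : pred I) (f : I -> K) :
  re (\sum_(i <- r | P i) f i) = \sum_(i <- r | P i) re (f i).
Proof. exact: (big_morph _ reD re0). Qed.

Definition rtr (A : V) : R := re (\tr (A : 'M[K]_n)).

Lemma rtrN A : rtr (- A) = - rtr A.
Proof. by rewrite /rtr raddfN reN. Qed.

Lemma rtrC A B : rtr (A *m B) = rtr (B *m A).
Proof.
rewrite /rtr /mxtrace !re_sum.
under eq_bigr do rewrite mxE re_sum.
under [RHS]eq_bigr do rewrite mxE re_sum.
rewrite exchange_big /=; apply: eq_bigr => i _; apply: eq_bigr => j _.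
exact: (reC tf).
Qed.

(** Source of definiteness: for skew [A] this trace is [- rtr (A *m A)], a sum of squared norms of
    the entries. *)
Lemma rtr_star_gt0 A : A != 0 -> 0 < rtr (A *m star_tr A).
Proof.
move=> A0; have re_ge0 a : 0 <= re (a * star a).
  have [->|a0] := eqVneq a 0; first by rewrite mul0r re0.
  exact/ltW/(re_gt0 tf).
have /existsP[[i j] /= Aij] : [exists ij : 'I_n * 'I_n, A ij.1 ij.2 != 0].
  apply: contraT; rewrite negb_exists => /forallP A_0.
  case/negP: A0; apply/eqP/matrixP => i j; rewrite mxE; apply/eqP.
  by have := A_0 (i, j); rewrite negbK.
rewrite /rtr /mxtrace re_sum /=.
under eq_bigr do rewrite mxE re_sum.
rewrite (bigD1 i) //= (bigD1 j) //= !mxE.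
rewrite ltr_wpDr ?ltr_wpDr ?(re_gt0 tf) ?sumr_ge0 // => *; last by rewrite !mxE.
by apply: sumr_ge0 => k _; rewrite !mxE.
Qed.

Lemma lftr_mxlrmul_scalarr A (C : V) (c : R) : \tr (C : 'M[K]_n) = c *: 1 ->
  lftr (mxlrmul A C) = c * d * rtr A.
Proof.
move=> Cc; rewrite lftr_mxlrmul Cc [lrmul _ _]linearZ lftrZ.
by rewrite (lftr_lrmull tf) mulrA.
Qed.

Lemma lftr_mxlrmul_scalarl A (C : V) (c : R) : \tr (C : 'M[K]_n) = c *: 1 ->
  lftr (mxlrmul C A) = c * d * rtr A.
Proof.
move=> Cc; rewrite lftr_mxlrmul Cc.
have -> : lrmul (c *: 1) (\tr (A : 'M[K]_n)) = c *: lrmul 1 (\tr (A : 'M[K]_n)).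
  by have := @lrmul_linearl R K (\tr (A : 'M[K]_n)) c 1 0;
    rewrite addr0 => ->; rewrite [X in _ + X](_ : _ = 0) ?addr0 //;
    apply/lfunP => z; rewrite lrmulE !mul0r zero_lfunE.
by rewrite lftrZ (lftr_lrmulr tf) mulrA.
Qed.

Lemma lftr_star_mxlrmul_rtr A B :
  lftr (star_mxlrmul A B) = (2 - d) * rtr (A *m star_tr B).
Proof.
rewrite lftr_star_mxlrmul /rtr /mxtrace re_sum mulr_sumr /=.
apply: eq_bigr => i _; rewrite mxE re_sum mulr_sumr.
by apply: eq_bigr => j _; rewrite !mxE (lftr_star_lrmul tf).
Qed.

Lemma lbr_lbr X Y Z : lbr X (lbr Y Z) =
  X *m Y *m Z - X *m Z *m Y - Y *m Z *m X + Z *m Y *m X.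
Proof. by rewrite /lbr mulmxBl mulmxBr !mulmxA opprB addrA addrAC. Qed.

(** The map [Z |-> [X, [Y, C Z C]]] expanded into two-sided multiplications, to which the trace
    formulas apply; [C] will be the identity or [J]. *)
Definition ad_lrmul X Y C : 'End(V) :=
  mxlrmul (X *m Y *m C) C - mxlrmul (X *m C) (C *m Y)
  - mxlrmul (Y *m C) (C *m X) + mxlrmul C (C *m Y *m X).
Definition ad_star_lrmul X Y C : 'End(V) :=
  star_mxlrmul (X *m Y *m C) C - star_mxlrmul (X *m C) (C *m Y)
  - star_mxlrmul (Y *m C) (C *m X) + star_mxlrmul C (C *m Y *m X).

Lemma ad_lrmulE X Y C Z : ad_lrmul X Y C Z = lbr X (lbr Y (C *m Z *m C)).
Proof.
by rewrite lbr_lbr !(add_lfunE, opp_lfunE) !mxlrmulE !mulmxA.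
Qed.

Lemma ad_star_lrmulE X Y C Z :
  ad_star_lrmul X Y C Z = lbr X (lbr Y (C *m star_tr Z *m C)).
Proof.
by rewrite lbr_lbr !(add_lfunE, opp_lfunE) !star_mxlrmulE !mulmxA.
Qed.

Section Commuting.
Variables (X Y C : V) (c : R).
Hypotheses (Xsk : star_tr X = - X) (Ysk : star_tr Y = - Y).
Hypotheses (C2 : C *m C = 1%:M) (Cst : star_tr C = C) (Ctr : \tr (C : 'M[K]_n) = c *: 1).
Hypotheses (XC : X *m C = C *m X) (YC : Y *m C = C *m Y).

(** The two middle terms stay as traces of [lrmul], being outside the scope of [trace_form]; they
    vanish later by [g_trl] and [g_trr]. *)
Lemma lftr_ad_lrmul : lftr (ad_lrmul X Y C) = 2 * c * d * rtr (X *m Y *m C)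
  - lftr (lrmul (\tr (X *m C : 'M[K]_n)) (\tr (C *m Y : 'M[K]_n)))
  - lftr (lrmul (\tr (Y *m C : 'M[K]_n)) (\tr (C *m X : 'M[K]_n))).
Proof.
rewrite /ad_lrmul lftrD !lftrB (lftr_mxlrmul_scalarr _ Ctr).
rewrite (lftr_mxlrmul_scalarl _ Ctr) (rtrC _ X) -YC mulmxA -!lftr_mxlrmul.
by ring.
Qed.

(** Each of the four terms contributes the same amount, since the two copies of [C] meet and
    [C *m C = 1]. The value is therefore independent of [C], so the cases [1] and [J] will
    cancel. *)
Lemma lftr_ad_star_lrmul : lftr (ad_star_lrmul X Y C) = 4 * (2 - d) * rtr (X *m Y).
Proof.
rewrite /ad_star_lrmul lftrD !lftrB !lftr_star_mxlrmul_rtr !star_trM Cst Xsk Ysk.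
rewrite !(mulNmx, mulmxN, opprK) !rtrN.
have -> : X *m Y *m C *m C = X *m Y by rewrite -mulmxA C2 mulmx1.
have -> : X *m C *m (Y *m C) = X *m Y by rewrite YC mulmxA -[X *m C *m C]mulmxA C2 mulmx1.
have -> : Y *m C *m (X *m C) = Y *m X by rewrite XC mulmxA -[Y *m C *m C]mulmxA C2 mulmx1.
have -> : rtr (C *m (X *m (Y *m C))) = rtr (X *m Y).
  by rewrite rtrC -!mulmxA C2 mulmx1.
rewrite (rtrC Y X); ring.
Qed.

End Commuting.

Lemma rtrZ a (A : V) : rtr (a *: A) = a * rtr A.
Proof.
rewrite /rtr -reZ; congr re; rewrite /mxtrace scaler_sumr.
by apply: eq_bigr => i _; rewrite mxE.
Qed.

End TraceForm.

(** * Killing form and isotropy form of the splitting defined by an involution *)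

Section InvolutiveSplitting.
Variables (R : realType) (K : starAlgType R) (re : K -> R^o) (d : R).
Hypothesis tf : trace_form re d.
Variable n : nat.
Local Notation V := (kmx K n).
Variables (g h : {vspace V}) (J : V) (c : R).
Local Notation rtr := (@rtr R K re n).
Local Notation p := (orthk g h).
Local Notation kappa := (n%:R * d - 4 + 2 * d).
Hypothesis kappa_gt0 : 0 < kappa.
Hypothesis g_skew : forall X, X \in g -> star_tr X = - X.
Hypothesis g_skew_ideal : forall X Y : V, X \in g -> star_tr Y = - Y -> lbr X Y \in g.
Hypothesis g_trl : forall X a, X \in g -> lftr (lrmul (\tr (X : 'M[K]_n)) a) = 0.
Hypothesis g_trr : forall X a, X \in g -> lftr (lrmul a (\tr (X : 'M[K]_n))) = 0.
Hypotheses (J2 : J *m J = 1%:M) (Jst : star_tr J = J).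
Hypothesis Jtr : \tr (J : 'M[K]_n) = c *: 1.
Hypothesis g_J : forall X, X \in g -> J *m X *m J \in g.
Hypothesis g_off : forall X : V, star_tr X = - X -> J *m X *m J = - X -> X \in g.
Hypothesis hP : forall X, (X \in h) = (X \in g) && (J *m X *m J == X).
Implicit Types X Y Z W : V.

Let lie_g : lie_closed g.
Proof. by move=> X Y Xg Yg; apply: g_skew_ideal => //; exact: g_skew. Qed.

(** The trace over [g] is that of [ad X \o ad Y] after the projection [(Z - star_tr Z) / 2], whose
    image is moved into [g] by [g_skew_ideal]. With [C = 1] this gives [(2 n d - 4 (2 - d)) / 2],
    the constant [kappa]. *)
Lemma killing_rtr X Y : X \in g -> Y \in g -> killing g X Y = kappa * rtr (X *m Y).
Proof.
move=> Xg Yg; have [Xs Ys] := (g_skew Xg, g_skew Yg).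
pose F : 'End(V) := 2^-1 *: (ad_lrmul X Y 1%:M - ad_star_lrmul X Y 1%:M).
have FE Z : F Z = lbr X (lbr Y (2^-1 *: (Z - star_tr Z))).
  rewrite scale_lfunE add_lfunE opp_lfunE ad_lrmulE ad_star_lrmulE.
  by rewrite !mul1mx !mulmx1 lbrZr lbrZr !lbrBr.
rewrite /killing (@lftr_restrict _ _ g _ F).
- have tr1 : \tr (1%:M : 'M[K]_n) = (n%:R : R) *: 1 by rewrite mxtrace1 scaler_nat.
  rewrite lftrZ lftrB (lftr_ad_lrmul tf _ tr1) ?mul1mx ?mulmx1 //.
  rewrite (lftr_ad_star_lrmul tf Xs Ys) ?mul1mx ?mulmx1 ?star_tr1 //.
  by rewrite !g_trl // !subr0; field.
- move=> Z; rewrite FE; apply: (g_skew_ideal Xg); apply/g_skew/(g_skew_ideal Yg).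
  by rewrite star_trZ star_trB star_trK -scalerN opprB.
move=> u; have us := g_skew (subvsP u).
rewrite FE us opprK -mulr2n -[vsval u *+ 2]scaler_nat scalerA mulVf ?pnatr_eq0 // scale1r.
by rewrite comp_lfunE !vsval_adm.
Qed.

Let JJ X : J *m (J *m X *m J) *m J = X.
Proof. by rewrite !mulmxA J2 mul1mx -mulmxA J2 mulmx1. Qed.

Let hg X : X \in h -> X \in g. Proof. by rewrite hP => /andP[]. Qed.
Let hJ X : X \in h -> J *m X *m J = X. Proof. by rewrite hP => /andP[_ /eqP]. Qed.

Let hJC X : X \in h -> X *m J = J *m X.
Proof. by move=> /hJ {1}<-; rewrite -mulmxA J2 mulmx1. Qed.

Let Jlbr X Y : J *m lbr X Y *m J = lbr (J *m X *m J) (J *m Y *m J).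
Proof.
rewrite /lbr mulmxBr mulmxBl.
have E A C : J *m (A *m C) *m J = J *m A *m J *m (J *m C *m J).
  by rewrite -[in RHS]mulmxA [J *m (J *m C *m J)]mulmxA [J *m (J *m C)]mulmxA J2 mul1mx !mulmxA.
by rewrite !E.
Qed.

Let rtrJ X Y : rtr (J *m X *m J *m Y) = rtr (X *m (J *m Y *m J)).
Proof. by rewrite -!mulmxA (rtrC tf) -!mulmxA. Qed.

Lemma killing_lt0 X : X \in g -> X != 0 -> killing g X X < 0.
Proof.
move=> Xg X0; rewrite killing_rtr // pmulr_rlt0 // -oppr_gt0.
by have := rtr_star_gt0 tf X0; rewrite g_skew // mulmxN (rtrN tf).
Qed.

Let JZ a X : J *m (a *: X) *m J = a *: (J *m X *m J : V).
Proof.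
have := mulkmx_linearr J a X 0; rewrite /= !addr0 mulmx0 addr0 => ->.
by have := mulkmx_linearl J a (J *m X) 0; rewrite /= !addr0 mul0mx addr0.
Qed.

Let JD X Y : J *m (X + Y) *m J = J *m X *m J + J *m Y *m J.
Proof. by rewrite mulmxDr mulmxDl. Qed.

Let JN X : J *m (- X) *m J = - (J *m X *m J).
Proof. by rewrite mulmxN mulNmx. Qed.

(** Conjugation by [J] preserves [rtr], fixes [Y] and negates [X], so [rtr (Y *m X)] equals its
    opposite. *)
Let anti_p X : X \in g -> J *m X *m J = - X -> X \in p.
Proof.
move=> Xg JX; apply/memv_orthk; split=> // Y Yh; rewrite (killing_rtr (hg Yh) Xg).
suff /eqP : rtr (Y *m X) = - rtr (Y *m X).
  by rewrite -subr_eq0 opprK -mulr2n mulrn_eq0 /= => /eqP ->; rewrite mulr0.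
by rewrite -{1}(hJ Yh) rtrJ JX mulmxN (rtrN tf).
Qed.

Let p_g X : X \in p -> X \in g. Proof. by case/memv_orthk. Qed.

Let half_p X : X \in g -> 2^-1 *: (X - J *m X *m J) \in p.
Proof.
move=> Xg; apply: anti_p; first by rewrite memvZ ?memvB ?g_J.
by rewrite JZ JD JN JJ -scalerN opprB addrC.
Qed.

Let half_h X : X \in g -> 2^-1 *: (X + J *m X *m J) \in h.
Proof.
move=> Xg; rewrite hP memvZ ?memvD ?g_J //= JZ JD JJ.
by rewrite [J *m X *m J + X]addrC.
Qed.

Let halfD X : 2^-1 *: (X - J *m X *m J) + 2^-1 *: (X + J *m X *m J) = X.
Proof.
rewrite -scalerDr addrACA addNr addr0 -mulr2n -[X *+ 2]scaler_nat scalerA.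
by rewrite mulVf ?pnatr_eq0 // scale1r.
Qed.

(** The [J]-invariant half of [X] lies both in [h] and in its orthogonal [p], so it vanishes by
    definiteness. With [anti_p], this makes [p] the [-1] eigenspace in [g]. *)
Let p_anti X : X \in p -> J *m X *m J = - X.
Proof.
move=> Xp; have Xg := p_g Xp; have Zh := half_h Xg.
have Zp : 2^-1 *: (X + J *m X *m J) \in p.
  by rewrite -(addKr (2^-1 *: (X - J *m X *m J)) (_ *: (_ + _))) halfD memvD ?memvN ?half_p.
have Z0 : 2^-1 *: (X + J *m X *m J) = 0.
  apply/eqP; apply: contraT => Z0; have := killing_lt0 (hg Zh) Z0.
  by case/memv_orthk: Zp => _ /(_ _ Zh) ->; rewrite ltxx.
apply/eqP; rewrite -addr_eq0 addrC.
by move/eqP: Z0; rewrite scaler_eq0 invr_eq0 pnatr_eq0.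
Qed.

(** Conjugation by [J] preserves brackets and has [h] and [p] as its eigenspaces for [1] and [-1],
    which gives the bracket relations. *)
Lemma involutive_symmetric_pair : symmetric_pair g h.
Proof.
split=> //.
- by apply/subvP => X; exact: hg.
- move=> X Y Xh Yh; rewrite hP lie_g ?hg //=.
  by rewrite Jlbr !hJ.
- move=> X Y Xp Yp; rewrite hP lie_g ?p_g //=.
  by rewrite Jlbr !p_anti // lbrNl lbrC lbrNl opprK -lbrC.
- apply/eqP; rewrite eqEsubv subv_add capvSl; apply/andP; split; last first.
    by apply/subvP => X; exact: hg.
  apply/subvP => X Xg.
  by rewrite -(halfD X) memv_add ?half_p ?half_h.
- by move=> X; exact: killing_lt0.
Qed.

(** [ad X \o ad Y] after the projection [off] of all matrices onto [p], a product of two commuting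
    projections: onto skew matrices and onto [J]-anti-invariant ones. Each brings a factor
    [1 / 2]. *)
Let F X Y : 'End(V) := 4^-1 *:
  (ad_lrmul X Y 1%:M - ad_lrmul X Y J
   - (ad_star_lrmul X Y 1%:M - ad_star_lrmul X Y J)).

Let off Z : V := 4^-1 *: (Z - J *m Z *m J - (star_tr Z - J *m star_tr Z *m J)).

Let FE X Y Z : F X Y Z = lbr X (lbr Y (off Z)).
Proof.
have lB (f f' : 'End(V)) : (f - f') Z = f Z - f' Z.
  by rewrite add_lfunE opp_lfunE.
rewrite scale_lfunE 3!lB 2!ad_lrmulE 2!ad_star_lrmulE !mul1mx !mulmx1.
rewrite /off (lbrZr _ Y) (lbrZr _ X); congr (_ *: _).
have lB2 A C : lbr X (lbr Y (A - C)) = lbr X (lbr Y A) - lbr X (lbr Y C).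
  by rewrite (lbrBr Y) (lbrBr X).
by rewrite 3!lB2.
Qed.

Let off_p Z : off Z \in p.
Proof.
have offs : star_tr (off Z) = - off Z.
  rewrite star_trZ !star_trB !star_trM Jst !star_trK !mulmxA /off -scalerN.
  by rewrite [in RHS]opprB.
have offJ : J *m off Z *m J = - off Z.
  have JB A C : J *m (A - C : V) *m J = J *m A *m J - J *m C *m J by rewrite JD JN.
  rewrite /off JZ -scalerN 3!JB !JJ; apply: (congr1 (fun A : V => 4^-1 *: A)).
  by rewrite !opprB addrC.
by apply: anti_p => //; exact: g_off.
Qed.

Let isotropy_lftr X Y : X \in h -> Y \in h -> isotropy_form g h X Y = lftr (F X Y).
Proof.
have sp := involutive_symmetric_pair; move=> Xh Yh.
apply: lftr_restrict => [Z|u].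
  by rewrite FE; exact: (sp_hp sp Xh (sp_hp sp Yh (off_p Z))).
rewrite FE comp_lfunE !(vsval_adp sp) //; congr (lbr _ (lbr _ _)).
have up := subvsP u; have us := g_skew (p_g up).
rewrite /off us mulmxN mulNmx (p_anti up) !opprK.
have -> : vsval u + vsval u - (- vsval u - vsval u) = 4%:R *: vsval u.
  by rewrite opprD !opprK -!mulr2n -mulrnA scaler_nat.
by rewrite scalerA mulVf ?pnatr_eq0 // scale1r.
Qed.

(** The relation [W *m J = eps *: W] makes the contribution of [C = J] a multiple of [rtr (X *m W)],
    while the star terms cancel; [(2 n d - 2 eps c d) / 4] is left. *)
Lemma isotropy_form_eigen (eps : R) X W : X \in h -> W \in h ->
  W *m J = eps *: W -> isotropy_form g h X W = d * (n%:R - eps * c) / 2 * rtr (X *m W).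
Proof.
move=> Xh Wh WJ; have [Xs Ws] := (g_skew (hg Xh), g_skew (hg Wh)).
have tr1 : \tr (1%:M : 'M[K]_n) = (n%:R : R) *: 1 by rewrite mxtrace1 scaler_nat.
have trZ (A : V) : \tr ((eps *: A) : 'M[K]_n) = eps *: \tr (A : 'M[K]_n).
  by rewrite /mxtrace scaler_sumr; apply: eq_bigr => i _; rewrite mxE.
have lB (a b a' b' : 'End(V)) k :
    lftr (k *: (a - b - (a' - b'))) = k * (lftr a - lftr b - (lftr a' - lftr b')).
  by rewrite lftrZ !lftrB.
have c1 (A : V) : A *m 1%:M = 1%:M *m A by rewrite mulmx1 mul1mx.
have E1 := lftr_ad_lrmul tf X tr1 (c1 W).
rewrite !mulmx1 !mul1mx !g_trl ?hg // !subr0 in E1.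
have E2 := lftr_ad_lrmul tf X Jtr (hJC Wh).
have XWJ : X *m W *m J = eps *: (X *m W : V).
  rewrite -mulmxA WJ; have := mulkmx_linearr X eps W 0.
  by rewrite /= !addr0 mulmx0 addr0.
rewrite -(hJC Wh) WJ !trZ XWJ (rtrZ tf) in E2.
have tr0 a : lftr (lrmul (eps *: \tr (W : 'M[K]_n)) a) = 0.
  have := @lrmul_linearl R K a eps (\tr (W : 'M[K]_n)) 0; rewrite addr0 => ->.
  rewrite [X in _ + X](_ : _ = 0) ?addr0; first by rewrite lftrZ g_trl ?hg // mulr0.
  by apply/lfunP => z; rewrite lrmulE !mul0r zero_lfunE.
have tr0' a : lftr (lrmul a (eps *: \tr (W : 'M[K]_n))) = 0.
  have -> : lrmul a (eps *: \tr (W : 'M[K]_n)) = eps *: lrmul a (\tr (W : 'M[K]_n)).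
    exact: linearZ.
  by rewrite lftrZ g_trr ?hg // mulr0.
rewrite tr0 tr0' !subr0 in E2.
have E3 := lftr_ad_star_lrmul tf Xs Ws (mul1mx _) (star_tr1 K n) (c1 X) (c1 W).
have E4 := lftr_ad_star_lrmul tf Xs Ws J2 Jst (hJC Xh) (hJC Wh).
rewrite (isotropy_lftr Xh Wh) lB E1 E2 E3 E4.
by field.
Qed.

Lemma isotropy_form_center X W : X \in h -> W \in centerv h ->
  isotropy_form g h X W = killing g X W.
Proof.
have sp := involutive_symmetric_pair.
move=> Xh /memv_centerv[Wh Wc]; have [Xg Wg] := (hg Xh, hg Wh).
(* The order is exchanged so that [ad W] acts last: for [H] in [h] it meets [[X, H]], an element of
   [h], and kills it. *)
rewrite killingC /isotropy_form lftrC -/(isotropy_form g h W X) isotropy_lftr //.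
have [Xs Ws] := (g_skew Xg, g_skew Wg).
apply/esym; apply: lftr_restrict => [Z|u].
  by apply: p_g; rewrite FE; exact: (sp_hp sp Wh (sp_hp sp Xh (off_p Z))).
rewrite comp_lfunE !vsval_adm // FE; set Y := vsval u.
have Yg : Y \in g by exact: subvsP.
have YE : Y = off Y + 2^-1 *: (Y + J *m Y *m J).
  rewrite -[LHS]halfD; congr (_ + _).
  rewrite /off (g_skew Yg) mulmxN mulNmx.
  have -> : Y - J *m Y *m J - (- Y - - (J *m Y *m J)) = 2%:R *: (Y - J *m Y *m J).
    by rewrite -opprD opprK -mulr2n scaler_nat.
  by rewrite scalerA (_ : 4^-1 * 2%:R = 2^-1) //; field.
have := half_h Yg; move: YE; move: (2^-1 *: _) (off Y) => H O -> Hh.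
rewrite (lbrDr X) (lbrDr W) [lbr W (lbr X H)]lbrC Wc ?oppr0 ?addr0 //.
exact: (sp_lieh sp Xh Hh).
Qed.

End InvolutiveSplitting.

(** * From eigenvalues of the isotropy form to the curvature operator *)

Section Operator.
Variables (R : realType) (K : starAlgType R) (n : nat).
Local Notation V := (kmx K n).
Variables (G : set V) (g h u1 u2 u3 : {vspace V}) (a1 a2 a3 : R).
Hypothesis sp : symmetric_pair g h.
Hypothesis G_unitary : forall X, G X -> star_tr X *m X = 1%:M.
Hypothesis G_tangent : tangent_in G g.
Hypothesis hE : h = (u1 + u2 + u3)%VS.
Hypothesis indep : forall W1 W2 W3, W1 \in u1 -> W2 \in u2 -> W3 \in u3 ->
  W1 + W2 + W3 = 0 -> [/\ W1 = 0, W2 = 0 & W3 = 0].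
Hypotheses (a1n0 : a1 != 0) (a2n0 : a2 != 0) (a3n0 : a3 != 0).
Hypothesis eig1 : forall X W, X \in h -> W \in u1 ->
  isotropy_form g h X W = 2 * a1 * killing g X W.
Hypothesis eig2 : forall X W, X \in h -> W \in u2 ->
  isotropy_form g h X W = 2 * a2 * killing g X W.
Hypothesis eig3 : forall X W, X \in h -> W \in u3 ->
  isotropy_form g h X W = 2 * a3 * killing g X W.

Let u1h : (u1 <= h)%VS. Proof. by rewrite hE -addvA addvSl. Qed.
Let u2h : (u2 <= h)%VS.
Proof. by rewrite hE [(u1 + u2)%VS]addvC -addvA addvSl. Qed.
Let u3h : (u3 <= h)%VS. Proof. by rewrite hE addvSr. Qed.

(** Twice [B(Y, T W)] is the isotropy form, so an eigenvalue relation between the two forms is one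
    for [T] because [B] is nondegenerate on [h]. *)
Lemma curvature_operator_scalars s : local_param G g h s ->
  exists T : 'End(subvs_of h),
    [/\ unique (curvature_operator_on_h g h s) T, scalar_on T u1 a1,
        scalar_on T u2 a2 & scalar_on T u3 a3].
Proof.
move=> lps; have [T [TB Tcurv]] := curvature_operator_exists sp.
have sc (u : {vspace V}) a : (forall X W, X \in h -> W \in u ->
    isotropy_form g h X W = 2 * a * killing g X W) -> scalar_on T u a.
  move=> eig Z Zu; apply: subvs_inj; apply/eqP; rewrite -subr_eq0; apply/eqP.
  apply: (@sp_nondeg _ _ _ _ _ sp h); first exact: (sp_sub sp).
    by rewrite memvB ?subvsP.
  move=> Y Yh; have := TB (vsproj h Y) Z; rewrite vsprojK // eig // => TYZ.
  rewrite killingBr [vsval (a *: Z)]linearZ /= killingZr.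
  apply: (@mulfI _ (2 : R)); first by rewrite pnatr_eq0.
  by rewrite mulr0 mulrBr TYZ mulrA subrr.
exists T; split; [split | exact: sc | exact: sc | exact: sc].
  by apply: Tcurv; exact: (curvature_local_param sp G_unitary G_tangent lps).
move=> T' T'curv; apply: (curvature_operator_uniq sp) T'curv; last first.
  by apply: Tcurv; exact: (curvature_local_param sp G_unitary G_tangent lps).
(* Injectivity of [adp]: if [adp g h Z = 0], the isotropy form vanishes on [Z], hence [T Z = 0], and
   nonzero eigenvalues on independent summands force [Z = 0]. *)
move=> Z Zh Z0; have := Zh; rewrite hE => /memv_addP[Z12 /memv_addP[Z1 Z1u [Z2 Z2u ->]]].
move=> [Z3 Z3u ZE].
have TZ : vsval (T (vsproj h Z)) = a1 *: Z1 + a2 *: Z2 + a3 *: Z3.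
  have -> : vsproj h Z = vsproj h Z1 + vsproj h Z2 + vsproj h Z3 by rewrite ZE !linearD.
  have Tv (u : {vspace V}) a W : scalar_on T u a -> W \in u -> W \in h ->
      vsval (T (vsproj h W)) = a *: W.
    move=> Tu Wu Wh; have -> : T (vsproj h W) = a *: vsproj h W.
      by apply: Tu; rewrite vsprojK.
    by rewrite [LHS]linearZ; congr (_ *: _); exact: vsprojK.
  have [Z1h Z2h Z3h] : [/\ Z1 \in h, Z2 \in h & Z3 \in h].
    by split; [exact: (subvP u1h)|exact: (subvP u2h)|exact: (subvP u3h)].
  rewrite -(Tv _ _ _ (sc _ _ eig1) Z1u Z1h) -(Tv _ _ _ (sc _ _ eig2) Z2u Z2h).
  by rewrite -(Tv _ _ _ (sc _ _ eig3) Z3u Z3h) !linearD.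
have TZ0 : vsval (T (vsproj h Z)) = 0.
  apply: (@sp_nondeg _ _ _ _ _ sp h); [exact: (sp_sub sp)|exact: subvsP|].
  move=> Y Yh; have := TB (vsproj h Y) (vsproj h Z).
  rewrite !vsprojK // /isotropy_form Z0 comp_lfun0r lftr0.
  by move=> /eqP; rewrite mulf_eq0 pnatr_eq0 /= => /eqP.
have [] := @indep (a1 *: Z1) (a2 *: Z2) (a3 *: Z3); rewrite ?memvZ -?TZ ?TZ0 //.
move=> /eqP + /eqP + /eqP; rewrite !scaler_eq0 (negPf a1n0) (negPf a2n0) (negPf a3n0) /=.
by rewrite ZE => /eqP -> /eqP -> /eqP ->; rewrite !addr0.
Qed.

End Operator.

Section UnitaryTangent.
Variables (R : realType) (K : starAlgType R) (n : nat).
Local Notation V := (kmx K n).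

Lemma star_tr_lbr (X Y : V) : star_tr X = - X -> star_tr Y = - Y ->
  star_tr (lbr X Y) = - lbr X Y.
Proof.
by move=> Xs Ys; rewrite /lbr star_trB !star_trM Xs Ys !mulNmx !mulmxN !opprK opprB.
Qed.

Lemma unitary_tangent (E : normedModType R) (c : E -> V) x v d :
  (\forall y \near x, star_tr (c y) *m c y = 1%:M) -> is_vderive x v c d ->
  star_tr (star_tr (c x) *m d) = - (star_tr (c x) *m d).
Proof.
move=> cu Dc; rewrite star_trM star_trK; apply/eqP; rewrite -addr_eq0; apply/eqP.
apply: (@is_vderive_uniq R E V (fun y => star_tr (c y) *m c y : V) x v).
  exact: (is_vderive_bilinear (@star_tr_mul_linearr R K n)
    (@star_tr_mul_linearl R K n) Dc Dc).
apply: (@is_vderive_near_line R E V (fun=> 1%:M : V)); last exact: is_vderive_cst.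
have cl := near_line v cu.
by near=> t; apply/esym; near: t; exact: cl.
Unshelve. all: by end_near. Qed.

End UnitaryTangent.

Section Blocks.
Variables (R : realType) (K : starAlgType R) (p q : nat).
Local Notation V := (kmx K (p + q)).

(** Conjugation by this matrix is the Cartan involution of the Grassmannian; its fixed points are
    the block-diagonal matrices. *)
Definition blockJ : V := block_mx 1%:M 0 0 (- 1%:M).
Local Notation J := blockJ.

Lemma star_tr_block (A : 'M[K]_p) (B : 'M[K]_(p, q)) (C : 'M[K]_(q, p)) (D : 'M[K]_q) :
  star_tr (block_mx A B C D : V) =
  block_mx (star_tr (A : kmx K p)) (map_mx star C)^T (map_mx star B)^T (star_tr (D : kmx K q)).
Proof. by rewrite /star_tr map_block_mx tr_block_mx. Qed.

Lemma blockJ2 : J *m J = 1%:M.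
Proof.
rewrite /J mulmx_block !mulmx0 !mul0mx !addr0 !add0r mul1mx mulmxN mulmx1 opprK.
by rewrite -scalar_mx_block.
Qed.

Lemma star_tr_blockJ : star_tr J = J.
Proof.
have z m' n' : (map_mx star (0 : 'M[K]_(m', n')))^T = 0.
  by apply/matrixP => i j; rewrite !mxE star0.
by rewrite /J star_tr_block star_trN !star_tr1 !z.
Qed.

Lemma mxtrace_blockJ : \tr (J : 'M[K]_(p + q)) = (p%:R - q%:R : R) *: 1.
Proof.
by rewrite /J mxtrace_block raddfN /= !mxtrace1 scalerBl !scaler_nat.
Qed.

Lemma conj_blockJ (A : 'M[K]_p) (B : 'M[K]_(p, q)) (C : 'M[K]_(q, p)) (D : 'M[K]_q) :
  J *m block_mx A B C D *m J = block_mx A (- B) (- C) D.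
Proof.
rewrite /J !mulmx_block !mulmx0 !mul0mx !addr0 !add0r !mul1mx !mulmx1.
by rewrite !mulNmx !mulmxN !mul1mx !mulmx1 ?opprK ?oppr0 ?addr0 ?add0r.
Qed.

Lemma mem_blockdiag_J (X : V) : (X \in blockdiag K p q) = (J *m X *m J == X).
Proof.
rewrite memv_blockdiag -[in RHS](submxK (X : 'M[K]_(p + q))) conj_blockJ.
have N0 m' n' (M : 'M[K]_(m', n')) : - M = M -> M = 0.
  move=> NM; apply/matrixP => i j; rewrite mxE.
  have /matrixP/(_ i j) := NM; rewrite mxE => /eqP; rewrite eq_sym -addr_eq0 -mulr2n.
  by rewrite -scaler_nat scaler_eq0 pnatr_eq0 /= => /eqP.
apply/andP/eqP => [[/eqP -> /eqP ->]|]; first by rewrite !oppr0.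
by move=> /eq_block_mx[_ /N0 -> /N0 -> _].
Qed.

End Blocks.

(** * Grassmannians *)

(** What the trace computations ask of [g]. [ga_trl] and [ga_trr] hold for different reasons: traces
    vanish in the special unitary and real cases, and are purely imaginary in the quaternionic
    one. *)
Record grassmann_algebra (R : realType) (K : starAlgType R) (d : R) (p q : nat)
    (g : {vspace kmx K (p + q)}) : Prop := GrassmannAlgebra {
  ga_kappa : 0 < (p + q)%:R * d - 4 + 2 * d;
  ga_skew : forall X, X \in g -> star_tr X = - X;
  ga_ideal : forall X Y : kmx K (p + q),
    X \in g -> star_tr Y = - Y -> lbr X Y \in g;
  ga_trl : forall (X : kmx K (p + q)) a,
    X \in g -> lftr (lrmul (\tr (X : 'M[K]_(p + q))) a) = 0;
  ga_trr : forall (X : kmx K (p + q)) a,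
    X \in g -> lftr (lrmul a (\tr (X : 'M[K]_(p + q)))) = 0;
  ga_J : forall X : kmx K (p + q), X \in g ->
    blockJ K p q *m X *m blockJ K p q \in g;
  ga_off : forall X : kmx K (p + q), star_tr X = - X ->
    blockJ K p q *m X *m blockJ K p q = - X -> X \in g }.

Section Grassmann.
Variables (R : realType) (K : starAlgType R) (re : K -> R^o) (d : R).
Hypothesis tf : trace_form re d.
Variables (p q : nat) (g : {vspace kmx K (p + q)}).
Hypothesis ga : grassmann_algebra d g.
Local Notation V := (kmx K (p + q)).
Local Notation J := (blockJ K p q).
Local Notation h := (g :&: blockdiag K p q)%VS.
Local Notation kappa := ((p + q)%:R * d - 4 + 2 * d).

Let hP (X : V) : (X \in h) = (X \in g) && (J *m X *m J == X).
Proof. by rewrite memv_cap mem_blockdiag_J. Qed.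

Lemma grassmann_symmetric_pair : symmetric_pair g h.
Proof.
exact: (involutive_symmetric_pair tf (ga_kappa ga) (ga_skew ga) (ga_ideal ga)
  (ga_trl ga) (blockJ2 K p q) (ga_J ga) hP).
Qed.

Let eig (eps : R) (X W : V) : X \in h -> W \in h -> W *m J = eps *: W ->
  isotropy_form g h X W =
  2 * (d * ((p + q)%:R - eps * (p%:R - q%:R)) / 4 / kappa) * killing g X W.
Proof.
move=> Xh Wh WJ; have k0 := lt0r_neq0 (ga_kappa ga).
have [Xg Wg] : X \in g /\ W \in g by move: Xh Wh; rewrite !hP => /andP[-> _] /andP[-> _].
rewrite (killing_rtr tf (ga_skew ga) (ga_ideal ga) (ga_trl ga) Xg Wg).
rewrite (isotropy_form_eigen tf (ga_kappa ga) (ga_skew ga) (ga_ideal ga)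
  (ga_trl ga) (ga_trr ga) (blockJ2 K p q) (star_tr_blockJ K p q)
  (mxtrace_blockJ K p q) (ga_J ga) (ga_off ga) hP Xh Wh WJ).
by move: kappa k0 => k k0; field.
Qed.

Lemma isotropy_form_emb_l (u : {vspace kmx K p}) (X W : V) :
  X \in h -> W \in h -> W \in emb_l q u ->
  isotropy_form g h X W = 2 * (1 / 2 * (d * q%:R / kappa)) * killing g X W.
Proof.
move=> Xh Wh /memv_emb_l[A _ WE]; have k0 := lt0r_neq0 (ga_kappa ga).
(* A matrix supported on the first block satisfies [W *m J = W], and [(p + q) - (p - q) = 2 q], the
   size of the opposite block. *)
rewrite (@eig 1) //; last first.
  by rewrite scale1r WE mulmx_block !mulmx0 !mul0mx !addr0 mulmx1.
move: kappa k0 => k k0; rewrite natrD.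
by field.
Qed.

Lemma isotropy_form_emb_r (u : {vspace kmx K q}) (X W : V) :
  X \in h -> W \in h -> W \in emb_r p u ->
  isotropy_form g h X W = 2 * (1 / 2 * (d * p%:R / kappa)) * killing g X W.
Proof.
move=> Xh Wh /memv_emb_r[D _ WE]; have k0 := lt0r_neq0 (ga_kappa ga).
rewrite (@eig (-1)) //; last first.
  rewrite scaleN1r WE mulmx_block !mulmx0 !mul0mx !addr0 add0r mulmxN mulmx1.
  by rewrite opp_block_mx !oppr0.
move: kappa k0 => k k0; rewrite natrD.
by field.
Qed.

Lemma isotropy_form_centerv (X W : V) : X \in h -> W \in centerv h ->
  isotropy_form g h X W = 2 * (1 / 2) * killing g X W.
Proof.
move=> Xh Wc; rewrite (isotropy_form_center tf (ga_kappa ga) (ga_skew ga)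
  (ga_ideal ga) (ga_trl ga) (blockJ2 K p q) (star_tr_blockJ K p q) (ga_J ga)
  (ga_off ga) hP Xh Wc).
by field.
Qed.

End Grassmann.

Section EmbIndependent.
Variables (R : fieldType) (K : starAlgType R) (p q : nat).

Lemma emb_lr_indep (u : {vspace kmx K p}) (u' : {vspace kmx K q}) (X Y : kmx K (p + q)) :
  X \in emb_l q u -> Y \in emb_r p u' -> X + Y = 0 -> X = 0 /\ Y = 0.
Proof.
move=> /memv_emb_l[A _ ->] /memv_emb_r[D _ ->]; rewrite add_block_mx !addr0 add0r.
rewrite -[RHS](@block_mx0 _ p q p q) => /eq_block_mx[-> _ _ ->].
by rewrite block_mx0.
Qed.

Lemma emb_lr_direct (u : {vspace kmx K p}) (u' : {vspace kmx K q}) :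
  directv (emb_l q u + emb_r p u').
Proof.
apply/directv_addP/eqP; rewrite -subv0; apply/subvP => X /memv_capP[Xl Xr].
have Xr' : - X \in emb_r p u' by rewrite memvN.
by have [-> _] := emb_lr_indep Xl Xr' (subrr X); rewrite mem0v.
Qed.

End EmbIndependent.

Section SkewGrassmann.
Variables (R : realType) (K : starAlgType R) (re : K -> R^o) (d : R).
Hypothesis tf : trace_form re d.
Variables (p q : nat) (hp : (1 <= p)%N) (hq : (1 <= q)%N).
Hypothesis d_gt0 : 0 < d.
Local Notation kappa := ((p + q)%:R * d - 4 + 2 * d).
Hypothesis kappa_gt0 : 0 < kappa.
Hypothesis skew_trl : forall (x a : K), star x = - x -> lftr (lrmul x a) = 0.
Hypothesis skew_trr : forall (x a : K), star x = - x -> lftr (lrmul a x) = 0.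
Local Notation V := (kmx K (p + q)).
Local Notation g := (skewherm K (p + q)).
Local Notation h := (g :&: blockdiag K p q)%VS.
Local Notation h1 := (emb_l q (skewherm K p)).
Local Notation h2 := (emb_r p (skewherm K q)).

Lemma skewherm_grassmann_algebra : grassmann_algebra d g.
Proof.
split=> //.
- by move=> X; rewrite memv_skewherm => /eqP.
- move=> X Y; rewrite !memv_skewherm => /eqP Xs Ys.
  by apply/eqP/star_tr_lbr.
- move=> X a; rewrite memv_skewherm => /eqP Xs; apply: skew_trl.
  by rewrite star_mxtrace Xs raddfN.
- move=> X a; rewrite memv_skewherm => /eqP Xs; apply: skew_trr.
  by rewrite star_mxtrace Xs raddfN.
- move=> X; rewrite !memv_skewherm => /eqP Xs; apply/eqP.
  by rewrite !star_trM star_tr_blockJ Xs mulNmx mulmxN mulmxA.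
- by move=> X Xs _; rewrite memv_skewherm Xs.
Qed.

Lemma skewherm_block0 (A : kmx K p) (D : kmx K q) :
  (block_mx A 0 0 D \in g) = (A \in skewherm K p) && (D \in skewherm K q).
Proof.
have z m' n' : (map_mx star (0 : 'M[K]_(m', n')))^T = 0.
  by apply/matrixP => i j; rewrite !mxE star0.
rewrite !memv_skewherm star_tr_block !z opp_block_mx !oppr0.
by apply/eqP/andP => [/eq_block_mx[-> _ _ ->]|[/eqP -> /eqP ->]].
Qed.

Lemma skewherm_blockdiag : h = (h1 + h2)%VS.
Proof.
have Z0 (k : nat) : (0 : kmx K k) \in skewherm K k by exact: mem0v.
apply/eqP; rewrite eqEsubv subv_add; apply/and3P; split.
- apply/subvP => X /memv_capP[]; rewrite memv_blockdiag.
  rewrite -[X in X \in g](submxK (X : 'M[K]_(p + q))) => + /andP[/eqP X12 /eqP X21].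
  rewrite X12 X21 skewherm_block0 => /andP[As Ds].
  rewrite -[X](submxK (X : 'M[K]_(p + q))) X12 X21.
  rewrite (_ : block_mx _ _ _ _ = block_mx (ulsubmx (X : 'M[K]_(p + q))) 0 0 0
      + block_mx 0 0 0 (drsubmx (X : 'M[K]_(p + q))) :> V).
    by apply: memv_add; [apply/memv_emb_l|apply/memv_emb_r];
      [exists (ulsubmx (X : 'M[K]_(p + q)))|exists (drsubmx (X : 'M[K]_(p + q)))].
  by rewrite add_block_mx !addr0 !add0r.
- apply/subvP => X /memv_emb_l[A Au ->]; rewrite memv_cap memv_blockdiag.
  by rewrite skewherm_block0 Au Z0 block_mxKur block_mxKdl !eqxx.
- apply/subvP => X /memv_emb_r[D Du ->]; rewrite memv_cap memv_blockdiag.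
  by rewrite skewherm_block0 Du Z0 block_mxKur block_mxKdl !eqxx.
Qed.

Lemma skewherm_grassmann (G : set V) :
  (forall X, G X -> star_tr X *m X = 1%:M) ->
  [/\ h = (h1 + h2)%VS, directv (h1 + h2) &
      forall s : 'rV[R]_(\dim (orthk g h)) -> V, local_param G g h s ->
      exists T : 'End(subvs_of h),
      [/\ unique (curvature_operator_on_h g h s) T,
          scalar_on T h1 (1 / 2 * (d * q%:R / kappa)) &
          scalar_on T h2 (1 / 2 * (d * p%:R / kappa))]].
Proof.
move=> G_unitary; have ga := skewherm_grassmann_algebra.
split; [exact: skewherm_blockdiag|exact: emb_lr_direct|move=> s lps].
have kn0 := lt0r_neq0 kappa_gt0; have dn0 := lt0r_neq0 d_gt0.
have n0 (k : nat) : (1 <= k)%N -> 1 / 2 * (d * k%:R / kappa) != 0.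
  by move=> k0; rewrite !mulf_neq0 ?invr_neq0 ?pnatr_eq0 -?lt0n // oner_eq0.
have h1h X : X \in h1 -> X \in h.
  by move: X; apply/subvP; rewrite skewherm_blockdiag addvSl.
have h2h X : X \in h2 -> X \in h.
  by move: X; apply/subvP; rewrite skewherm_blockdiag addvSr.
(* No separate center summand occurs here, so the first summand is [0], with eigenvalue [1] as a
   nonzero placeholder. *)
have [||||||T [uT _ T1 T2]] := @curvature_operator_scalars R K (p + q) G g h 0 h1 h2
  1 (1 / 2 * (d * q%:R / kappa)) (1 / 2 * (d * p%:R / kappa))
  (grassmann_symmetric_pair tf ga) G_unitary _ _ _ (oner_neq0 R) (n0 q hq) (n0 p hp) _ _ _ s lps.
- move=> E c x v e cG Dc; rewrite memv_skewherm; apply/eqP/unitary_tangent => //.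
  by near=> y; apply: G_unitary; near: y; exact: cG.
- by rewrite add0v skewherm_blockdiag.
- move=> W1 W2 W3; rewrite memv0 => /eqP -> W2h W3h; rewrite add0r => W0.
  by have [-> ->] := emb_lr_indep W2h W3h W0.
- move=> X W _; rewrite memv0 => /eqP ->.
  have B0 : killing g X 0 = 0 by exact: linear0.
  have adp0 : adp g h (0 : V) = 0 by exact: linear0.
  by rewrite B0 mulr0 /isotropy_form adp0 comp_lfun0r lftr0.
- by move=> X W Xh Wu; apply: (isotropy_form_emb_l tf ga Xh (h1h _ Wu) Wu).
- by move=> X W Xh Wu; apply: (isotropy_form_emb_r tf ga Xh (h2h _ Wu) Wu).
by exists T; split.
Unshelve. all: by end_near. Qed.

End SkewGrassmann.

(** * Trace forms of the reals, the complex numbers and the quaternions *)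

Section TraceForms.
Variable R : realType.

Lemma lftr_real (f : 'End(R^o)) : lftr f = f 1.
Proof.
rewrite -[RHS]/(@idfun R^o (f 1)) -(@lftr_rank1 R R^o idfun (f 1)) //.
congr lftr; apply/lfunP => z.
rewrite linfunE => [|a u v]; last by rewrite scalerDl scalerA.
by rewrite -[in LHS](mulr1 z) -[z * 1]/(z *: 1) linearZ.
Qed.

Lemma real_trace_form : trace_form (@idfun R^o) (1 : R).
Proof.
split=> //.
- exact: mulrC.
- by move=> a a0; rewrite -[star a]/a -expr2 exprn_even_gt0.
- by move=> a; rewrite lftr_real lrmulE !mulr1 mul1r.
- by move=> a; rewrite lftr_real lrmulE !mul1r.
- by move=> a b; rewrite lftr_real star_lrmulE -[star 1]/1 -[star b]/b /= mulr1; ring.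
Qed.

Local Notation C := (Rcomplex R).

(** From [z = Re z + Im z i], [f] is a sum of two rank-one maps, whose traces are evaluations. *)
Lemma lftr_complex (f : 'End(C)) :
  lftr f = complex.Re (f 1) + complex.Im (f (Complex 0 1 : C)).
Proof.
have Re_lin : linear (fun z : C => complex.Re z : R^o) by move=> a [x y] [x' y'].
have Im_lin : linear (fun z : C => complex.Im z : R^o) by move=> a [x y] [x' y'].
rewrite -(lftr_rank1 (f 1) Re_lin) -(lftr_rank1 (f (Complex 0 1 : C)) Im_lin) -lftrD.
congr lftr; apply/lfunP => -[x y]; rewrite add_lfunE !linfunE => [|a u v|a u v].
- rewrite -!linearZ -linearD; congr (f _).
  by apply/eqP; rewrite eq_complex /=; apply/andP; split; apply/eqP; ring.
- by rewrite Im_lin scalerDl scalerA.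
- by rewrite Re_lin scalerDl scalerA.
Qed.

Lemma complex_trace_form : trace_form (fun z : C => complex.Re z : R^o) (2 : R).
Proof.
split.
- by move=> a [x y] [x' y'].
- by move=> a b; rewrite mulrC.
- move=> [x y] xy0; rewrite -[star _]/(Complex x (- y)) /=.
  rewrite mulrN opprK -!expr2 lt0r addr_ge0 ?sqr_ge0 // andbT.
  rewrite paddr_eq0 ?sqr_ge0 // !sqrf_eq0; apply: contra xy0.
  by move=> /andP[/eqP -> /eqP ->].
- by move=> [x y]; rewrite lftr_complex !lrmulE /=; ring.
- by move=> [x y]; rewrite lftr_complex !lrmulE /=; ring.
- move=> [x y] [x' y']; rewrite lftr_complex !star_lrmulE.
  have starE u v : star (Complex u v : C) = Complex u (- v) by [].
  by rewrite star1 !starE /=; ring.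
Qed.

Local Notation H := (quat R).

Lemma lftr_quat (f : 'End(H)) : lftr f =
  qre (f 1) + qi (f (Quat 0 1 0 0)) + qj (f (Quat 0 0 1 0)) + qk (f (Quat 0 0 0 1)).
Proof.
have re_lin : linear (fun z : H => qre z : R^o) by [].
have i_lin : linear (fun z : H => qi z : R^o) by [].
have j_lin : linear (fun z : H => qj z : R^o) by [].
have k_lin : linear (fun z : H => qk z : R^o) by [].
rewrite -(lftr_rank1 (f 1) re_lin) -(lftr_rank1 (f (Quat 0 1 0 0)) i_lin).
rewrite -(lftr_rank1 (f (Quat 0 0 1 0)) j_lin) -(lftr_rank1 (f (Quat 0 0 0 1)) k_lin).
have scl (phi : H -> R^o) w : linear phi -> linear (fun u => phi u *: w : H).
  by move=> phi_lin a u v; rewrite phi_lin scalerDl scalerA.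
rewrite -!lftrD; congr lftr; apply/lfunP => z; rewrite !add_lfunE.
rewrite !(linfunE _ (scl _ _ re_lin)) !(linfunE _ (scl _ _ i_lin)).
rewrite !(linfunE _ (scl _ _ j_lin)) !(linfunE _ (scl _ _ k_lin)).
rewrite -!linearZ -!linearD; congr (f _).
by case: z => a b c d; congr Quat => /=; ring.
Qed.

Lemma quat_trace_form : trace_form (fun z : H => qre z : R^o) (4 : R).
Proof.
split.
- by [].
- by move=> a b /=; ring.
- move=> [x y z t] x0; rewrite -[star _]/(Quat x (- y) (- z) (- t)) /=.
  rewrite !mulrN !opprK -!expr2 lt0r !addr_ge0 ?sqr_ge0 // andbT.
  rewrite !paddr_eq0 ?addr_ge0 ?sqr_ge0 // !sqrf_eq0; apply: contra x0.
  by move=> /andP[/andP[/andP[/eqP -> /eqP ->] /eqP ->] /eqP ->].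
- by move=> [x y z t]; rewrite lftr_quat !lrmulE /=; ring.
- by move=> [x y z t]; rewrite lftr_quat !lrmulE /=; ring.
- move=> [x y z t] [x' y' z' t']; rewrite lftr_quat !star_lrmulE.
  have starE u v w r : star (Quat u v w r) = Quat u (- v) (- w) (- r) by [].
  by rewrite star1 !starE /=; ring.
Qed.

Lemma quat_skew_re (x : H) : star x = - x -> qre x = 0.
Proof.
move=> /(congr1 (@qre R)); rewrite -[qre (star x)]/(qre x) => /eqP.
by rewrite -addr_eq0 -mulr2n mulrn_eq0 /= => /eqP.
Qed.

(** The trace of [z |-> x * z * a] is [4 qre x qre a], and a skew quaternion has no real part. *)
Lemma quat_skew_lrmull (x a : H) : star x = - x -> lftr (lrmul x a) = 0.
Proof.
move=> /quat_skew_re; case: x a => [x y z t] [x' y' z' t'] /= ->.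
by rewrite lftr_quat !lrmulE /=; ring.
Qed.

Lemma quat_skew_lrmulr (x a : H) : star x = - x -> lftr (lrmul a x) = 0.
Proof.
move=> /quat_skew_re; case: x a => [x y z t] [x' y' z' t'] /= ->.
by rewrite lftr_quat !lrmulE /=; ring.
Qed.

Lemma real_skew_eq0 (x : R^o) : star x = - x -> x = 0.
Proof.
by move=> /eqP; rewrite -[star x]/x -addr_eq0 -mulr2n mulrn_eq0 /= => /eqP.
Qed.

End TraceForms.

(** * Derivative of the determinant and the tangent space of the special unitary group *)

Section ComplexDeterminant.
Variables (R : realType) (E : normedModType R) (x v : E).
Local Notation C := (Rcomplex R).

Lemma is_vderive_complex_mul (f f' : E -> C) df df' :
  is_vderive x v f df -> is_vderive x v f' df' ->
  is_vderive x v (fun y => f y * f' y) (df * f' x + f x * df').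
Proof.
apply: (@is_vderive_bilinear R E C C C (fun a b => a * b)).
- by move=> a c b b'; rewrite mulrDr scalerAr.
- by move=> a c b b'; rewrite mulrDl scalerAl.
Qed.

(** [uniq r] ensures that the condition [k != i] removes exactly the differentiated factor. *)
Lemma is_vderive_complex_prod (I : eqType) (r : seq I) (f : I -> E -> C) df :
  uniq r -> (forall i, is_vderive x v (f i) (df i)) ->
  is_vderive x v (fun y => \prod_(i <- r) f i y)
    (\sum_(i <- r) df i * \prod_(k <- r | k != i) f k x).
Proof.
move=> + Df; elim: r => [_|a r IH /= /andP[ar ur]].
  by rewrite big_nil; under eq_fun do rewrite big_nil; exact: is_vderive_cst.
under eq_fun do rewrite big_cons.
have -> : \sum_(i <- a :: r) df i * \prod_(k <- a :: r | k != i) f k x =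
    df a * \prod_(i <- r) f i x
    + f a x * \sum_(i <- r) df i * \prod_(k <- r | k != i) f k x.
  rewrite big_cons big_cons eqxx /=; congr (_ + _).
    congr (_ * _); rewrite big_seq_cond [RHS]big_seq; apply: eq_bigl => k.
    by case: (boolP (k \in r)) => //= kr; apply: contraNneq ar => <-.
  rewrite mulr_sumr big_seq [RHS]big_seq; apply: eq_bigr => k kr.
  rewrite big_cons ifT; first by rewrite mulrCA.
  by apply: contraNneq ar => ->.
exact: (is_vderive_complex_mul (Df a) (IH ur)).
Qed.

(** In the expansion over permutations, a nontrivial permutation moves at least two indices, so
    after differentiation of one factor another off-diagonal entry of the identity remains. *)
Lemma is_vderive_det1 n (M : E -> 'M[C]_n) (N : 'M[C]_n) : M x = 1%:M ->
  (forall i j, is_vderive x v (fun y => M y i j : C) (N i j)) ->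
  is_vderive x v (fun y => \det (M y) : C) (\tr N).
Proof.
move=> Mx DM.
have D : is_vderive x v (fun y => \det (M y) : C)
    (\sum_(s : 'S_n) (-1) ^+ s *
      \sum_i N i (s i) * \prod_(k | k != i) M x k (s k)).
  apply: is_vderive_sum => s.
  have := is_vderive_complex_mul (is_vderive_cst ((-1) ^+ s : C) x v)
    (is_vderive_complex_prod (index_enum_uniq 'I_n) (fun i => DM i (s i))).
  by rewrite mul0r add0r.
rewrite (_ : \tr N = \sum_(s : 'S_n) (-1) ^+ s *
      \sum_i N i (s i) * \prod_(k | k != i) M x k (s k)) //.
rewrite (bigD1 1%g) //= odd_perm1 mul1r [X in _ = _ + X]big1 ?addr0.
  apply: eq_bigr => i _; rewrite perm1 big1 ?mulr1 // => k _.
  by rewrite Mx mxE perm1 eqxx.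
move=> s s1; rewrite big1 ?mulr0 // => i _.
(* If [s] moved only [i], it would fix [s i], and injectivity would give [s i = i]. *)
have [k ki sk] : exists2 k, k != i & s k != k.
  apply/exists_inP; apply: contraNT s1 => /exists_inPn sid.
  have sk k : k != i -> s k = k by move=> /sid; rewrite negbK => /eqP.
  apply/eqP/permP => k; rewrite perm1; have [->|/sk //] := eqVneq k i.
  apply/eqP; apply: contraT => si; have := sk _ si => /perm_inj si'.
  by rewrite si' eqxx in si.
by rewrite (bigD1 k) //= Mx mxE eq_sym (negPf sk) mulr0n mul0r mulr0.
Qed.

End ComplexDeterminant.

Section SpecialUnitary.
Variable R : realType.
Local Notation C := (Rcomplex R).

Lemma lie_suP n (X : kmx C n) :
  (X \in lie_su R n) = (star_tr X == - X) && (\tr (X : 'M[C]_n) == 0).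
Proof. by rewrite memv_cap memv_skewherm memv_traceless. Qed.

Lemma su_tangent n : tangent_in (grp_SU R n) (lie_su R n).
Proof.
move=> E c x v d cG Dc; rewrite lie_suP; apply/andP; split.
  apply/eqP/(unitary_tangent _ Dc); near=> y.
  by have [] : grp_SU R n (c y) by near: y; exact: cG.
have [cx_u cx_d] : grp_SU R n (c x) by exact: nbhs_singleton cG.
(* Translation by the inverse of [c x] brings the base point to the identity, where the derivative
   of the determinant is the trace. *)
pose M y : 'M[C]_n := star_tr (c x) *m c y.
have detX : \det (star_tr (c x) : 'M[C]_n) = 1.
  by have := congr1 (fun A : 'M[C]_n => \det A) cx_u; rewrite det_mulmx cx_d mulr1 det1.
have DM i j : is_vderive x v (fun y => M y i j : C)
    ((star_tr (c x) *m d) i j).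
  apply: (@is_vderive_linear R E (kmx C n) C (fun A => (star_tr (c x) *m A) i j)) Dc.
  by move=> a A A'; rewrite (@star_tr_mul_linearr R C n) !mxE.
have D1 := is_vderive_det1 cx_u DM.
apply/eqP; apply: is_vderive_uniq D1 _.
apply: (@is_vderive_near_line R E C (fun=> 1 : C)); last exact: is_vderive_cst.
have cl := near_line v cG.
near=> t; rewrite det_mulmx detX mul1r; apply/esym.
by have [] : grp_SU R n (c (t *: v + x)) by near: t; exact: cl.
Unshelve. all: by end_near. Qed.

End SpecialUnitary.

(** * The complex Grassmannian *)

Section SpecialUnitaryGrassmann.
Variables (R : realType) (p q : nat) (hp : (1 <= p)%N) (hq : (1 <= q)%N).
Local Notation C := (Rcomplex R).
Local Notation V := (kmx C (p + q)).
Local Notation g := (lie_su R (p + q)).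
Local Notation h := (g :&: blockdiag C p q)%VS.
Local Notation u1 := (centerv h).
Local Notation h1 := (emb_l q (lie_su R p)).
Local Notation h2 := (emb_r p (lie_su R q)).
Local Notation J := (blockJ C p q).

Let su_skew n (X : kmx C n) : X \in lie_su R n -> star_tr X = - X.
Proof. by rewrite lie_suP => /andP[/eqP]. Qed.

Let su_trace n (X : kmx C n) : X \in lie_su R n -> \tr (X : 'M[C]_n) = 0.
Proof. by rewrite lie_suP => /andP[_ /eqP]. Qed.

Let trJ (X : V) : \tr (J *m X *m J : 'M[C]_(p + q)) = \tr (X : 'M[C]_(p + q)).
Proof. by rewrite mxtrace_mulC mulmxA blockJ2 mul1mx. Qed.

Let lrmul0l (a : C) : lrmul 0 a = 0.
Proof. by apply/lfunP => z; rewrite lrmulE !mul0r zero_lfunE. Qed.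

Let lrmul0r (a : C) : lrmul a 0 = 0.
Proof. by apply/lfunP => z; rewrite lrmulE mulr0 zero_lfunE. Qed.

Lemma su_grassmann_algebra : grassmann_algebra (2 : R) g.
Proof.
split.
- rewrite (_ : _ - 4 + 2 * 2 = (p + q)%:R * 2); last by ring.
  by rewrite mulr_gt0 // ltr0n addn_gt0 hp.
- exact: su_skew.
- move=> X Y Xg Ys; rewrite lie_suP (star_tr_lbr (su_skew Xg) Ys) eqxx /=.
  by rewrite /lbr raddfB /= mxtrace_mulC subrr.
- by move=> X a /su_trace ->; rewrite lrmul0l lftr0.
- by move=> X a /su_trace ->; rewrite lrmul0r lftr0.
- move=> X Xg; rewrite lie_suP trJ (su_trace Xg) eqxx andbT.
  by rewrite !star_trM star_tr_blockJ (su_skew Xg) mulNmx mulmxN mulmxA.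
- move=> X Xs JX; rewrite lie_suP Xs eqxx /=.
  have : \tr (X : 'M[C]_(p + q)) = - \tr (X : 'M[C]_(p + q)).
    by rewrite -{1}trJ JX raddfN.
  move=> /eqP; rewrite -subr_eq0 opprK -mulr2n.
  by rewrite -(@scaler_nat R C) scaler_eq0 pnatr_eq0.
Qed.

Lemma su_block0 (A : kmx C p) (D : kmx C q) : (block_mx A 0 0 D \in g) =
  [&& star_tr A == - A, star_tr D == - D &
      \tr (A : 'M[C]_p) + \tr (D : 'M[C]_q) == 0].
Proof.
rewrite lie_suP -memv_skewherm skewherm_block0 !memv_skewherm.
by rewrite mxtrace_block andbA.
Qed.

Let star_tr_scalar n (a : C) : star_tr (a%:M : kmx C n) = (star a)%:M.
Proof.
apply/matrixP => i j; rewrite !mxE eq_sym.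
by case: eqP; rewrite ?mulr1n ?mulr0n ?star0.
Qed.

Let mem_h_block (A : kmx C p) (D : kmx C q) :
  (block_mx A 0 0 D \in h) = (block_mx A 0 0 D \in g).
Proof.
apply/memv_capP/idP => [[]//|Xg]; split=> //.
by rewrite memv_blockdiag block_mxKur block_mxKdl !eqxx.
Qed.

Let h_block (X : V) : X \in h -> exists A D, X = block_mx A 0 0 D.
Proof.
move=> /memv_capP[_]; rewrite memv_blockdiag => /andP[/eqP X12 /eqP X21].
exists (ulsubmx (X : 'M[C]_(p + q))), (drsubmx (X : 'M[C]_(p + q))).
by rewrite -[LHS](submxK (X : 'M[C]_(p + q))) X12 X21.
Qed.

(* The center is made of the traceless block-scalar matrices, onto which an
   element of [h] is projected by averaging the trace of each block. *)
Lemma su_blockdiag : h = (u1 + h1 + h2)%VS.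
Proof.
apply/eqP; rewrite eqEsubv !subv_add; apply/and3P; split; first last.
- apply/subvP => X /memv_emb_r[D]; rewrite lie_suP => /andP[Ds Dt] ->.
  rewrite mem_h_block su_block0 Ds (eqP Dt) mxtrace0 addr0 eqxx !andbT.
  by rewrite -memv_skewherm mem0v.
- apply/andP; split; first exact: capvSl.
  apply/subvP => X /memv_emb_l[A]; rewrite lie_suP => /andP[As At] ->.
  rewrite mem_h_block su_block0 As (eqP At) mxtrace0 addr0 eqxx !andbT /=.
  by rewrite -memv_skewherm mem0v.
apply/subvP => X Xh; have [A [D XE]] := h_block Xh; move: Xh.
rewrite {X}XE mem_h_block su_block0 => /and3P[/eqP As /eqP Ds /eqP ADt].
have avg n (B : kmx C n) (b : C) : (1 <= n)%N -> star_tr B = - B ->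
    b = (n%:R : R)^-1 *: \tr (B : 'M[C]_n) ->
    [/\ star b = - b, \tr (b%:M : 'M[C]_n) = \tr (B : 'M[C]_n) & B - b%:M \in lie_su R n].
  move=> n0 Bs bE; have sb : star b = - b.
    by rewrite bE starZ star_mxtrace Bs raddfN scalerN.
  have tb : \tr (b%:M : 'M[C]_n) = \tr (B : 'M[C]_n).
    by rewrite mxtrace_scalar bE -scaler_nat scalerA mulfV ?scale1r // pnatr_eq0 -lt0n.
  have trB : \tr (B - b%:M : 'M[C]_n) = \tr (B : 'M[C]_n) - \tr (b%:M : 'M[C]_n).
    exact: raddfB.
  have Nb : (- b)%:M = - b%:M :> 'M[C]_n by exact: raddfN.
  split=> //; rewrite lie_suP trB tb subrr eqxx andbT.
  by rewrite star_trB Bs star_tr_scalar sb Nb opprD.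
have [a aE] : exists a, a = (p%:R : R)^-1 *: \tr (A : 'M[C]_p) by eexists.
have [b bE] : exists b, b = (q%:R : R)^-1 *: \tr (D : 'M[C]_q) by eexists.
have [sa ta A0] := avg p A _ hp As aE; have [sb tb D0] := avg q D _ hq Ds bE.
have -> : block_mx A 0 0 D = block_mx a%:M 0 0 b%:M +
    block_mx (A - a%:M) 0 0 0 + block_mx 0 0 0 (D - b%:M) :> V.
  rewrite !add_block_mx !addr0; congr block_mx; first by rewrite addrC subrK.
  by rewrite addrC subrK.
apply: memv_add; last by apply/memv_emb_r; exists (D - b%:M).
apply: memv_add; last by apply/memv_emb_l; exists (A - a%:M).
apply/memv_centerv; split.
  rewrite mem_h_block su_block0 !star_tr_scalar sa sb ta tb ADt !raddfN !eqxx.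
  by [].
move=> Y /h_block[A' [D' ->]]; rewrite /lbr !mulmx_block !mulmx0 !mul0mx !addr0 !add0r.
by rewrite !scalar_mxC subrr.
Qed.

Local Notation a1 := (1 / 2 * (2 * q%:R / ((p + q)%:R * 2 - 4 + 2 * 2)) : R).
Local Notation a2 := (1 / 2 * (2 * p%:R / ((p + q)%:R * 2 - 4 + 2 * 2)) : R).

Let pn0 : (p%:R : R) != 0. Proof. by rewrite pnatr_eq0 -lt0n. Qed.
Let qn0 : (q%:R : R) != 0. Proof. by rewrite pnatr_eq0 -lt0n. Qed.
Let n_neq0 : (p%:R + q%:R : R) != 0.
Proof. by rewrite -natrD pnatr_eq0 addn_eq0 negb_and -lt0n hp. Qed.

Let a1E : a1 = 1 / 2 * (q%:R / (p + q)%:R).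
Proof.
rewrite natrD (_ : (p%:R + q%:R) * 2 - 4 + 2 * 2 = 2 * (p%:R + q%:R) :> R); last by ring.
by field; rewrite n_neq0.
Qed.

Let a2E : a2 = 1 / 2 * (p%:R / (p + q)%:R).
Proof.
rewrite natrD (_ : (p%:R + q%:R) * 2 - 4 + 2 * 2 = 2 * (p%:R + q%:R) :> R); last by ring.
by field; rewrite n_neq0.
Qed.

Let u1h (X : V) : X \in u1 -> X \in h.
Proof. by move: X; apply/subvP; rewrite {2}su_blockdiag -addvA addvSl. Qed.
Let h1h (X : V) : X \in h1 -> X \in h.
Proof. by move: X; apply/subvP; rewrite su_blockdiag [(u1 + h1)%VS]addvC -addvA addvSl. Qed.
Let h2h (X : V) : X \in h2 -> X \in h.
Proof. by move: X; apply/subvP; rewrite su_blockdiag addvSr. Qed.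

Let tf := complex_trace_form R.
Let sp := grassmann_symmetric_pair tf su_grassmann_algebra.

(* On the center the isotropy form is the Killing form, whereas on each block
   it is a proper multiple of it. *)
Let su_indep (W1 W2 W3 : V) : W1 \in u1 -> W2 \in h1 -> W3 \in h2 ->
  W1 + W2 + W3 = 0 -> [/\ W1 = 0, W2 = 0 & W3 = 0].
Proof.
move=> W1u W2u W3u W0.
have [W1h W2h W3h] := And3 (u1h W1u) (h1h W2u) (h2h W3u).
have Z0 : W1 + ((2 * a1) *: W2 + (2 * a2) *: W3) = 0.
  apply: (@sp_nondeg _ _ _ _ _ sp h); first exact: (sp_sub sp).
    by rewrite !memvD ?memvZ.
  move=> X Xh; rewrite !killingDr !killingZr.
  have := isotropy_form_centerv tf su_grassmann_algebra Xh W1u.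
  have := isotropy_form_emb_l tf su_grassmann_algebra Xh W2h W2u.
  have := isotropy_form_emb_r tf su_grassmann_algebra Xh W3h W3u.
  move=> <- <-; rewrite (_ : 2 * (1 / 2) = 1 :> R); last by field.
  rewrite mul1r => <-; rewrite addrA -!isotropy_formDr W0.
  exact: isotropy_form0r.
have W23 : (1 - 2 * a1) *: W2 + (1 - 2 * a2) *: W3 = 0.
  rewrite !scalerBl !scale1r addrACA -opprD -(addKr W1 (_ + (2 * a2) *: W3)) Z0 addr0.
  by rewrite opprK addrC addrA.
have [] := @emb_lr_indep _ _ p q (lie_su R p) (lie_su R q) _ _ _ _ W23.
- by rewrite memvZ.
- by rewrite memvZ.
have c1 : 1 - 2 * a1 != 0.
  rewrite a1E natrD (_ : _ - _ = p%:R / (p%:R + q%:R)); last by field.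
  by rewrite mulf_neq0 ?invr_neq0.
have c2 : 1 - 2 * a2 != 0.
  rewrite a2E natrD (_ : _ - _ = q%:R / (p%:R + q%:R)); last by field.
  by rewrite mulf_neq0 ?invr_neq0.
move=> /eqP; rewrite scaler_eq0 (negPf c1) /= => /eqP W20.
move=> /eqP; rewrite scaler_eq0 (negPf c2) /= => /eqP W30.
by move: W0; rewrite W20 W30 !addr0.
Qed.

Let su_direct : directv (u1 + h1 + h2).
Proof.
rewrite directv_addE /= directv_addE /= !directv_trivial /=; apply/andP; split.
  rewrite -subv0; apply/subvP => X /memv_capP[X1 X2].
  have [] := @su_indep X (- X) 0 X1; rewrite ?memvN ?mem0v ?subrr ?addr0 //.
  by move=> -> _ _; rewrite mem0v.
rewrite -subv0; apply/subvP => X /memv_capP[/memv_addP[X1 X1u [X2 X2u XE]] X3].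
have [] := @su_indep X1 X2 (- X) X1u X2u; rewrite ?memvN // -?XE ?subrr //.
by move=> _ _ /eqP; rewrite oppr_eq0 memv0.
Qed.

Lemma su_grassmann :
  [/\ h = (u1 + h1 + h2)%VS, directv (u1 + h1 + h2) &
      forall s : 'rV[R]_(\dim (orthk g h)) -> V,
      local_param (grp_SU R (p + q)) g h s ->
      exists T : 'End(subvs_of h),
      [/\ unique (curvature_operator_on_h g h s) T,
          scalar_on T u1 (1 / 2),
          scalar_on T h1 (1 / 2 * (q%:R / (p + q)%:R)) &
          scalar_on T h2 (1 / 2 * (p%:R / (p + q)%:R))]].
Proof.
split; [exact: su_blockdiag|exact: su_direct|move=> s lps].
rewrite -a1E -a2E; have ga := su_grassmann_algebra.
apply: (curvature_operator_scalars sp _ _ su_blockdiag su_indep _ _ _ _ _ _ lps).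
- by move=> X [].
- exact: su_tangent.
- by rewrite mulf_neq0 ?oner_eq0 ?invr_eq0 ?pnatr_eq0.
- by rewrite a1E natrD !mulf_neq0 ?invr_neq0 // ?oner_eq0 ?pnatr_eq0.
- by rewrite a2E natrD !mulf_neq0 ?invr_neq0 // ?oner_eq0 ?pnatr_eq0.
- by move=> X W Xh Wu; apply: (isotropy_form_centerv tf ga Xh Wu).
- by move=> X W Xh Wu; apply: (isotropy_form_emb_l tf ga Xh (h1h Wu) Wu).
- by move=> X W Xh Wu; apply: (isotropy_form_emb_r tf ga Xh (h2h Wu) Wu).
Qed.

End SpecialUnitaryGrassmann.

Theorem mainTheorem4 (R : realType) (p q : nat) (hp : (1 <= p)%N) (hq : (1 <= q)%N) :
  [/\ let g := lie_su R (p + q) in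
      let h := (g :&: blockdiag (Rcomplex R) p q)%VS in
      let u1 := centerv h in
      let h1 := emb_l q (lie_su R p) in
      let h2 := emb_r p (lie_su R q) in
      [/\ h = (u1 + h1 + h2)%VS, directv (u1 + h1 + h2) &
          forall s : 'rV[R]_(\dim (orthk g h)) -> kmx (Rcomplex R) (p + q),
            local_param (grp_SU R (p + q)) g h s ->
            exists T : 'End(subvs_of h),
            [/\ unique (curvature_operator_on_h g h s) T,
                scalar_on T u1 (1 / 2),
                scalar_on T h1 (1 / 2 * (q%:R / (p + q)%:R)) &
                scalar_on T h2 (1 / 2 * (p%:R / (p + q)%:R))]],
      let g := lie_sp R (p + q) in
      let h := (g :&: blockdiag (quat R) p q)%VS in
      let h1 := emb_l q (lie_sp R p) in
      let h2 := emb_r p (lie_sp R q) in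
      [/\ h = (h1 + h2)%VS, directv (h1 + h2) &
          forall s : 'rV[R]_(\dim (orthk g h)) -> kmx (quat R) (p + q),
            local_param (grp_Sp R (p + q)) g h s ->
            exists T : 'End(subvs_of h),
            [/\ unique (curvature_operator_on_h g h s) T,
                scalar_on T h1 (1 / 2 * (q%:R / (p + q + 1)%:R)) &
                scalar_on T h2 (1 / 2 * (p%:R / (p + q + 1)%:R))]] &
      (3 <= p + q)%N ->
      let g := lie_so R (p + q) in
      let h := (g :&: blockdiag R^o p q)%VS in
      let h1 := emb_l q (lie_so R p) in
      let h2 := emb_r p (lie_so R q) in
      [/\ h = (h1 + h2)%VS, directv (h1 + h2) &
          forall s : 'rV[R]_(\dim (orthk g h)) -> kmx R^o (p + q),
            local_param (grp_SO R (p + q)) g h s ->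
            exists T : 'End(subvs_of h),
            [/\ unique (curvature_operator_on_h g h s) T,
                scalar_on T h1 (1 / 2 * (q%:R / ((p + q)%:R - 2))) &
                scalar_on T h2 (1 / 2 * (p%:R / ((p + q)%:R - 2)))]]].
Proof.
split; first exact: su_grassmann.
- move=> g h h1 h2.
  (* For [d = 4] the Killing constant is [4 (p + q + 1)], the origin of the [+ 1] in the
     denominators. *)
  have k0 : 0 < (p + q)%:R * 4 - 4 + 2 * 4 :> R.
    have -> : (p + q)%:R * 4 - 4 + 2 * 4 = (p + q)%:R * 4 + 4 :> R by ring.
    by rewrite ltr_wpDl // mulr_ge0.
  have := skewherm_grassmann (quat_trace_form R) hp hq (ltr0n R 4) k0
    (@quat_skew_lrmull R) (@quat_skew_lrmulr R) (G := grp_Sp R (p + q)) (fun X GX => GX).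
  have aE (k : nat) : 1 / 2 * (4 * k%:R / ((p + q)%:R * 4 - 4 + 2 * 4)) =
      1 / 2 * (k%:R / (p + q + 1)%:R) :> R.
    have n0 : ((p + q + 1)%:R : R) != 0 by rewrite pnatr_eq0 addn1.
    have -> : (p + q)%:R * 4 - 4 + 2 * 4 = 4 * (p + q + 1)%:R :> R.
      by rewrite [(p + q + 1)%:R]natrD; ring.
    by move: ((p + q + 1)%:R) n0 => n n0; field.
  by rewrite !aE.
- move=> pq3 g h h1 h2.
  (* The assumption [3 <= p + q] enters here: for [d = 1] the Killing constant is [p + q - 2]. *)
  have n2 : 0 < (p + q)%:R - 2 :> R by rewrite subr_gt0 ltr_nat.
  have k0 : 0 < (p + q)%:R * 1 - 4 + 2 * 1 :> R.
    by rewrite (_ : _ - 4 + _ = (p + q)%:R - 2 :> R) //; ring.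
  have zl (x a : R^o) : star x = - x -> lftr (lrmul x a) = 0.
    by move=> /real_skew_eq0 ->; rewrite lftr_real lrmulE !mul0r.
  have zr (x a : R^o) : star x = - x -> lftr (lrmul a x) = 0.
    by move=> /real_skew_eq0 ->; rewrite lftr_real lrmulE mulr0.
  have := skewherm_grassmann (real_trace_form R) hp hq ltr01 k0 zl zr
    (G := grp_SO R (p + q)) (fun X GX => proj1 GX).
  have aE (k : nat) : 1 / 2 * (1 * k%:R / ((p + q)%:R * 1 - 4 + 2 * 1)) =
      1 / 2 * (k%:R / ((p + q)%:R - 2)) :> R.
    by rewrite mul1r (_ : _ - 4 + _ = (p + q)%:R - 2 :> R) //; ring.
  by rewrite !aE.
Qed.
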